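(* (a) Assume $\mathbf{\Pi}^1_3$-Determinacy. Then for every game $G=(\pi_1,\pi_2)$ with Polish strategy spaces $X_1,X_2$ and bounded analytically measurable payoffs $\pi_i:X_1\times X_2\to\mathbb{R}$, $\mathrm{RAT}_i(G)=\mathrm{RCBR}_i(G)$ for each $i\in\{1,2\}$. (b) Assume Projective Determinacy. Then for every game $G=(\pi_1,\pi_2)$ with Polish strategy spaces $X_1,X_2$ and bounded projective payoffs $\pi_i:X_1\times X_2\to\mathbb{R}$, $\mathrm{RAT}_i(G)=\mathrm{RCBR}_i(G)$ for each $i\in\{1,2\}$.
   Context: Conventions. $\mathbf{\Sigma}^1_n,\mathbf{\Pi}^1_n$ are the boldface projective classes. $\mathbf{\Pi}^1_n$-Determinacy: every Gale–Stewart game on $\omega$ with $\mathbf{\Pi}^1_n$ payoff set is determined; Projective Determinacy: this holds for all projective payoff sets. A function is analytically measurable if it is measurable with respect to the $\sigma$-algebra generated by the analytic sets; a function is projective if its graph is a projective set. For a Polish space $X$, $\Delta(X)$ is the Polish space of Borel probability measures on $X$ (weak topology). A measure is identified with its completion; for arbitrary $S\subseteq X$, ''$\mu(S)=1$'' means $S$ is measurable for the completion of $\mu$ and has measure one. Always $\{i,j\}=\{1,2\}$. Games. A (two-person strategic form) game $G=(\pi_1,\pi_2)$ is a pair of bounded (universally measurable) functions $\pi_i:X_1\times X_2\to\mathbb{R}$, with $X_1,X_2$ Polish (strategy spaces). For $s\in X_i$ and $\mu\in\Delta(X_j)$, $\pi_i(s,\mu)$ is the integral over $y\in X_j$ with respect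 to $\mu$ of player $i$'s payoff when $i$ plays $s$ and $j$ plays $y$. $s$ is a best response to $\mu$ if $\pi_i(s,\mu)\ge\pi_i(\bar s,\mu)$ for all $\bar s\in X_i$. Let $E_i^G=\{(s,\mu)\in X_i\times\Delta(X_j) : s\text{ is a best response to }\mu\}$. Rationalizability. Put $X_i^0=X_i$; $X_i^{\alpha+1}=\{s\in X_i^\alpha : \exists\mu\in\Delta(X_j)\ (\mu(X_j^\alpha)=1 \text{ and } (s,\mu)\in E_i^G)\}$; and $X_i^\alpha=\bigcap_{\beta<\alpha}X_i^\beta$ for limit $\alpha$. With $\alpha$ least such that $X_i^{\alpha+1}=X_i^\alpha$ for both $i$, $\mathrm{RAT}_i(G)=X_i^\alpha$ is the set of rationalizable strategies of player $i$. Type spaces. Put $X_i^{(0)}=X_j$ and $X_i^{(n)}=X_i^{(n-1)}\times\Delta(X_j^{(n-1)})$ for $n>0$. Let $T_i^0=\prod_{n>0}\Delta(X_i^{(n-1)})$, and let $T_i^1\subseteq T_i^0$ be the set of sequences $\delta_i=(\delta_i^1,\delta_i^2,\dots)$ with $\mathrm{marg}_{X_i^{(n-2)}}(\delta_i^n)=\delta_i^{n-1}$ for all $n>1$. By Kolmogorov extension each $\delta_i\in T_i^1$ determines a unique $\delta_i^*\in\Delta(X_j\times T_j^0)$ with $\mathrm{marg}_{X_i^{(n)}}\delta_i^*=\delta_i^{n+1}$ for all $n\ge 0$. For $k>1$ let $T_i^k=\{\delta_i\in T_i^1:\delta_i^*(X_j\times T_j^{k-1})=1\}$ and $T_i=\bigcap_{k\geq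 1}T_i^k$. Then $T_i$ is Polish and $\lambda_i(\delta_i)=\delta_i^*$ defines a homeomorphism $\lambda_i:T_i\to\Delta(X_j\times T_j)$. RCBR. Let $R_i^1=\{(s,t)\in X_i\times T_i : (s,\mathrm{marg}_{X_j}\lambda_i(t))\in E_i^G\}$ and $R_i^{n+1}=\{(s,t)\in R_i^n : \lambda_i(t)(R_j^n)=1\}$ for $n\ge1$. $\mathrm{RCBR}_i(G)=\{s\in X_i:\exists t\in T_i\ \forall n\ge 1\ (s,t)\in R_i^n\}$ is the set of strategies of player $i$ consistent with Rationality and Common Belief in Rationality. *)

(* Defs.v *)
From HB Require Import structures.
From mathcomp Require Import all_boot all_order all_algebra.
From mathcomp Require Import all_classical all_reals all_analysis.
From mathcomp Require wochoice.
Import Order.TTheory GRing.Theory Num.Theory.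
Import numFieldNormedType.Exports.

Set Implicit Arguments.
Unset Strict Implicit.
Unset Printing Implicit Defensive.

Local Open Scope classical_set_scope.
Local Open Scope ring_scope.

Definition is_metric (R : realType) (T : Type) (d : T -> T -> R) : Prop :=
  [/\ forall x y, 0 <= d x y,
      forall x y, d x y = 0 <-> x = y,
      forall x y, d x y = d y x &
      forall x y z, d x z <= d x y + d y z].

Definition metrizes (R : realType) (T : topologicalType) (d : T -> T -> R) :
    Prop :=
  forall (x : T) (U : set T),
    nbhs x U <-> exists2 e : R, 0 < e & [set y | d x y < e] `<=` U.

Definition complete_metric (R : realType) (T : topologicalType)
    (d : T -> T -> R) : Prop :=
  forall u : nat -> T,
    (forall e : R, 0 < e ->
       exists N, forall m n, (N <= m)%N -> (N <= n)%N -> d (u m) (u n) < e) ->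
    exists x : T, u @ \oo --> x.

Definition polish (R : realType) (T : topologicalType) : Prop :=
  (exists2 D : set T, countable D & dense D) /\
  (exists d : T -> T -> R, [/\ is_metric d, metrizes d & complete_metric d]).

Definition baire : topologicalType := prod_topology (fun _ : nat => nat).

(* [Sigma1 n] is the boldface class $\mathbf\Sigma^1_n$ for $n \geq 1$; level
   0 is only the start of the recursion, arranged so that
   $\mathbf\Sigma^1_1$ consists of the projections of closed sets. *)
Fixpoint Sigma1 (n : nat) (T : topologicalType) : set (set T) :=
  match n with
  | 0 => open
  | m.+1 => [set A : set T | exists2 C : set (T * baire)%type,
               Sigma1 m (~` C) & A = fst @` C]
  end.

Definition Pi1 (n : nat) (T : topologicalType) : set (set T) :=
  [set A : set T | Sigma1 n (~` A)].

Definition analytic (T : topologicalType) : set (set T) := @Sigma1 1 T.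

Definition projective (T : topologicalType) : set (set T) :=
  [set A : set T | exists n : nat, Sigma1 n.+1 A].

(* Player I chooses [x 0], [x 2], ... and player II chooses [x 1], [x 3], ...;
   a strategy maps the finite position reached so far to the next move. *)
Definition winning_I (A : set baire) (sigma : seq nat -> nat) : Prop :=
  forall x : baire, (forall k, x k.*2 = sigma (mkseq x k.*2)) -> A x.

Definition winning_II (A : set baire) (tau : seq nat -> nat) : Prop :=
  forall x : baire, (forall k, x k.*2.+1 = tau (mkseq x k.*2.+1)) -> ~ A x.

Definition determined (A : set baire) : Prop :=
  (exists sigma, winning_I A sigma) \/ (exists tau, winning_II A tau).

Definition Pi1_determinacy (n : nat) : Prop :=
  forall A : set baire, Pi1 n A -> determined A.

Definition projective_determinacy : Prop :=
  forall A : set baire, projective A -> determined A.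

Definition analytically_measurable (R : realType) (T : ptopologicalType)
    (f : T -> R) : Prop :=
  forall B : set R, <<s open >> B -> <<s @analytic T >> (f @^-1` B).

Definition projective_fun (R : realType) (T : topologicalType) (f : T -> R) :
    Prop :=
  projective [set p : (T * R)%type | p.2 = f p.1].

HB.instance Definition _ (T U : ptopologicalType) := Pointed.on (T * U)%type.

HB.instance Definition _ (I : Type) (T : I -> ptopologicalType) :=
  Pointed.copy (prod_topology T) (forall i, T i).

Definition borel (T : ptopologicalType) :
    measurableType (sigma_display (@open T)) :=
  g_sigma_algebraType (@open T).

Section zero_off_borel.
Context (R : realType) (T : ptopologicalType) (P : probability (borel T) R).

Definition zero_off : set (borel T) -> \bar R :=
  fun A => if `[< measurable A >] then P A else 0%E.

Let zero_offE A : measurable A -> zero_off A = P A.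
Proof. by move=> mA; rewrite /zero_off asboolT. Qed.

Let zero_off0 : zero_off set0 = 0%E.
Proof. by rewrite zero_offE// measure0. Qed.

Let zero_off_ge0 A : (0 <= zero_off A)%E.
Proof. by rewrite /zero_off; case: ifP. Qed.

Let zero_off_sigma_additive : semi_sigma_additive zero_off.
Proof.
move=> F mF tF mUF; rewrite zero_offE//.
under eq_fun do under eq_bigr do rewrite zero_offE//.
exact: measure_semi_sigma_additive.
Qed.

HB.instance Definition _ := isMeasure.Build _ _ _ zero_off
  zero_off0 zero_off_ge0 zero_off_sigma_additive.

Let zero_off_setT : zero_off setT = 1%E.
Proof. by rewrite zero_offE// probability_setT. Qed.

HB.instance Definition _ :=
  Measure_isProbability.Build _ _ _ zero_off zero_off_setT.

Lemma zero_off_out (A : set (borel T)) :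
  ~ measurable A -> (zero_off : probability (borel T) R) A = 0%E.
Proof. by move=> nA; rewrite /= /zero_off asboolF. Qed.

End zero_off_borel.

(* A library measure is a function on all sets, arbitrary outside the
   sigma-algebra; requiring the value 0 there makes two elements of
   [Delta R T] equal as soon as they agree on the Borel sets. *)
Definition Delta (R : realType) (T : ptopologicalType) : Type :=
  {mu : probability (borel T) R |
    forall A : set (borel T), ~ measurable A -> mu A = 0%E}.

Definition Delta_prob (R : realType) (T : ptopologicalType)
  (mu : Delta R T) : probability (borel T) R := sval mu.
Coercion Delta_prob : Delta >-> probability.

Definition to_Delta (R : realType) (T : ptopologicalType)
    (P : probability (borel T) R) : Delta R T :=
  exist _ (zero_off P : probability (borel T) R) (@zero_off_out R T P).

Section Delta_topology.
Context (R : realType) (T : ptopologicalType).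

Definition bounded_continuous : Type :=
  {f : T -> R | continuous f /\ exists M : R, forall x, `|f x| <= M}.

Definition Delta_eval (mu : Delta R T) :
    prod_topology (fun _ : bounded_continuous => R) :=
  fun f => \int[mu]_x (sval f : borel T -> R) x.

HB.instance Definition _ := gen_eqMixin (Delta R T).
HB.instance Definition _ := gen_choiceMixin (Delta R T).
HB.instance Definition _ :=
  isPointed.Build (Delta R T) (to_Delta (dirac (point : borel T))).

(* the weak topology, i.e. the coarsest one making every
   $\mu \mapsto \int f\,d\mu$, $f$ bounded and continuous, continuous *)
HB.instance Definition _ :=
  Topological.copy (Delta R T) (initial_topology Delta_eval).

End Delta_topology.

Lemma continuous_borel (T U : ptopologicalType) (f : T -> U) :
  continuous f -> measurable_fun [set: borel T] (f : borel T -> borel U).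
Proof.
move=> cf; apply: (@measurability _ _ (borel T) (borel U) _ _ open) => //.
move=> _ [B oB <-]; rewrite setTI; apply: sub_sigma_algebra.
by move/continuousP: cf; exact.
Qed.

Definition mfun_of_continuous (T U : ptopologicalType) (f : T -> U)
    (cf : continuous f) : {mfun borel T >-> borel U} :=
  HB.pack (f : borel T -> borel U)
    (isMeasurableFun.Build _ _ _ _ _ (continuous_borel cf)).

Definition fst_mfun (T U : ptopologicalType) :
    {mfun borel (T * U)%type >-> borel T} :=
  @mfun_of_continuous (T * U)%type T fst (fun z => cvg_fst).
Arguments fst_mfun {T U}.

Definition marg (R : realType) (T U : ptopologicalType)
    (f : {mfun borel T >-> borel U}) (mu : Delta R T) : Delta R U :=
  to_Delta (distribution mu f).

Definition outer (R : realType) (T : ptopologicalType) (mu : Delta R T) :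
    {outer_measure set (borel T) -> \bar R} := mu_ext (Delta_prob mu).

(* The Caratheodory sets of the outer measure of [mu] form the completed
   sigma-algebra because [mu] is finite. *)
Definition completion (R : realType) (T : ptopologicalType) (mu : Delta R T) :
    {measure set (caratheodory_type (outer mu)) -> \bar R} :=
  @completed_measure_extension _ (borel T) R (Delta_prob mu).

Definition has_measure_one (R : realType) (T : ptopologicalType)
    (mu : Delta R T) (S : set T) : Prop :=
  measurable (S : set (caratheodory_type (outer mu))) /\
  completion mu S = 1%E.

Definition completed_integral (R : realType) (T : ptopologicalType)
    (mu : Delta R T) (f : T -> R) : R :=
  \int[completion mu]_y (f : caratheodory_type (outer mu) -> R) y.

Variant player : Type := One | Two.

Definition opponent (i : player) : player :=
  match i with One => Two | Two => One end.

(* The library's measurable spaces are pointed, so strategy spaces are nonempty;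
   the chosen points play no role.
   Universal measurability of the payoffs is not a field: it is a consequence
   of each of the measurability assumptions made on them together with the
   corresponding determinacy assumption. *)
Record game (R : realType) : Type := Game {
  space1 : ptopologicalType;
  space2 : ptopologicalType;
  space1_polish : polish R space1;
  space2_polish : polish R space2;
  pay : player -> space1 * space2 -> R;
  pay_bounded : forall i, exists M : R, forall z, `|pay i z| <= M
}.
Arguments pay {R} g _ _.

Section game.
Context (R : realType) (G : game R).

Definition strat (i : player) : ptopologicalType :=
  match i with One => space1 G | Two => space2 G end.

Definition payoff (i : player) : strat i -> strat (opponent i) -> R :=
  match i return strat i -> strat (opponent i) -> R with
  | One => fun s y => pay G One (s, y)
  | Two => fun s y => pay G Two (y, s)
  end.

Definition expected (i : player) (s : strat i)
    (mu : Delta R (strat (opponent i))) : R :=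
  completed_integral mu (payoff s).

Definition best_response (i : player) :
    set (strat i * Delta R (strat (opponent i)))%type :=
  [set z | forall s' : strat i, expected s' z.2 <= expected z.1 z.2].
Arguments best_response i : clear implicits.

Definition reduce (Y : forall i, set (strat i)) (i : player) :
    set (strat i) :=
  [set s | Y i s /\ exists mu : Delta R (strat (opponent i)),
     has_measure_one mu (Y (opponent i)) /\ best_response i (s, mu)].
Arguments reduce Y i : clear implicits.

Definition precedes (W : Type) (le : rel W) (b a : W) : Prop :=
  le b a /\ b <> a.

Definition is_least (W : Type) (le : rel W) (a : W) : Prop :=
  forall b, le a b.

Definition is_successor (W : Type) (le : rel W) (b a : W) : Prop :=
  precedes le b a /\ forall c, precedes le b c -> le a c.

Definition is_limit (W : Type) (le : rel W) (a : W) : Prop :=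
  ~ is_least le a /\ ~ exists b, is_successor le b a.

(* Ordinals are represented by the elements of a well-ordered type [W]; a stage
   $\alpha + 1$ is always obtained as [reduce (Y a)], so that [a] need not have
   a successor in [W]. *)
Definition reduction_sequence (W : Type) (le : rel W)
    (Y : W -> forall i, set (strat i)) : Prop :=
  [/\ forall a, is_least le a -> forall i, Y a i = setT,
      forall b a, is_successor le b a -> forall i, Y a i = reduce (Y b) i &
      forall a, is_limit le a ->
        forall i, Y a i = \bigcap_(b in [set b | precedes le b a]) Y b i].

Definition stable (Y : forall i, set (strat i)) : Prop :=
  forall i, reduce Y i = Y i.

Definition RAT (i : player) : set (strat i) :=
  [set s | exists (W : Type) (le : rel W) (Y : W -> forall i, set (strat i))
             (a : W),
     [/\ wochoice.well_order le, reduction_sequence le Y, stable (Y a),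
         (forall b, precedes le b a -> ~ stable (Y b)) & Y a i s]].

Fixpoint level (n : nat) (i : player) : ptopologicalType :=
  match n with
  | 0 => strat (opponent i)
  | m.+1 => (level m i * Delta R (level m (opponent i)))%type
  end.

(* the [n]-th coordinate of a hierarchy is $\delta_i^{n+1}$ *)
Definition hierarchy (i : player) : ptopologicalType :=
  prod_topology (fun n : nat => Delta R (level n i)).

Fixpoint level_proj (n : nat) (i : player) :
    strat (opponent i) * hierarchy (opponent i) -> level n i :=
  match n return strat (opponent i) * hierarchy (opponent i) -> level n i with
  | 0 => fun z => z.1
  | m.+1 => fun z => (level_proj m z, z.2 m)
  end.
Arguments level_proj n i : clear implicits.

Lemma level_proj_continuous n i : continuous (level_proj n i).
Proof.
elim: n => [|n IHn] z; first exact: cvg_fst.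
apply: (@cvg_pair _ _ _ _ (nbhs (level_proj n i z)) (nbhs (z.2 n))).
  exact: IHn.
apply: (@cvg_comp _ _ _ snd (fun t : hierarchy (opponent i) => t n) _ (nbhs z.2)).
  exact: cvg_snd.
exact: (@proj_continuous _ (fun n => Delta R (level n (opponent i))) n z.2).
Qed.

Definition level_mfun (n : nat) (i : player) :
    {mfun borel (strat (opponent i) * hierarchy (opponent i))%type >-> borel (level n i)} :=
  mfun_of_continuous (@level_proj_continuous n i).

Definition coherent (i : player) : set (hierarchy i) :=
  [set d | forall n : nat,
     @marg R (level n.+1 i) (level n i) fst_mfun (d n.+1) = d n].
Arguments coherent i : clear implicits.

(* $\delta_i^*$: for a coherent hierarchy over Polish spaces there is exactly
   one such measure, by Kolmogorov's extension theorem *)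
Definition belief (i : player) (d : hierarchy i) :
    Delta R (strat (opponent i) * hierarchy (opponent i))%type :=
  get [set nu : Delta R (strat (opponent i) * hierarchy (opponent i))%type |
       forall n : nat, marg (level_mfun n i) nu = d n].

Fixpoint types_upto (k : nat) (i : player) : set (hierarchy i) :=
  match k with
  | 0 => setT
  | 1 => coherent i
  | m.+1 => [set d | coherent i d /\
      has_measure_one (belief d) [set z | @types_upto m (opponent i) z.2]]
  end.
Arguments types_upto k i : clear implicits.

(* A probability measure on $X_j \times T_j$ is identified with one on the
   product of $X_j$ with the space of all hierarchies of $j$ that gives measure
   one to $X_j \times T_j$; under this identification [belief] restricted to
   [types i] is $\lambda_i$. *)
Definition types (i : player) : set (hierarchy i) :=
  \bigcap_(k in [set k : nat | (1 <= k)%N]) types_upto k i.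
Arguments types i : clear implicits.

(* [RCB n i] is $R_i^{n+1}$ *)
Fixpoint RCB (n : nat) (i : player) : set (strat i * hierarchy i)%type :=
  match n with
  | 0 => [set z | types i z.2 /\
      best_response i (z.1, marg fst_mfun (belief z.2))]
  | m.+1 => [set z | @RCB m i z /\
      has_measure_one (belief z.2) (@RCB m (opponent i))]
  end.
Arguments RCB n i : clear implicits.

Definition RCBR (i : player) : set (strat i) :=
  [set s | exists2 t : hierarchy i, types i t & forall n : nat, RCB n i (s, t)].

End game.

Arguments RAT {R} G i.
Arguments RCBR {R} G i.

(* Main.v *)
(* Both RAT and RCBR are the largest family Y such that every strategy in Y_i is
   a best response to a measure concentrated on Y_j; the difficulty is the
   measurability of Y. Strategies and measures are coded by reals, so that the
   complement of Y becomes the least fixed point of an operator preserving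
   Pi^1_(n+1), n even. Determinacy gives Pi^1_(n+1) the prewellordering property,
   and norm induction makes the complement of Y a Pi^1_(n+1) set. A covering game
   of the same complexity shows that Sigma^1_(n+1) sets are universally
   measurable, that the class is closed under "has outer measure > r", and that
   its relations have Borel uniformizations almost everywhere.

   RCBR is contained in Y because it is a best-response family in the weak sense
   that beliefs give outer measure one to it, and a strategy of minimal norm
   refutes any such family not contained in Y. Conversely, Borel selections of
   best responses, iterated along countably many measures and trimmed by null
   sets, give Borel sets D_i and kernels f_i with f_i(s)(D_j) = 1 for s in D_i; the
   type of s that believes f_i(s), and believes each opponent y to be of the type
   of y, then exhibits D_i as a subset of RCBR. *)

From HB Require Import structures.
Require Import Defs.
From mathcomp Require Import all_boot all_order all_algebra.
From mathcomp Require Import all_classical all_reals all_analysis.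
From mathcomp Require Import ring lra zify.
From mathcomp Require wochoice measurable_realfun.
Import measurable_realfun.
Import Order.TTheory GRing.Theory Num.Theory.
Import numFieldNormedType.Exports.

Set Implicit Arguments.
Unset Strict Implicit.
Unset Printing Implicit Defensive.

Local Open Scope classical_set_scope.
Local Open Scope ring_scope.

(** * Baire space and its Borel sets *)

(** Parity ties the levels together. Payoffs are both Sigma and Pi at an even level k, so best
    response is Pi at level k and the existence of a suitable measure is Sigma at level k + 1. The
    eliminated strategies thus form a Pi set at an odd level, where periodicity supplies norms.
    Analytically measurable payoffs have k = 2, whence level 3 in (a).

    RCBR is a projection of a countable intersection, and its measurability is known only once it is
    identified with Y. Hence Y has to be maximal even among families supported merely in outer
    measure.

    The types built from beliefs are image measures, so the beliefs must depend on the strategy in a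
    Borel way. Borel choices exist only almost everywhere for a measure fixed in advance, while the
    chosen beliefs may charge the exceptional set of the opponent. The average of the chosen beliefs
    is therefore taken as the next measure; only countably many null sets have to be trimmed, and
    starting from Dirac masses protects the given strategy. *)

Definition cyl (p : seq nat) : set baire := [set x : baire | mkseq x (size p) = p].

Lemma coord_continuous i : continuous (fun x : baire => x i).
Proof. exact: (@proj_continuous _ (fun _ : nat => nat)). Qed.

Lemma mkseq_eqP (x y : nat -> nat) k :
  mkseq x k = mkseq y k <-> forall i, (i < k)%N -> x i = y i.
Proof.
split=> [xy i ik|xy].
  by rewrite -(nth_mkseq 0%N x ik) -(nth_mkseq 0%N y ik) xy.
by apply/eq_in_map => i; rewrite mem_iota => /andP[_]; exact: xy.
Qed.

Lemma cyl_mkseq (x y : baire) k : cyl (mkseq x k) y <-> forall i, (i < k)%N -> y i = x i.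
Proof. by rewrite /cyl /= size_mkseq; exact: mkseq_eqP. Qed.

Lemma nbhs_cyl (x : baire) (U : set baire) :
  nbhs x U <-> exists k, cyl (mkseq x k) `<=` U.
Proof.
split=> [|[k kU]].
- pose F := filter_from [set: nat] (fun k => cyl (mkseq x k)).
  have FF : ProperFilter F.
    apply: filter_from_proper; last first.
      by move=> k _; exists x; apply/cyl_mkseq.
    apply: filter_from_filter; first by exists 0%N.
    move=> i j _ _; exists (maxn i j) => // y /cyl_mkseq yx.
    by split; apply/cyl_mkseq => l li; apply: yx; rewrite leq_max li ?orbT.
  have : F --> x.
    apply/(@cvg_sup) => i; apply/cvg_image; first by rewrite eqEsubset; split => // v _; exists (fun _ => v).
    move=> W Wx; exists [set f : baire | W (f i)].
      exists i.+1 => // y /cyl_mkseq yx; rewrite /= (yx i)//; exact: nbhs_singleton Wx.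
    by apply/seteqP; split => [v [f Wf <-]//|v Wv]; exists (fun=> v).
  by move=> Fx Ux; have [k _ kU] := Fx _ Ux; exists k.
- apply: filterS kU _; elim: k => [|k IHk]; first by apply: filterS filterT => y _; apply/cyl_mkseq.
  have := coord_continuous (discrete_set1 (x k : nat)).
  move=> /(filterI IHk); apply: filterS => y [/cyl_mkseq yx /= yk].
  by apply/cyl_mkseq => i; rewrite ltnS leq_eqVlt => /orP[/eqP->//|]; exact: yx.
Qed.

Lemma nbhs_prefix (x : baire) k : nbhs x (cyl (mkseq x k)).
Proof. by apply/nbhs_cyl; exists k. Qed.

Lemma coord_nbhs (x : baire) (i : nat) : nbhs x [set y : baire | y i = x i].
Proof. by apply/nbhs_cyl; exists i.+1 => y /cyl_mkseq; apply. Qed.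

Notation NN := (borel baire).

Lemma open_cyl p : open (cyl p).
Proof.
rewrite openE => x <-; apply/nbhs_cyl; exists (size p) => y.
by rewrite /cyl /= size_mkseq.
Qed.

Lemma open_bigcup_cyl (U : set baire) :
  open U -> U = \bigcup_(p in [set p : seq nat | cyl p `<=` U]) cyl p.
Proof.
move=> oU; apply/seteqP; split => [x Ux|x [p /= pU]]; last exact: pU.
have : nbhs x U by apply: open_nbhs_nbhs; split.
by move=> /nbhs_cyl[k kU]; exists (mkseq x k) => //; exact/cyl_mkseq.
Qed.

Lemma closed_cyl p : closed (cyl p).
Proof.
rewrite -[cyl p]setCK closedC openE => x px; apply/nbhs_cyl; exists (size p) => y.
move=> /cyl_mkseq yx py; apply: px; rewrite /cyl /= in py *; rewrite -{2}py.
by apply/mkseq_eqP => i /yx.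
Qed.

Lemma open_measurable_borel (T : ptopologicalType) (U : set T) :
  open U -> measurable (U : set (borel T)).
Proof. exact: sub_sigma_algebra. Qed.

Lemma measurable_open (U : set baire) : open U -> measurable (U : set NN).
Proof. exact: (@open_measurable_borel baire). Qed.

Lemma measurable_closed (C : set baire) : closed C -> measurable (C : set NN).
Proof.
move=> cC; rewrite -[C]setCK; apply: (@measurableC _ NN).
by apply: measurable_open; exact: closed_openC.
Qed.

Lemma measurable_cyl p : measurable (cyl p : set NN).
Proof. by apply: measurable_open; exact: open_cyl. Qed.

(** * Measurability of functions with countably many values *)

Section countably_valued.
Context d (T : measurableType d).

(** Measurability fibre by fibre needs no sigma-algebra on [C]; prefixes, indices and least
    witnesses are handled this way. *)
Definition cmeas (C : Type) (f : T -> C) := forall c, measurable [set t | f t = c].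

Lemma cmeas_pred (C : countType) (f : T -> C) (P : set C) :
  cmeas f -> measurable [set t | P (f t)].
Proof.
move=> mf.
rewrite (_ : [set _ | _] = \bigcup_(c : C) (if `[< P c >] then [set t | f t = c] else set0)).
  apply: countable_bigcupT_measurable => // c; by case: ifP.
apply/seteqP; split => [t Pft|t [c _]]; first by exists (f t) => //; rewrite asboolT.
by case: asboolP => // Pc /= ->.
Qed.

Lemma cmeas_comp (C : countType) (D : Type) (h : C -> D) (f : T -> C) :
  cmeas f -> cmeas (h \o f).
Proof. by move=> mf c; exact: (@cmeas_pred C f [set x | h x = c]). Qed.

Lemma cmeas_pair (C D : Type) (f : T -> C) (g : T -> D) :
  cmeas f -> cmeas g -> cmeas (fun t => (f t, g t)).
Proof.
move=> mf mg [c e]; rewrite (_ : [set _ | _] = [set t | f t = c] `&` [set t | g t = e]).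
  exact: measurableI.
by apply/seteqP; split => t /= [-> ->].
Qed.

Lemma cmeas_coord (F : T -> NN) (C : countType) (m : T -> C) (h : C -> nat) :
  measurable_fun setT F -> cmeas m -> cmeas (fun t => F t (h (m t))).
Proof.
move=> mF mm v.
rewrite (_ : [set _ | _] = \bigcup_(c : C) ([set t | m t = c] `&` F @^-1` [set x : baire | x (h c) = v])).
  apply: countable_bigcupT_measurable => // c; apply: measurableI; first exact: mm.
  rewrite -[X in measurable X]setTI; apply: mF => //; apply: open_measurable_borel.
  rewrite openE => x /= xv; rewrite /interior -xv; exact: coord_nbhs.
by apply/seteqP; split => [t /= Ft|t /= [c _ [<-]]//]; exists (m t).
Qed.

Lemma cmeas_cst (C : Type) (c : C) : cmeas (fun _ : T => c).
Proof.
move=> e; have [->|ce] := pselect (c = e); last first.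
  by rewrite (_ : [set _ | _] = set0)//; apply/seteqP; split.
by rewrite (_ : [set _ | _] = setT)//; apply/seteqP; split.
Qed.

Lemma cmeas_mkseq (F : T -> nat -> nat) k :
  (forall i, cmeas (fun t => F t i)) -> cmeas (fun t => mkseq (F t) k).
Proof.
move=> mF; elim: k => [|k IHk]; first exact: cmeas_cst.
rewrite (_ : (fun _ => _) = (fun z : seq nat * nat => rcons z.1 z.2) \o
   (fun t => (mkseq (F t) k, F t k))); last by apply/funext => t /=; rewrite mkseqS.
exact/cmeas_comp/cmeas_pair.
Qed.

Lemma cmeas_eval (F : T -> NN) k : measurable_fun setT F -> cmeas (fun t => F t k).
Proof. by move=> mF; exact: (@cmeas_coord F unit (fun=> tt) (fun=> k) mF (cmeas_cst tt)). Qed.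

Lemma measurable_eval (F : T -> NN) k (S : set nat) :
  measurable_fun setT F -> measurable [set t | S (F t k)].
Proof.
move=> mF; have h : cmeas (fun t => F t k : nat) := @cmeas_eval F k mF.
by have := @cmeas_pred nat _ S h.
Qed.

Lemma cmeas_prefix (F : T -> NN) k :
  measurable_fun setT F -> cmeas (fun t => mkseq (F t) k).
Proof. by move=> mF; apply: (@cmeas_mkseq F) => i; exact: cmeas_eval. Qed.

Lemma measurable_NN (F : T -> NN) :
  (forall k, cmeas (fun t => F t k)) -> measurable_fun setT F.
Proof.
move=> mF; apply: (@measurability _ _ T NN _ _ (@open baire)) => // _ [U oU <-].
rewrite setTI (open_bigcup_cyl oU).
rewrite (_ : _ @^-1` _ = \bigcup_(p : seq nat) (if `[< cyl p `<=` U >] then F @^-1` (cyl p) else set0)).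
  apply: countable_bigcupT_measurable => // p; case: ifP => // _.
  exact: (cmeas_mkseq (F := F)).
apply/seteqP; split => [t [p /= pU pt]|t [p _]]; first by exists p => //; rewrite asboolT.
by case: asboolP => // pU pt; exists p.
Qed.

Lemma cmeas_bind (C : countType) (D : Type) (f : T -> C) (g : C -> T -> D) :
  cmeas f -> (forall c, cmeas (g c)) -> cmeas (fun t => g (f t) t).
Proof.
move=> mf mg v.
rewrite (_ : [set _ | _] = \bigcup_(c : C) ([set t | f t = c] `&` [set t | g c t = v])).
  by apply: countable_bigcupT_measurable => // c; apply: measurableI; [exact: mf|exact: mg].
by apply/seteqP; split => [t /= gt|t /= [c _ [<-]]//]; exists (f t).
Qed.

(* The least element of S; junk value 0 on the empty set. *)
Definition least (S : set nat) : nat :=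
  if pselect (exists k, `[< S k >]) is left e then ex_minn e else 0%N.

Lemma leastP (S : set nat) : S !=set0 -> S (least S) /\ forall k, S k -> (least S <= k)%N.
Proof.
move=> [k0 Sk0]; rewrite /least; case: pselect => [e|[]]; last by exists k0; exact/asboolP.
by case: ex_minnP => k /asboolP Sk kmin; split => // l Sl; exact/kmin/asboolP.
Qed.

Lemma least0 (S : set nat) : ~ (exists k, S k) -> least S = 0%N.
Proof.
move=> nS; rewrite /least; case: pselect => // e; exfalso; apply: nS.
by case: e => k /asboolP Sk; exists k.
Qed.

Lemma cmeas_least (S : nat -> set T) : (forall k, measurable (S k)) ->
  cmeas (fun t => least [set k | S k t]).
Proof.
move=> mS v; pose none := ~` \bigcup_k S k.
have mnone : measurable none by apply: measurableC; exact: bigcupT_measurable.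
rewrite (_ : [set _ | _] = ((S v `&` ~` \bigcup_(k < v) S k) `|` (if v == 0%N then none else set0))).
  apply: measurableU; last by case: ifP.
  by apply: measurableI => //; apply: measurableC; exact: bigcup_measurable.
apply/seteqP; split => t /=.
  have [[k Sk]|nS] := pselect (exists k, S k t).
    have [Sl lmin] := leastP (ex_intro [set k | S k t] k Sk) => lv; left; rewrite -lv.
    by split=> // -[l /= ll /lmin]; rewrite leqNgt ll.
  rewrite least0// => <-.
  by right=> -[k _ Sk]; apply: nS; exists k.
move=> [[Sv nSv]|]; last first.
  by case: eqP => // -> nt; apply: least0 => -[k Sk]; apply: nt; exists k.
have [Sl lmin] := leastP (ex_intro [set k | S k t] v Sv).
by apply/eqP; rewrite eqn_leq lmin//= leqNgt; apply/negP => lv; apply: nSv; exists (least [set k | S k t]).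
Qed.

End countably_valued.

(** * Projective classes over measurable spaces *)

Definition slice (k : nat) (w : nat -> nat) : nat -> nat := fun i => w (pickle (k, i)).

Definition join (f : nat -> nat -> nat) : nat -> nat :=
  fun m => if unpickle m is Some (k, i) then f k i else 0%N.

Lemma slice_join f k : slice k (join f) = f k.
Proof. by apply/funext => i; rewrite /slice /join pickleK. Qed.

Definition join2 (x y : nat -> nat) := join (fun k => if k is 0 then x else y).

Section measurable_slice.
Context d (T : measurableType d).

Lemma measurable_slice (F : T -> NN) k :
  measurable_fun setT F -> measurable_fun setT (fun t => slice k (F t) : NN).
Proof. by move=> mF; apply: measurable_NN => i; exact: cmeas_eval. Qed.

Lemma measurable_join (F : T -> nat -> NN) :
  (forall k, measurable_fun setT (F ^~ k)) ->
  measurable_fun setT (fun t => join (F t) : NN).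
Proof.
move=> mF; apply: measurable_NN => m; rewrite /join.
case: (unpickle m) => [[k i]|]; last exact: cmeas_cst.
by have := @cmeas_eval _ _ _ i (mF k); apply.
Qed.

Lemma measurable_join2 (F G : T -> NN) :
  measurable_fun setT F -> measurable_fun setT G ->
  measurable_fun setT (fun t => join2 (F t) (G t) : NN).
Proof. by move=> mF mG; apply: measurable_join => -[|k]. Qed.

End measurable_slice.

Lemma measurable_sliceT k : measurable_fun setT (slice k : NN -> NN).
Proof. exact: (@measurable_slice _ _ id). Qed.

Lemma measurable_split2 :
  measurable_fun setT (fun w : NN => (slice 0 w : NN, slice 1 w : NN)).
Proof. by apply: measurable_fun_pair; exact: measurable_sliceT. Qed.

(** Starting from the sigma-algebra instead of the open sets makes every level stable under
    measurable substitution and lets parameters range over any measurable space. On [NN], from level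
    1 on, the classes agree with [Sigma1]. *)
Fixpoint Sig (n : nat) d (T : measurableType d) : set (set T) :=
  match n with
  | 0 => measurable
  | m.+1 => [set A | exists2 C : set (T * NN), @Sig m _ _ (~` C) & A = fst @` C]
  end.
Arguments Sig n {d T} : simpl never.

Definition Pi n d (T : measurableType d) : set (set T) := [set A | Sig n (~` A)].
Arguments Pi n {d T}.

Lemma fst_image (T U : Type) (C : set (T * U)) :
  fst @` C = [set t | exists y, C (t, y)].
Proof.
by apply/seteqP; split => [_ [[t y] Cty <-]|t [y Cty]]; [exists y|exists (t, y)].
Qed.

Lemma Sig_ex n d (T : measurableType d) (C : set (T * NN)) :
  Pi n C -> Sig n.+1 [set t | exists y, C (t, y)].
Proof. by move=> PC; exists C => //; rewrite fst_image. Qed.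

Lemma Sig_inv n d (T : measurableType d) (A : set T) : Sig n.+1 A ->
  exists2 C : set (T * NN), Pi n C & A = [set t | exists y, C (t, y)].
Proof. by move=> [C SC ->]; exists C => //; rewrite fst_image. Qed.

Lemma Sig_preimage n d d' (T : measurableType d) (U : measurableType d')
    (f : T -> U) (A : set U) :
  measurable_fun setT f -> Sig n A -> Sig n (f @^-1` A).
Proof.
elim: n d d' T U f A => [|n IHn] d d' T U f A mf.
  rewrite /Sig => mA; by rewrite -[X in measurable X]setTI; exact: mf.
move=> [C SC ->].
rewrite (_ : _ @^-1` _ = [set t | exists y, [set ty | C (f ty.1, ty.2)] (t, y)]).
  apply: Sig_ex; rewrite /Pi /= (_ : ~` _ = (fun ty => (f ty.1, ty.2)) @^-1` (~` C))//.
  apply: IHn => //; apply: measurable_fun_pair => //=.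
  exact: measurableT_comp.
by rewrite fst_image.
Qed.

Lemma Pi_preimage n d d' (T : measurableType d) (U : measurableType d')
    (f : T -> U) (A : set U) :
  measurable_fun setT f -> Pi n A -> Pi n (f @^-1` A).
Proof. by move=> mf; exact: Sig_preimage. Qed.

(** Unions and intersections go together because the matrix of a projection is a complement, which
    exchanges them. For intersections, countably many witnesses are packed into one real by
    [join]. *)
Lemma Sig_bigcup_bigcap n d (T : measurableType d) (A : nat -> set T) :
  (forall k, Sig n (A k)) -> Sig n (\bigcup_k A k) /\ Sig n (\bigcap_k A k).
Proof.
elim: n d T A => [|n IHn] d T A SA.
  by split; [exact: bigcupT_measurable|exact: bigcapT_measurable].
have /choice[C CA] : forall k, exists C : set (T * NN), Pi n C /\ A k = [set t | exists y, C (t, y)].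
  by move=> k; have [C SC ->] := SA k; exists C; rewrite -fst_image.
split.
- rewrite (_ : \bigcup_k A k = [set t | exists y, (\bigcup_k C k) (t, y)]).
    apply: Sig_ex; rewrite /Pi /= setC_bigcup.
    by apply: (IHn _ (T * NN)%type _ _).2 => k; exact: (CA k).1.
  apply/seteqP; split => [t [k _]|t [y [k _ Cty]]].
    by rewrite (CA k).2 => -[y Cty]; exists y, k.
  by exists k => //; rewrite (CA k).2; exists y.
- pose D : set (T * NN) := \bigcap_k [set z | C k (z.1, slice k z.2)].
  rewrite (_ : \bigcap_k A k = [set t | exists y, D (t, y)]).
    apply: Sig_ex; rewrite /Pi /= setC_bigcap.
    apply: (IHn _ (T * NN)%type _ _).1 => k.
    rewrite (_ : ~` _ = (fun z : T * NN => (z.1, slice k z.2 : NN)) @^-1` (~` C k))//.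
    apply: Sig_preimage; last exact: (CA k).1.
    by apply: measurable_fun_pair => //; exact: measurable_slice.
  apply/seteqP; split => [t At|t [w Dw] k _]; last first.
    by rewrite (CA k).2; exists (slice k w); exact: Dw.
  have /choice[y Cy] : forall k, exists y : NN, C k (t, y) by move=> k; move: (At k I); rewrite (CA k).2.
  by exists (join y) => k _; rewrite /= slice_join.
Qed.

Lemma Sig_bigcup n d (T : measurableType d) (A : nat -> set T) :
  (forall k, Sig n (A k)) -> Sig n (\bigcup_k A k).
Proof. by move=> /Sig_bigcup_bigcap[]. Qed.

Lemma Sig_bigcap n d (T : measurableType d) (A : nat -> set T) :
  (forall k, Sig n (A k)) -> Sig n (\bigcap_k A k).
Proof. by move=> /Sig_bigcup_bigcap[]. Qed.

Lemma Sig_setU n d (T : measurableType d) (A B : set T) :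
  Sig n A -> Sig n B -> Sig n (A `|` B).
Proof.
move=> SA SB; rewrite (_ : A `|` B = \bigcup_k (if k is 0%N then A else B)).
  by apply: Sig_bigcup => -[].
by apply/seteqP; split => [t [At|Bt]|t [[|k] _ ?]]; [exists 0%N|exists 1%N|left|right].
Qed.

Lemma Sig_setI n d (T : measurableType d) (A B : set T) :
  Sig n A -> Sig n B -> Sig n (A `&` B).
Proof.
move=> SA SB; rewrite (_ : A `&` B = \bigcap_k (if k is 0%N then A else B)).
  by apply: Sig_bigcap => -[].
by apply/seteqP; split => [t [At Bt] [|k] _//|t ABt]; split; [exact: (ABt 0%N)|exact: (ABt 1%N)].
Qed.

Lemma Pi_setI n d (T : measurableType d) (A B : set T) :
  Pi n A -> Pi n B -> Pi n (A `&` B).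
Proof. by rewrite /Pi /= setCI; exact: Sig_setU. Qed.

Lemma bigcup_unpickle (T : Type) (I : countType) (A : I -> set T) :
  \bigcup_i A i = \bigcup_k (if unpickle k is Some i then A i else set0).
Proof.
apply/seteqP; split => [t [i _ At]|t [k _]]; first by exists (pickle i); rewrite ?pickleK.
by case: (unpickle k) => // i At; exists i.
Qed.

Lemma Sig_bigcup_countable n d (T : measurableType d) (I : countType) (A : I -> set T) :
  Sig n (set0 : set T) -> (forall i, Sig n (A i)) -> Sig n (\bigcup_i A i).
Proof.
move=> S0 SA.
by rewrite bigcup_unpickle; apply: Sig_bigcup => k; case: unpickle.
Qed.

Lemma Pi_sub_Sig n d (T : measurableType d) (A : set T) : Pi n A -> Sig n.+1 A.
Proof.
move=> PA; rewrite (_ : A = [set t | exists y : NN, (A \o fst) (t, y)]).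
  apply: (@Sig_ex n _ T); exact: (Pi_preimage measurable_fst).
by apply/seteqP; split => [t At|t [_]//]; exists (fun=> 0%N).
Qed.

Lemma Sig_subS n d (T : measurableType d) (A : set T) : Sig n A -> Sig n.+1 A.
Proof.
elim: n d T A => [|n IHn] d T A; first by move=> mA; apply: Pi_sub_Sig; exact: measurableC.
by move=> [C SC ->]; exists C => //; exact: IHn.
Qed.

Lemma Sig_sub_Pi n d (T : measurableType d) (A : set T) : Sig n A -> Pi n.+1 A.
Proof. by move=> SA; apply: Pi_sub_Sig; rewrite /Pi /= setCK. Qed.

Lemma Sig_le m n d (T : measurableType d) (A : set T) : (m <= n)%N -> Sig m A -> Sig n A.
Proof.
by elim: n => [|n IHn]; rewrite leq_eqVlt => /orP[/eqP->//|//]; rewrite ltnS => /IHn{}IHn /IHn /Sig_subS.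
Qed.

Lemma Pi_le m n d (T : measurableType d) (A : set T) : (m <= n)%N -> Pi m A -> Pi n A.
Proof. exact: Sig_le. Qed.

Lemma measurable_Sig n d (T : measurableType d) (A : set T) : measurable A -> Sig n A.
Proof. by move=> mA; exact: (@Sig_le 0). Qed.

Lemma measurable_Pi n d (T : measurableType d) (A : set T) : measurable A -> Pi n A.
Proof. by move=> /measurableC /(@measurable_Sig n). Qed.

Lemma Sig_proj n d (T : measurableType d) (A : set (T * NN)) :
  Sig n.+1 A -> Sig n.+1 [set t | exists y, A (t, y)].
Proof.
move=> [C SC AC].
rewrite (_ : [set _ | _] =
   [set t | exists w, [set z : T * NN | C ((z.1, slice 0 z.2), slice 1 z.2)] (t, w)]).
  apply: Sig_ex.
  rewrite /Pi /= (_ : ~` _ = (fun z : T * NN =>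
     ((z.1, slice 0 z.2 : NN), slice 1 z.2 : NN)) @^-1` (~` C))//.
  apply: Sig_preimage => //; apply: measurable_fun_pair; last exact: measurable_slice.
  by apply: measurable_fun_pair => //; exact: measurable_slice.
rewrite AC fst_image; apply/seteqP; split => [t [y [y' /= Ct]]|t [w /= Ct]].
  by exists (join2 y y'); rewrite /= !slice_join.
by exists (slice 0 w), (slice 1 w).
Qed.

Lemma Pi_all n d (T : measurableType d) (A : set (T * NN)) :
  Pi n.+1 A -> Pi n.+1 [set t | forall y, A (t, y)].
Proof.
move=> PA; rewrite /Pi /= (_ : ~` _ = [set t | exists y : NN, (~` A) (t, y)]).
  exact: Sig_proj.
by apply/seteqP; split => [t /existsNP[y nA]|t [y nA] A0]; [exists y|exact/nA/A0].
Qed.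

Lemma Pi_allSig n d (T : measurableType d) (A : set (T * NN)) :
  Sig n A -> Pi n.+1 [set t | forall y, A (t, y)].
Proof. by move=> /Sig_sub_Pi /Pi_all. Qed.

(** * Comparison with the topological projective classes *)

Lemma continuous_baire (T : topologicalType) (F : T -> baire) :
  (forall k t, nbhs t [set t' | F t' k = F t k]) -> continuous F.
Proof.
move=> cF t U /nbhs_cyl[k kU]; suff : nbhs t (F @^-1` cyl (mkseq (F t) k)) by apply: filterS => s; exact: kU.
elim: k {kU} => [|k IHk]; first by apply: filterS filterT => y _; exact/cyl_mkseq.
apply: filterS (filterI IHk (cF k t)) => y [/cyl_mkseq yx /= yk].
by apply/cyl_mkseq => i; rewrite ltnS leq_eqVlt => /orP[/eqP->//|]; exact: yx.
Qed.

Lemma baire_continuous (T : topologicalType) (F : T -> baire) :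
  continuous F -> forall k t, nbhs t [set t' | F t' k = F t k].
Proof. by move=> cF k t; have := cF t _ (coord_nbhs (F t) k). Qed.

Lemma continuous_slice (T : topologicalType) (F : T -> baire) k :
  continuous F -> continuous (fun t => slice k (F t) : baire).
Proof.
by move=> cF; apply: continuous_baire => i t; exact: (baire_continuous cF).
Qed.

Lemma continuous_sliceT k : continuous (slice k : baire -> baire).
Proof. exact: (@continuous_slice baire id k (fun w => cvg_id)). Qed.

Lemma continuous_join2 (T : topologicalType) (F G : T -> baire) :
  continuous F -> continuous G -> continuous (fun t => join2 (F t) (G t) : baire).
Proof.
move=> cF cG; apply: continuous_baire => m t; rewrite /join2 /join.
case: (unpickle m) => [[[|k] i]|]; last by apply: filterS filterT.
  exact: baire_continuous.
exact: baire_continuous.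
Qed.

Lemma continuous_pair (T U V : topologicalType) (F : T -> U) (G : T -> V) :
  continuous F -> continuous G -> continuous (fun t => (F t, G t)).
Proof. by move=> cF cG t; apply: cvg_pair; [exact: cF|exact: cG]. Qed.

Lemma continuous_fst (T U : topologicalType) : continuous (fst : T * U -> T).
Proof. by move=> z; exact: cvg_fst. Qed.

Lemma continuous_snd (T U : topologicalType) : continuous (snd : T * U -> U).
Proof. by move=> z; exact: cvg_snd. Qed.

Lemma continuous_compose (T U V : topologicalType) (f : T -> U) (g : U -> V) :
  continuous f -> continuous g -> continuous (g \o f).
Proof. by move=> cf cg t; apply: continuous_comp; [exact: cf|exact: cg]. Qed.

Lemma open_preimage (T U : topologicalType) (f : T -> U) (A : set U) :
  continuous f -> open A -> open (f @^-1` A).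
Proof. by move/continuousP; exact. Qed.

Lemma Sigma1_preimage n (T U : topologicalType) (f : T -> U) (A : set U) :
  continuous f -> Sigma1 n A -> Sigma1 n (f @^-1` A).
Proof.
elim: n T U f A => [|n IHn] T U f A cf; first exact: open_preimage.
move=> [C SC ->]; exists [set z | C (f z.1, z.2)].
  rewrite (_ : ~` _ = (fun z : T * baire => (f z.1, z.2)) @^-1` (~` C))//.
  apply: IHn SC; apply: continuous_pair; last exact: continuous_snd.
  by apply: continuous_compose => //; exact: continuous_fst.
by rewrite !fst_image.
Qed.

Lemma Sigma1_ex1 n (T : topologicalType) (C : set (T * baire)) :
  Sigma1 n (~` C) -> Sigma1 n.+1 [set t | exists y, C (t, y)].
Proof. by move=> SC; exists C => //; rewrite fst_image. Qed.

Lemma analytic_bigcap (A : nat -> set baire) :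
  (forall k, Sigma1 1 (A k)) -> Sigma1 1 (\bigcap_k A k).
Proof.
move=> SA.
have /choice[C CA] : forall k, exists C : set (baire * baire),
    open (~` C) /\ A k = [set t | exists y, C (t, y)].
  by move=> k; have [C SC ->] := SA k; exists C; rewrite -fst_image.
rewrite (_ : \bigcap_k A k =
    [set t | exists w : baire, (\bigcap_k [set z : baire * baire | C k (z.1, slice k z.2)]) (t, w)]).
  apply: Sigma1_ex1; rewrite setC_bigcap; apply: bigcup_open => k _.
  rewrite (_ : ~` _ = (fun z : baire * baire => (z.1, slice k z.2 : baire)) @^-1` (~` C k))//.
  apply: open_preimage; last exact: (CA k).1.
  apply: continuous_pair; [exact: continuous_fst|apply: continuous_slice; exact: continuous_snd].
apply/seteqP; split => [t At|t [w Dw] k _]; last first.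
  by rewrite (CA k).2; exists (slice k w); exact: (Dw k).
have /choice[y Cy] : forall k, exists y : baire, C k (t, y).
  by move=> k; move: (At k I); rewrite (CA k).2.
by exists (join y) => k _; rewrite /= slice_join.
Qed.

Lemma analytic_bigcup (A : nat -> set baire) :
  (forall k, Sigma1 1 (A k)) -> Sigma1 1 (\bigcup_k A k).
Proof.
move=> SA.
have /choice[C CA] : forall k, exists C : set (baire * baire),
    open (~` C) /\ A k = [set t | exists y, C (t, y)].
  by move=> k; have [C SC ->] := SA k; exists C; rewrite -fst_image.
rewrite (_ : \bigcup_k A k = [set t | exists w : baire,
    [set z : baire * baire | C (z.2 (pickle (0, 0)%N)) (z.1, slice 1 z.2)] (t, w)]).
  apply: Sigma1_ex1 => /=; rewrite openE => -[x w] /= nC.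
  have := (CA (w (pickle (0, 0)%N))).1; rewrite openE => /(_ _ nC) nC'.
  have c1 : continuous (fun z : baire * baire => (z.1, slice 1 z.2 : baire)).
    apply: continuous_pair; [exact: continuous_fst|apply: continuous_slice; exact: continuous_snd].
  have := c1 (x, w) _ nC'.
  have := baire_continuous (@continuous_snd baire baire) (pickle (0, 0)%N) (x, w).
  by move=> /filterI h /h; apply: filterS => z [/= ->].
apply/seteqP; split => [t [k _]|t [w Cw]]; last first.
  by exists (w (pickle (0, 0)%N)) => //; rewrite (CA _).2; exists (slice 1 w).
rewrite (CA k).2 => -[y Cy]; exists (join2 (fun=> k) y).
by rewrite /= slice_join /join2 /join pickleK.
Qed.

(** The sets that are analytic with analytic complement form a sigma-algebra containing the open
    sets. *)
Lemma borel_analytic (A : set NN) : measurable A -> Sigma1 1 (A : set baire).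
Proof.
pose G := [set A : set baire | Sigma1 1 A /\ Sigma1 1 (~` A)].
suff : <<s @open baire >> `<=` G by move=> sub mA; exact: (sub A mA).1.
have closed_analytic (C : set baire) : closed C -> Sigma1 1 C.
  move=> cC; exists (fst @^-1` C); last by apply/seteqP; split => [x Cx|x [[? ?] ? <-]//]; exists (x, x).
  rewrite preimage_setC; apply: open_preimage; [exact: continuous_fst|exact: closed_openC].
have open_analytic (U : set baire) : open U -> Sigma1 1 U.
  move=> oU; rewrite (open_bigcup_cyl oU).
  rewrite (_ : \bigcup_(p in _) _ =
      \bigcup_(p : seq nat) (if `[< cyl p `<=` U >] then cyl p else set0)).
    rewrite (bigcup_unpickle (I := seq nat)); apply: analytic_bigcup => k; apply: closed_analytic.
    by case: ifP => _; [exact: closed_cyl|exact: closed0].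
  apply/seteqP; split => [t [p /= pU pt]|t [p _]].
    by exists p => //; rewrite asboolT.
  by case: asboolP => // pU pt; exists p.
apply: smallest_sub.
  split.
  - by split; [exact/closed_analytic/closed0|rewrite setC0; exact/open_analytic/openT].
  - by move=> B [SB SnB]; rewrite setTD; split => //; rewrite setCK.
  - move=> F GF; split; first by apply: analytic_bigcup => k; exact: (GF k).1.
    by rewrite setC_bigcup; apply: analytic_bigcap => k; exact: (GF k).2.
by move=> U oU; split; [exact: open_analytic|exact/closed_analytic/open_closedC].
Qed.

(** At level 1 the matrix is only Borel. Coded as a set of single reals it is analytic, and its
    witness is merged with the quantified real, which leaves a closed matrix. *)
Lemma Sig_Sigma1 n (A : set NN) : Sig n.+1 A -> Sigma1 n.+1 (A : set baire).
Proof.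
have munpair := measurable_split2.
elim: n A => [|n IHn] A [C SC ->].
  pose C' := (fun w : NN => (slice 0 w : NN, slice 1 w : NN)) @^-1` C.
  have [D oD C'D] : Sigma1 1 (C' : set baire).
    apply: borel_analytic; rewrite /C' -[C]setCK -preimage_setC.
    by apply: measurableC; by have := @Sig_preimage 0 _ _ _ _ _ _ munpair SC; apply.
  rewrite (_ : _ @` _ = [set x | exists w : baire,
     [set z : baire * baire | D (join2 z.1 (slice 0 z.2), slice 1 z.2)] (x, w)]).
    apply: Sigma1_ex1.
    rewrite (_ : ~` _ = (fun z : baire * baire =>
        (join2 z.1 (slice 0 z.2) : baire, slice 1 z.2 : baire)) @^-1` (~` D))//.
    apply: open_preimage; last exact: oD.
    apply: continuous_pair; last by apply: continuous_slice; exact: continuous_snd.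
    apply: continuous_join2; first exact: continuous_fst.
    by apply: continuous_slice; exact: continuous_snd.
  rewrite fst_image fst_image in C'D *; apply/seteqP; split => [x [y Cxy]|x [w /= Dxw]].
    have : C' (join2 x y) by rewrite /C' /= !slice_join.
    by rewrite C'D => -[v Dv]; exists (join2 y v); rewrite /= !slice_join.
  have : C' (join2 x (slice 0 w)) by rewrite C'D; exists (slice 1 w).
  by rewrite /C' /= !slice_join; exists (slice 0 w).
exists C => //.
have /IHn : Sig n.+1 ((fun w : NN => (slice 0 w : NN, slice 1 w : NN)) @^-1` (~` C)).
  exact: Sig_preimage.
move=> /(@Sigma1_preimage _ _ _ (fun z : baire * baire => join2 z.1 z.2 : baire)).
rewrite (_ : _ @^-1` _ = ~` C) => [|]; last first.
  by apply/seteqP; split => -[x y] /=; rewrite /preimage /= !slice_join.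
by apply; apply: continuous_join2; [exact: continuous_fst|exact: continuous_snd].
Qed.

(** Pulling back along [phi] moves the recursion from [T * baire] to reals coding its points, so
    that [T] may be any topological space. *)
Lemma Sigma1_Sig n (T : topologicalType) (phi : baire -> T) (A : set T) :
  continuous phi -> Sigma1 n A -> Sig n (phi @^-1` A : set NN).
Proof.
elim: n T phi A => [|n IHn] T phi A cphi.
  by move=> oA; apply: (@open_measurable_borel baire); exact: open_preimage.
move=> [C SC ->]; rewrite (_ : _ @^-1` _ =
    [set x | exists y : NN, [set z : NN * NN | C (phi z.1, z.2)] (x, y)]); last by rewrite fst_image.
apply: Sig_ex.
have /IHn : continuous (fun w : baire => (phi (slice 0 w), slice 1 w : baire)).
  apply: continuous_pair; last exact: continuous_sliceT.
  exact: (continuous_compose (@continuous_sliceT 0) cphi).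
move=> /(_ _ SC) /(@Sig_preimage _ _ _ (NN * NN)%type NN (fun z => join2 z.1 z.2 : NN)).
rewrite /Pi /= (_ : _ @^-1` _ = ~` [set z | C (phi z.1, z.2)]) => [|]; last first.
  by apply/seteqP; split => -[x y] /=; rewrite /preimage /= !slice_join.
by apply; exact: measurable_join2.
Qed.

Definition universal n (U : set (NN * NN)) :=
  forall A : set NN, Sig n A -> exists a : NN, forall x, A x <-> U (a, x).

(** At level 1 the index [a] marks the prefixes whose cylinder lies in the open complement of the
    matrix, and y is a witness when no prefix of the pair is marked. Each further level projects the
    negation of the previous universal set. *)
Lemma Sig_universal n : exists2 U : set (NN * NN), Sig n.+1 U & universal n.+1 U.
Proof.
elim: n => [|n [U SU uU]].
  pose C : set ((NN * NN) * NN) := [set z |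
    forall k, z.1.1 (pickle (mkseq (join2 z.1.2 z.2) k)) = 0%N].
  exists [set z | exists y : NN, C (z, y)].
    apply: Sig_ex; apply: measurable_Pi.
    rewrite (_ : C = \bigcap_k [set z | z.1.1 (pickle (mkseq (join2 z.1.2 z.2) k)) = 0%N]).
      apply: bigcapT_measurable => k.
      have := @cmeas_coord _ ((NN * NN) * NN)%type (fun z => z.1.1) (seq nat)
         (fun z => mkseq (join2 z.1.2 z.2) k) pickle; apply.
        exact: measurableT_comp.
      apply: (@cmeas_prefix _ ((NN * NN) * NN)%type (fun z => join2 z.1.2 z.2)); apply: measurable_join2 => //.
      exact: measurableT_comp.
    by apply/seteqP; split => z Cz k; [move=> _; exact: Cz|exact: (Cz k)].
  move=> A /Sig_Sigma1[D oD ->].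
  pose D' := (fun w : baire => (slice 0 w : baire, slice 1 w : baire)) @^-1` (~` D).
  have oD' : open D'.
    apply: open_preimage; last exact: oD.
    by apply: continuous_pair; exact: continuous_sliceT.
  pose a : NN := fun m => if unpickle m is Some p then `[< cyl p `<=` D' >] : nat else 0%N.
  exists a => x; rewrite fst_image; split => [[y Dxy]|[y Cy]]; exists y; last first.
    apply: contrapT => nD.
    have : D' (join2 x y) by rewrite /D' /= !slice_join.
    rewrite (open_bigcup_cyl oD') => -[p /= pD' px].
    move: (Cy (size p)); rewrite /= /a px pickleK.
    by rewrite asboolT.
  move=> k /=; rewrite /a pickleK; case: asboolP => // kD'.
  have : D' (join2 x y) by apply: kD'; exact/cyl_mkseq.
  by rewrite /D' /= !slice_join.
have mj : measurable_fun setT (fun z : (NN * NN) * NN => (z.1.1, join2 z.1.2 z.2 : NN)).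
  apply: measurable_fun_pair; first exact: measurableT_comp.
  by apply: measurable_join2 => //; exact: measurableT_comp.
exists [set z | exists y : NN, [set z : (NN * NN) * NN | ~ U (z.1.1, join2 z.1.2 z.2)] (z, y)].
  apply: Sig_ex; rewrite /Pi /= (_ : ~` _ =
     (fun z : (NN * NN) * NN => (z.1.1, join2 z.1.2 z.2 : NN)) @^-1` U).
    exact: Sig_preimage.
  by apply/seteqP; split => z /= ; [move/contrapT|move=> ? ?].
move=> A /Sig_inv[C SC ->].
have /uU[a aP] : Sig n.+1 ((fun w : NN => (slice 0 w : NN, slice 1 w : NN)) @^-1` (~` C)).
  exact: (Sig_preimage measurable_split2 SC).
exists a => x; split => -[y xy]; exists y.
  by rewrite /= -aP /preimage /= !slice_join.
by apply: contrapT; move: xy; rewrite /= -aP /preimage /= !slice_join.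
Qed.

(** * Determinacy and prewellorderings *)

(** A strategy is a real evaluated at the code of the opponent's moves so far: I has seen k of them
    before move k, and II, in [resp2], has seen k + 1. The player's own moves can be recomputed. *)
Definition resp1 (s b : nat -> nat) : nat -> nat := fun k => s (pickle (mkseq b k)).

Definition resp2 (t a : nat -> nat) : nat -> nat := fun k => t (pickle (mkseq a k.+1)).

Definition recode (f : seq nat -> nat) : nat -> nat :=
  fun m => if unpickle m is Some q then f q else 0%N.

Lemma recodeE f q : recode f (pickle q) = f q.
Proof. by rewrite /recode pickleK. Qed.

Lemma measurable_resp1 d (T : measurableType d) (F G : T -> NN) :
  measurable_fun setT F -> measurable_fun setT G ->
  measurable_fun setT (fun t => resp1 (F t) (G t) : NN).
Proof.
move=> mF mG; apply: measurable_NN => k.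
by have := @cmeas_coord _ T F (seq nat) (fun t => mkseq (G t) k) pickle mF (cmeas_prefix k mG).
Qed.

Lemma measurable_resp2 d (T : measurableType d) (F G : T -> NN) :
  measurable_fun setT F -> measurable_fun setT G ->
  measurable_fun setT (fun t => resp2 (F t) (G t) : NN).
Proof.
move=> mF mG; apply: measurable_NN => k.
by have := @cmeas_coord _ T F (seq nat) (fun t => mkseq (G t) k.+1) pickle mF (cmeas_prefix k.+1 mG).
Qed.

Definition evens (x : nat -> nat) : nat -> nat := fun k => x k.*2.
Definition odds (x : nat -> nat) : nat -> nat := fun k => x k.*2.+1.
Definition interleave (a b : nat -> nat) : nat -> nat :=
  fun n => if odd n then b n./2 else a n./2.

Lemma evens_interleave a b : evens (interleave a b) = a.
Proof. by apply/funext => k; rewrite /evens /interleave odd_double doubleK. Qed.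

Lemma odds_interleave a b : odds (interleave a b) = b.
Proof.
by apply/funext => k; rewrite /odds /interleave /= odd_double uphalf_double.
Qed.

Lemma mkseq_doubleS (x : nat -> nat) k :
  mkseq x k.+1.*2 = rcons (rcons (mkseq x k.*2) (evens x k)) (odds x k).
Proof. by rewrite doubleS !mkseqS. Qed.

(** The strategies of [determined] read whole positions, those of [resp1] and [resp2] only the
    opponent's moves; [pos] rebuilds the position from the latter. *)
Lemma determined_pair (Q : set (baire * baire)) :
  determined [set x | Q (evens x, odds x)] ->
  (exists s, forall b, Q (resp1 s b, b)) \/ (exists t, forall a, ~ Q (a, resp2 t a)).
Proof.
case=> [[sigma wI]|[tau wII]]; [left|right].
- pose pos := foldl (fun P v => rcons (rcons P (sigma P)) v) [::].
  exists (recode (sigma \o pos)) => b; set a := resp1 _ b.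
  suff xb k : mkseq (interleave a b) k.*2 = pos (mkseq b k).
    have := wI (interleave a b); rewrite /= evens_interleave odds_interleave; apply => k.
    by rewrite xb -[LHS]/(evens _ k) evens_interleave /a /resp1 recodeE.
  elim: k => // k IHk; rewrite mkseq_doubleS evens_interleave odds_interleave IHk.
  by rewrite mkseqS /pos foldl_rcons -/pos /a /resp1 recodeE.
- pose pos := foldl (fun P v => rcons (rcons P v) (tau (rcons P v))) [::].
  exists (recode (last 0%N \o pos)) => a; set b := resp2 _ a.
  have bE k : b k = tau (rcons (pos (mkseq a k)) (a k)).
    by rewrite /b /resp2 recodeE /= mkseqS /pos foldl_rcons last_rcons.
  suff xa k : mkseq (interleave a b) k.*2 = pos (mkseq a k).
    have := wII (interleave a b); rewrite /= evens_interleave odds_interleave; apply => k.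
    rewrite mkseqS xa -[interleave a b k.*2]/(evens _ k) -[LHS]/(odds _ k).
    by rewrite evens_interleave odds_interleave bE.
  elim: k => // k IHk; rewrite mkseq_doubleS evens_interleave odds_interleave IHk.
  by rewrite mkseqS /pos foldl_rcons -/pos bE.
Qed.

Lemma game_determined n (Q : set (NN * NN)) : Pi1_determinacy n.+1 -> Pi n.+1 Q ->
  (exists s, forall b, Q (resp1 s b, b)) \/ (exists t, forall a, ~ Q (a, resp2 t a)).
Proof.
move=> det PQ; apply: determined_pair; apply: det.
apply: (@Sig_Sigma1 n (~` [set x : NN | Q (evens x : NN, odds x : NN)])).
apply: (@Pi_preimage n.+1 _ _ NN (NN * NN)%type (fun x : NN => (evens x : NN, odds x : NN))) PQ.
by apply: measurable_fun_pair; apply: measurable_NN => k; exact: (@cmeas_eval _ _ id).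
Qed.

Lemma play_ex (s t : nat -> nat) : exists a b, a = resp1 s b /\ b = resp2 t a.
Proof.
pose f (L : seq nat * seq nat) := let a' := rcons L.1 (s (pickle L.2)) in
  (a', rcons L.2 (t (pickle a'))).
pose L k := iter k f ([::], [::]).
pose a k := s (pickle (L k).2).
pose b k := t (pickle (rcons (L k).1 (a k))).
have Lab k : L k = (mkseq a k, mkseq b k).
  by elim: k => // k IHk; rewrite !mkseqS {1}/L iterS -/(L k) /f /= {2}/b /a IHk.
exists a, b; split; apply/funext => k; first by rewrite /resp1 /a Lab.
by rewrite /resp2 mkseqS /b Lab.
Qed.

(** The first k + 1 moves of the middle run are known once k + 1 moves of [a] are, so the composite
    is again a strategy. This gives transitivity of the compared norms. *)
Lemma resp2_comp (t1 t2 : nat -> nat) :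
  exists t, forall a, resp2 t a = resp2 t2 (resp2 t1 a).
Proof.
exists (recode (fun q => t2 (pickle (mkseq (fun i => t1 (pickle (take i.+1 q))) (size q))))).
move=> a; apply/funext => k; rewrite /resp2 recodeE size_mkseq; congr (t2 (pickle _)).
apply/mkseq_eqP => i ik; congr (t1 (pickle _)).
by rewrite /mkseq -map_take take_iota; congr (map _ (iota _ _)); lia.
Qed.

(** Infinitely many boards are played at once: move k on board n depends on the first k moves of
    board n + 1, so all boards are filled by recursion on k. *)
Lemma chain_ex (s : nat -> nat -> nat) :
  exists a : nat -> nat -> nat, forall n, a n = resp1 (s n) (a n.+1).
Proof.
pose L := fix L k n := if k is k'.+1 then rcons (L k' n) (s n (pickle (L k' n.+1))) else [::].
pose a n k := s n (pickle (L k n.+1)).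
have La k n : L k n = mkseq (a n) k by elim: k n => // k IHk n; rewrite mkseqS /= IHk.
by exists a => n; apply/funext => k; rewrite /resp1 -La.
Qed.

(* [le u v] is $u \in B$ and, if $v \in B$, the norm of u is at most that of v;
   [lt] is the strict version. *)
Record normed (T : Type) (B : set T) (le lt : T -> T -> Prop) : Prop := Normed {
  normed_le : forall u v, le u v -> B u;
  normed_lt : forall u v, lt u v -> B u;
  normed_leN : forall u v, B u -> ~ B v -> le u v;
  normed_ltN : forall u v, B u -> ~ B v -> lt u v;
  normed_dual : forall u v, B u -> B v -> le u v <-> ~ lt v u;
  normed_trans : forall u v w, B v -> B w -> le u v -> le v w -> le u w;
  normed_wf : forall f : nat -> T, (forall n, B (f n)) -> ~ (forall n, lt (f n.+1) (f n))
}.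

Lemma normed_preimage (T U : Type) (f : T -> U) B le lt : normed B le lt ->
  normed (f @^-1` B) (fun u v => le (f u) (f v)) (fun u v => lt (f u) (f v)).
Proof.
case=> p1 p2 p3 p4 p5 p6 p7; split.
- by move=> u v /p1.
- by move=> u v /p2.
- by move=> u v; exact: p3.
- by move=> u v; exact: p4.
- by move=> u v; exact: p5.
- by move=> u v w; exact: p6.
- by move=> g Bg; exact: (p7 (f \o g)).
Qed.

Lemma normed_min (T : Type) (B : set T) le lt (D : set T) : normed B le lt ->
  D `<=` B -> D !=set0 -> exists2 u, D u & forall v, D v -> le u v.
Proof.
move=> [p1 p2 p3 p4 p5 p6 p7] DB [u0 Du0]; apply: contrapT => nmin.
have next (u : {u | D u}) : exists v : {v | D v}, lt (sval v) (sval u).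
  case: u => u Du /=; apply: contrapT => nv; apply: nmin; exists u => // v Dv.
  by apply/p5; [exact: DB|exact: DB|move=> vu; apply: nv; exists (exist _ v Dv)].
have [g gP] := choice next.
pose f := fix f n := if n is m.+1 then g (f m) else exist _ u0 Du0.
apply: (p7 (fun n => sval (f n))); first by move=> n; exact/DB/(svalP (f n)).
by move=> n; exact: gP.
Qed.

(** * Norms through a universal quantifier: the first periodicity theorem *)

Section normed_forall.
Variables (T : Type) (B : set (T * baire)) (le lt : T * baire -> T * baire -> Prop).
Hypothesis nB : normed B le lt.
Let A := [set x | forall y, B (x, y)].
Hypothesis detB : forall x x', A x -> A x' ->
  (exists s, forall b, lt (x', b) (x, resp1 s b)) \/
  (exists t, forall a, ~ lt (x', resp2 t a) (x, a)).

(** I has no winning strategy in the game where I plays a, II plays b, and II wins when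
    [le (x, a) (x', b)]. In [all_lt] the side of x' moves first, and it is II who has no strategy
    preventing [lt]. Denying a strategy to one player, instead of granting one to the other, puts a
    universal quantifier in front and keeps both relations in the Pi class. *)
Definition all_le x x' := forall s, exists b, le (x, resp1 s b) (x', b).
Definition all_lt x x' := forall t, exists a, lt (x, resp2 t a) (x', a).

Lemma all_leP x x' : A x -> A x' ->
  all_le x x' <-> exists t, forall a, le (x, a) (x', resp2 t a).
Proof.
move=> Ax Ax'; split=> [xx'|[t tP] s].
  have [[s sP]|[t tP]] := detB Ax Ax'.
    by have [b] := xx' s; move=> /(normed_dual nB); case => //; exact: sP.
  by exists t => a; apply: (normed_dual nB (Ax _) (Ax' _)).2; exact: tP.
have [a [b [aE bE]]] := play_ex s t; exists b.
by rewrite -aE bE; exact: tP.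
Qed.

Lemma normed_all : normed A all_le all_lt.
Proof.
have Ale x x' : all_le x x' -> A x.
  (* Testing against the strategy of I that plays [y] whatever happens yields [B (x, y)]. *)
  move=> xx' y; have [b] := xx' (recode (fun q => y (size q))).
  rewrite (_ : resp1 _ b = y); first exact: (normed_le nB).
  by apply/funext => k; rewrite /resp1 recodeE size_mkseq.
split => //.
(* II has already seen k + 1 moves when making move k, hence the predecessor. *)
- move=> x x' xx' y; have [b] := xx' (recode (fun q => y (size q).-1)).
  rewrite (_ : resp2 _ b = y); first exact: (normed_lt nB).
  by apply/funext => k; rewrite /resp2 recodeE size_mkseq.
- by move=> x x' Ax /existsNP[b nB'] s; exists b; exact: (normed_leN nB).
- by move=> x x' Ax /existsNP[b nB'] s; exists b; exact: (normed_ltN nB).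
- move=> x x' Ax Ax'; split=> [/(all_leP Ax Ax')[t tP] /(_ t)[a]|nlt].
    exact: ((normed_dual nB (Ax _) (Ax' _)).1 (tP a)).
  apply/(all_leP Ax Ax'); apply: contrapT => nt; apply: nlt => t.
  apply: contrapT => na; apply: nt; exists t => a.
  by apply: (normed_dual nB (Ax _) (Ax' _)).2 => lta; apply: na; exists a.
- move=> x y z Ay Az xy yz; have Ax := Ale _ _ xy.
  move: xy yz => /(all_leP Ax Ay)[t1 t1P] /(all_leP Ay Az)[t2 t2P].
  apply/(all_leP Ax Az); have [t tE] := resp2_comp t1 t2; exists t => a; rewrite tE.
  by apply: (normed_trans nB) (t1P a) (t2P _); [exact: Ay|exact: Az].
- move=> f Af fdec.
  (* Each descent refutes every strategy of II, so I has a winning one. Played on linked boards,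
     these turn a descending sequence of the new order into one of the old. *)
  have /choice[s sP] : forall n, exists s : nat -> nat,
      forall b, lt (f n.+1, b) (f n, resp1 s b).
    move=> n; have [//|[t tP]] := detB (Af n) (Af n.+1).
    by have [a /tP] := fdec n t.
  have [a aE] := chain_ex s.
  apply: (normed_wf nB (f := fun n => (f n, a n))); first by move=> n; exact: Af.
  by move=> n; rewrite [in X in lt _ X]aE; exact: sP.
Qed.

End normed_forall.

(** * Norms through an existential quantifier *)

Section normed_exists.
Variables (T : Type) (B : set (T * baire)) (le lt : T * baire -> T * baire -> Prop).
Hypothesis nB : normed B le lt.
Let A := [set x | exists y, B (x, y)].

(** The norm of x is the least norm of a witness; a single y that beats all y' expresses this with
    one existential quantifier in front. *)
Definition ex_le x x' := exists y, forall y', le (x, y) (x', y').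
Definition ex_lt x x' := exists y, forall y', lt (x, y) (x', y').

Let min_ex x : A x -> exists2 y, B (x, y) & forall y', B (x, y') -> le (x, y) (x, y').
Proof.
move=> [y0 By0].
have [||_ [y By <-] ymin] := @normed_min _ _ _ _ ((pair x) @` [set y | B (x, y)]) nB.
- by move=> _ [y By <-].
- by exists (x, y0); exists y0.
- by exists y => // y' By'; apply: ymin; exists y'.
Qed.

Let ex_leP x x' y : B (x, y) -> (forall y', B (x, y') -> le (x, y) (x, y')) ->
  A x' -> ex_le x x' <-> forall y', B (x', y') -> le (x, y) (x', y').
Proof.
move=> By ymin _; split=> [[y1 y1P] y' By'|yx].
  apply: (normed_trans nB) (y1P y') => //; first exact: (normed_le nB (y1P y')).
  exact/ymin/(normed_le nB (y1P y')).
exists y => y'; have [By'|nBy'] := pselect (B (x', y')); first exact: yx.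
exact: (normed_leN nB).
Qed.

Let ex_ltP x x' y : B (x, y) -> (forall y', B (x, y') -> le (x, y) (x, y')) ->
  A x' -> ex_lt x x' <-> forall y', B (x', y') -> lt (x, y) (x', y').
Proof.
move=> By ymin _; split=> [[y1 y1P] y' By'|yx].
  have By1 := normed_lt nB (y1P y').
  apply: contrapT => /(normed_dual nB By' By) yy.
  apply/(normed_dual nB By' By1): (y1P y').
  exact: (normed_trans nB) By By1 yy (ymin _ By1).
exists y => y'; have [By'|nBy'] := pselect (B (x', y')); first exact: yx.
exact: (normed_ltN nB).
Qed.

Lemma normed_ex : normed A ex_le ex_lt.
Proof.
split.
- by move=> x x' [y /(_ (fun=> 0%N)) /(normed_le nB)]; exists y.
- by move=> x x' [y /(_ (fun=> 0%N)) /(normed_lt nB)]; exists y.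
- by move=> x x' [y By] nA; exists y => y'; apply: (normed_leN nB) => // By'; apply: nA; exists y'.
- by move=> x x' [y By] nA; exists y => y'; apply: (normed_ltN nB) => // By'; apply: nA; exists y'.
- move=> x x' Ax Ax'; have [y By ymin] := min_ex Ax; have [y' By' y'min] := min_ex Ax'.
  rewrite (ex_leP By ymin Ax') (ex_ltP By' y'min Ax); split=> [yx /(_ _ By)|nyx].
    by apply/(normed_dual nB By By'); exact: yx.
  have yy' : le (x, y) (x', y').
    apply/(normed_dual nB By By') => lt1; apply: nyx => y1 By1.
    apply: contrapT => /(normed_dual nB By1 By') ly1.
    by apply/(normed_dual nB By By'): lt1; exact: (normed_trans nB) By1 By' (ymin _ By1) ly1.
  by move=> y1 By1; exact: (normed_trans nB) By' By1 yy' (y'min _ By1).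
- move=> x x1 x2 Ax1 Ax2 xx1 x12.
  have Ax : A x by case: xx1 => y /(_ (fun=> 0%N)) /(normed_le nB); exists y.
  have [y By ymin] := min_ex Ax; have [y1 By1 y1min] := min_ex Ax1.
  move: xx1 x12; rewrite (ex_leP By ymin Ax1) (ex_leP By1 y1min Ax2) (ex_leP By ymin Ax2).
  by move=> xx1 x12 y2 By2; exact: (normed_trans nB) By1 By2 (xx1 _ By1) (x12 _ By2).
- move=> f Af fdec.
  have /choice[y yP] : forall n, exists y : baire, B (f n, y) /\ (forall y', B (f n, y') -> le (f n, y) (f n, y')).
    by move=> n; have [y ? ?] := min_ex (Af n); exists y.
  apply: (normed_wf nB (f := fun n => (f n, y n))); first by move=> n; exact: (yP n).1.
  move=> n; have [B1 m1] := yP n.+1.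
  by apply: ((ex_ltP B1 m1 (Af n)).1 (fdec n)); exact: (yP n).1.
Qed.

End normed_exists.

(** The prewellordering property of a pointclass. *)
Definition norm_property (Gamma : forall d (T : measurableType d), set (set T)) :=
  forall A : set NN, Gamma _ NN A -> exists le lt : NN -> NN -> Prop,
  [/\ normed A le lt, Gamma _ (NN * NN)%type [set z | le z.1 z.2] &
      Gamma _ (NN * NN)%type [set z | lt z.1 z.2] ].

Ltac mtac := repeat first [ exact: measurable_fst | exact: measurable_snd
  | exact: measurable_id | apply: (measurableT_comp measurable_fst)
  | apply: (measurableT_comp measurable_snd) | apply: measurable_fun_pair
  | apply: measurable_join2 | apply: measurable_resp1 | apply: measurable_resp2
  | apply: measurable_slice ].

Section norm_property_steps.
Variable (m : nat).
Hypothesis det : Pi1_determinacy m.+1.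

Lemma normed_join (C : set (NN * NN)) le lt :
  normed ((fun w : NN => (slice 0 w : NN, slice 1 w : NN)) @^-1` C) le lt ->
  normed (C : set (NN * baire)) (fun u v => le (join2 u.1 u.2) (join2 v.1 v.2))
    (fun u v => lt (join2 u.1 u.2) (join2 v.1 v.2)).
Proof.
move=> /(normed_preimage (fun u : NN * baire => join2 u.1 u.2 : NN)).
by rewrite (_ : _ @^-1` _ = C)//; apply/seteqP; split => -[x y]; rewrite /= !slice_join.
Qed.

Lemma norm_property_Sig n : norm_property (@Pi n.+1) -> norm_property (@Sig n.+2).
Proof.
move=> np A /Sig_inv[C PC ->].
have [le [lt [nrm Ple Plt]]] := np _ (Pi_preimage measurable_split2 PC).
have nC := normed_join nrm.
exists (ex_le (fun u v => le (join2 u.1 u.2) (join2 v.1 v.2))),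
  (ex_lt (fun u v => lt (join2 u.1 u.2) (join2 v.1 v.2))).
have m4 : measurable_fun setT (fun z : ((NN * NN) * NN) * NN =>
    (join2 z.1.1.1 z.1.2 : NN, join2 z.1.1.2 z.2 : NN)).
  by mtac.
split; first exact: normed_ex.
- apply: (@Sig_ex _ _ _ [set z : (NN * NN) * NN |
    forall y' : NN, le (join2 z.1.1 z.2) (join2 z.1.2 y')]).
  apply: (@Pi_all _ _ _ [set z : ((NN * NN) * NN) * NN |
    le (join2 z.1.1.1 z.1.2) (join2 z.1.1.2 z.2)]).
  exact: (Pi_preimage m4 Ple).
- apply: (@Sig_ex _ _ _ [set z : (NN * NN) * NN |
    forall y' : NN, lt (join2 z.1.1 z.2) (join2 z.1.2 y')]).
  apply: (@Pi_all _ _ _ [set z : ((NN * NN) * NN) * NN |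
    lt (join2 z.1.1.1 z.1.2) (join2 z.1.1.2 z.2)]).
  exact: (Pi_preimage m4 Plt).
Qed.

Lemma game_determined_le n (Q : set (NN * NN)) : (n <= m.+1)%N -> Pi n Q ->
  (exists s, forall b, Q (resp1 s b, b)) \/ (exists t, forall a, ~ Q (a, resp2 t a)).
Proof. by move=> nm PQ; apply: (game_determined det); exact: (Pi_le nm). Qed.

(** The last hypotheses isolate the inner quantifier of [all_le] and [all_lt]: at level 0 it ranges
    over an open set and becomes countable, at higher levels the class absorbs it. *)
Lemma norm_property_all n A (C : set (NN * NN)) le lt : (n <= m)%N ->
  A = [set x | forall y, C (x, y)] ->
  normed ((fun w : NN => (slice 0 w : NN, slice 1 w : NN)) @^-1` C) le lt ->
  Sig n [set z : NN * NN | lt z.1 z.2] ->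
  Sig n [set z : (NN * NN) * NN | exists b,
    le (join2 z.1.1 (resp1 z.2 b)) (join2 z.1.2 b)] ->
  Sig n [set z : (NN * NN) * NN | exists a,
    lt (join2 z.1.1 (resp2 z.2 a)) (join2 z.1.2 a)] ->
  exists le lt : NN -> NN -> Prop,
    [/\ normed A le lt, Pi n.+1 [set z : NN * NN | le z.1 z.2] &
      Pi n.+1 [set z : NN * NN | lt z.1 z.2] ].
Proof.
move=> nm -> nrm Slt Sex_le Sex_lt; have nC := normed_join nrm.
exists (all_le (fun u v => le (join2 u.1 u.2) (join2 v.1 v.2))),
  (all_lt (fun u v => lt (join2 u.1 u.2) (join2 v.1 v.2))).
split.
- apply: normed_all => // x x' _ _.
  apply: (game_determined_le (Q := [set z | lt (join2 x' z.2) (join2 x z.1)]) (n := n.+1)) => //.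
  apply/Sig_sub_Pi/(@Sig_preimage _ _ _ (NN * NN)%type (NN * NN)%type
    (fun z => (join2 x' z.2 : NN, join2 x z.1 : NN)) _ _ Slt).
  by mtac; exact: measurable_cst.
- exact: (Pi_allSig Sex_le).
- exact: (Pi_allSig Sex_lt).
Qed.

Lemma norm_property_Pi n : (n.+1 <= m)%N ->
  norm_property (@Sig n.+1) -> norm_property (@Pi n.+2).
Proof.
move=> nm np A PA; have [C PC AC] := Sig_inv (PA : Sig n.+2 (~` A)).
have [le [lt [nrm Ple Plt]]] := np _ (Sig_preimage measurable_split2 PC).
apply: (norm_property_all nm _ nrm Plt).
- apply/seteqP; split => [x Ax y Cxy|x Cx].
    by have : (~` A) x by rewrite AC; exists y.
  by apply: contrapT => nAx; have : (~` A) x by []; rewrite AC => -[y]; exact: Cx.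
- apply: (@Sig_proj _ _ _ [set z : ((NN * NN) * NN) * NN |
    le (join2 z.1.1.1 (resp1 z.1.2 z.2)) (join2 z.1.1.2 z.2)]).
  apply: (@Sig_preimage _ _ _ _ _ (fun z : ((NN * NN) * NN) * NN =>
    (join2 z.1.1.1 (resp1 z.1.2 z.2) : NN, join2 z.1.1.2 z.2 : NN)) _ _ Ple).
  by mtac.
- apply: (@Sig_proj _ _ _ [set z : ((NN * NN) * NN) * NN |
    lt (join2 z.1.1.1 (resp2 z.1.2 z.2)) (join2 z.1.1.2 z.2)]).
  apply: (@Sig_preimage _ _ _ _ _ (fun z : ((NN * NN) * NN) * NN =>
    (join2 z.1.1.1 (resp2 z.1.2 z.2) : NN, join2 z.1.1.2 z.2 : NN)) _ _ Plt).
  by mtac.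
Qed.

End norm_property_steps.

Lemma normed_rank (T : Type) (B : set T) (r : T -> nat) :
  normed B (fun u v => B u /\ (B v -> (r u <= r v)%N))
    (fun u v => B u /\ (B v -> (r u < r v)%N)).
Proof.
split.
- by move=> u v [].
- by move=> u v [].
- by move=> u v.
- by move=> u v.
- move=> u v Bu Bv; split=> [[_ /(_ Bv)] uv [_ /(_ Bu)]|nvu]; first by rewrite ltnNge uv.
  by split => // _; rewrite leqNgt; apply/negP => vu; apply: nvu.
- by move=> u v w Bv Bw [Bu /(_ Bv) uv] [_ /(_ Bw) vw]; split => // _; exact: leq_trans vw.
- move=> f Bf fdec; have lt n : (r (f n.+1) < r (f n))%N by apply: (fdec n).2.
  suff : forall n, (r (f n) + n <= r (f 0))%N by move/(_ (r (f 0%N)).+1); lia.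
  by elim=> [|n IHn]; [rewrite addn0|have := lt n; lia].
Qed.

Lemma continuous_resp1 s : continuous (resp1 s : baire -> baire).
Proof.
apply: continuous_baire => k t; apply/nbhs_cyl; exists k => b.
by rewrite /resp1 /cyl /= size_mkseq => ->.
Qed.

Lemma continuous_resp2 s : continuous (resp2 s : baire -> baire).
Proof.
apply: continuous_baire => k t; apply/nbhs_cyl; exists k.+1 => b.
by move=> /cyl_mkseq/mkseq_eqP E; rewrite /resp2 /mkset E.
Qed.

(** Eventually zero reals are dense, so a real quantifier over an open set becomes countable; this
    keeps the inner quantifier Borel at the lowest level. *)
Lemma open_nonempty_dense (U : set baire) : open U ->
  (exists b, U b) <-> exists q : seq nat, U (nth 0%N q).
Proof.
move=> oU; split=> [[b Ub]|[q Uq]]; last by exists (nth 0%N q).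
have : nbhs b U by apply: open_nbhs_nbhs.
move=> /nbhs_cyl[k kU]; exists (mkseq b k); apply: kU; apply/cyl_mkseq => i ik.
by rewrite nth_mkseq.
Qed.

(** Openness of the relation in the product, expressed by prefixes. *)
Definition finitary (le : baire -> baire -> Prop) := forall u v, le u v ->
  exists k, forall u' v', mkseq u' k = mkseq u k -> mkseq v' k = mkseq v k -> le u' v'.

Lemma finitary_measurable le : finitary le -> measurable [set z : NN * NN | le z.1 z.2].
Proof.
move=> fle; pose good k := [set p : seq nat * seq nat |
  forall u v, mkseq u k = p.1 -> mkseq v k = p.2 -> le u v].
rewrite (_ : [set _ | _] = \bigcup_k [set z : NN * NN | good k (mkseq z.1 k, mkseq z.2 k)]).
  apply: bigcupT_measurable => k.
  apply: (cmeas_pred (f := fun z : NN * NN => (mkseq z.1 k, mkseq z.2 k))).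
  by apply: cmeas_pair; exact: cmeas_prefix.
apply/seteqP; split => [[u v] /= /fle[k kP]|[u v] [k _]]; first by exists k.
exact.
Qed.

Lemma finitary_open le (F G : baire -> baire) : finitary le ->
  continuous F -> continuous G -> open [set b | le (F b) (G b)].
Proof.
move=> fle cF cG; rewrite openE => b /fle[k kP]; rewrite /interior.
have /(cF b) : nbhs (F b) (cyl (mkseq (F b) k)) by apply/nbhs_cyl; exists k.
have /(cG b) : nbhs (G b) (cyl (mkseq (G b) k)) by apply/nbhs_cyl; exists k.
rewrite /nbhs /= => nG nF; apply: filterS (@filterI _ (nbhs b) _ _ _ nF nG) => b' [/cyl_mkseq/mkseq_eqP h /cyl_mkseq/mkseq_eqP].
exact: kP.
Qed.

(** The norm of a pair (x, y) is the length of the shortest prefix that certifies its membership in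
    the open set; the comparison game then deals with the quantifier over y. *)
Lemma norm_property_Pi1 m : Pi1_determinacy m.+1 -> norm_property (@Pi 1).
Proof.
move=> det A PA; have [D oD AD] := Sig_Sigma1 (PA : Sig 1 (~` A)).
pose U := (fun w : baire => (slice 0 w : baire, slice 1 w : baire)) @^-1` (~` D).
have oU : open U.
  by apply: open_preimage oD; apply: continuous_pair; exact: continuous_sliceT.
pose Q q := cyl q `<=` U.
have UQ u : U u <-> exists k, Q (mkseq u k).
  rewrite {1}(open_bigcup_cyl oU); split=> [[p /= pU pu]|[k kU]].
    by exists (size p); rewrite pu.
  by exists (mkseq u k) => //; exact/cyl_mkseq.
pose r u := least [set k | Q (mkseq u k)].
have rP u : U u -> Q (mkseq u (r u)) /\ forall k, Q (mkseq u k) -> (r u <= k)%N.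
  by move=> /UQ; exact: leastP.
pose le u v := U u /\ (U v -> (r u <= r v)%N).
pose lt u v := U u /\ (U v -> (r u < r v)%N).
have Qr u : U u -> Q (mkseq u (r u)) by move=> /rP[].
have rmin u k : Q (mkseq u k) -> U u /\ (r u <= k)%N.
  move=> Quk; have Uu : U u by apply/UQ; exists k.
  by split => //; exact: (rP u Uu).2.
have fle : finitary le.
  move=> u v [Uu uv]; exists (r u) => u' v' uu' vv'.
  have [Uu' ru'] : U u' /\ (r u' <= r u)%N by apply: rmin; rewrite uu'; exact: Qr.
  split=> // Uv'; apply: (leq_trans ru'); rewrite leqNgt; apply/negP => rv'.
  have : Q (mkseq v (r v')).
    suff <- : mkseq v' (r v') = mkseq v (r v') by exact: Qr.
    by apply/mkseq_eqP => i ir; move/mkseq_eqP : vv'; apply; exact: ltn_trans ir rv'.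
  by move=> /rmin[Uv rv]; move: (uv Uv); lia.
have flt : finitary lt.
  move=> u v [Uu uv]; exists (r u).+1 => u' v' uu' vv'.
  have [Uu' ru'] : U u' /\ (r u' <= r u)%N.
    apply: rmin; suff -> : mkseq u' (r u) = mkseq u (r u) by exact: Qr.
    by apply/mkseq_eqP => i ir; move/mkseq_eqP : uu'; apply; exact: ltnW.
  split=> // Uv'; apply: (leq_ltn_trans ru'); rewrite ltnNge; apply/negP => rv'.
  have : Q (mkseq v (r v')).
    suff <- : mkseq v' (r v') = mkseq v (r v') by exact: Qr.
    by apply/mkseq_eqP => i ir; move/mkseq_eqP : vv'; apply; exact: leq_trans ir (ltnW _).
  by move=> /rmin[Uv rv]; move: (uv Uv); lia.
have ids (f : NN) : continuous (fun b : baire => join2 f b : baire).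
  by apply: continuous_join2; [exact: cst_continuous|move=> ?; exact: cvg_id].
apply: (norm_property_all det (C := ~` D) (le := le) (lt := lt) (n := 0)) => //.
- apply/seteqP; split => [x Ax y Dxy|x Cx].
    by have : (~` A) x by rewrite AD; exists (x, y).
  by apply: contrapT => nAx; have : (~` A) x by []; rewrite AD fst_image => -[y]; exact: Cx.
- exact: normed_rank.
- exact: finitary_measurable.
- rewrite (_ : [set _ | _] = \bigcup_(q : seq nat) [set z : (NN * NN) * NN |
    le (join2 z.1.1 (resp1 z.2 (nth 0%N q))) (join2 z.1.2 (nth 0%N q))]).
    apply: countable_bigcupT_measurable => // q.
    apply: (@Sig_preimage 0 _ _ _ _ (fun z : (NN * NN) * NN =>
      (join2 z.1.1 (resp1 z.2 (nth 0%N q)) : NN, join2 z.1.2 (nth 0%N q) : NN)) _ _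
      (finitary_measurable fle)).
    by mtac; exact: measurable_cst.
  apply/seteqP; split => z; last by move=> [q _ qz]; exists (nth 0%N q).
  move=> /(open_nonempty_dense (U := [set b | le (join2 z.1.1 (resp1 z.2 b)) (join2 z.1.2 b)])).
  case; last by move=> q qz; exists q.
  apply: (finitary_open fle) => //.
  exact: (continuous_compose (@continuous_resp1 z.2) (ids z.1.1)).
- rewrite (_ : [set _ | _] = \bigcup_(q : seq nat) [set z : (NN * NN) * NN |
    lt (join2 z.1.1 (resp2 z.2 (nth 0%N q))) (join2 z.1.2 (nth 0%N q))]).
    apply: countable_bigcupT_measurable => // q.
    apply: (@Sig_preimage 0 _ _ _ _ (fun z : (NN * NN) * NN =>
      (join2 z.1.1 (resp2 z.2 (nth 0%N q)) : NN, join2 z.1.2 (nth 0%N q) : NN)) _ _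
      (finitary_measurable flt)).
    by mtac; exact: measurable_cst.
  apply/seteqP; split => z; last by move=> [q _ qz]; exists (nth 0%N q).
  move=> /(open_nonempty_dense (U := [set b | lt (join2 z.1.1 (resp2 z.2 b)) (join2 z.1.2 b)])).
  case; last by move=> q qz; exists q.
  apply: (finitary_open flt) => //.
  exact: (continuous_compose (@continuous_resp2 z.2) (ids z.1.1)).
Qed.

Lemma norm_property_Pi_odd m k : Pi1_determinacy m.+1 -> (k.*2 <= m)%N ->
  norm_property (@Pi k.*2.+1).
Proof.
move=> det; elim: k => [|k IHk] km; first exact: norm_property_Pi1 det.
rewrite doubleS; apply: (norm_property_Pi det) => //.
apply: norm_property_Sig; apply: IHk; lia.
Qed.

(* Moschovakis' norm induction theorem. The index b of the set V inside a
   universal set is a fixed point obtained by diagonalization, which makes V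
   satisfy the recursion "x is in V iff Phi holds at x of the part of V of
   smaller norm". *)
Lemma norm_induction n (Phi : set NN -> NN -> Prop) : norm_property (@Pi n.+1) ->
  (forall Z : set ((NN * NN) * NN), Pi n.+1 Z ->
     Pi n.+1 [set p : NN * NN | Phi [set y | Z (p, y)] p.2]) ->
  exists (V : set NN) (lt : NN -> NN -> Prop),
  [/\ Pi n.+1 V, Pi n.+1 [set z : NN * NN | lt z.1 z.2],
      (forall x, V x <-> Phi [set y | lt y x] x),
      (forall x y, (lt y x -> V y) /\ (V y -> ~ V x -> lt y x)) &
      (forall f : nat -> NN, (forall n, V (f n)) -> ~ (forall n, lt (f n.+1) (f n)))].
Proof.
move=> np PhiP; have [U SU uU] := Sig_universal n.
have msw : measurable_fun setT (fun w : NN => (slice 0 w : NN, w)).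
  by apply: measurable_fun_pair => //; exact: measurable_sliceT.
pose W : set NN := ~` [set w | U (slice 0 w : NN, w)].
have PW : Pi n.+1 W by rewrite /W /Pi /= setCK; exact: (Sig_preimage msw SU).
have [le [lt [nrm _ Plt]]] := np _ PW.
have mlt : measurable_fun setT (fun z : (NN * NN) * NN =>
  (join2 z.1.1 z.2 : NN, join2 z.1.1 z.1.2 : NN)) by mtac.
have := PhiP _ (Pi_preimage mlt Plt).
(* The index [b] codes the failure of [Phi] at pairs (p, x), where p serves as the parameter of the
   norm. Evaluating at [join2 b x] makes the parameter the index itself, which closes the
   recursion. *)
move=> /(Pi_preimage measurable_split2)/uU[b bP].
have jb x : W (join2 b x) <-> Phi [set y | lt (join2 b y) (join2 b x)] x.
  rewrite /W /= slice_join /= -bP /= /preimage /= !slice_join.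
  by split=> [/contrapT|?].
exists (fun x => W (join2 b x)), (fun y x => lt (join2 b y) (join2 b x)).
have mb : measurable_fun setT (fun x : NN => join2 b x : NN).
  by mtac; exact: measurable_cst.
split => //.
- exact: (Pi_preimage mb PW).
- apply: (@Pi_preimage _ _ _ (NN * NN)%type _ (fun z : NN * NN =>
    (join2 b z.1 : NN, join2 b z.2 : NN)) _ _ Plt).
  by mtac; exact: measurable_cst.
- by move=> x y; split; [exact: (normed_lt nrm)|exact: (normed_ltN nrm)].
- move=> f Wf; exact: (normed_wf nrm (f := fun n => join2 b (f n))).
Qed.

(** * Probability measures *)

Lemma exists_invS_lt (R : realType) (e : R) : 0 < e -> exists k : nat, k.+1%:R^-1 < e.
Proof.
move=> e0; exists (Num.truncn e^-1).
by rewrite invf_plt ?posrE//; have := truncnS_gt e^-1; exact.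
Qed.

Section real_probability.
Context d (T : measurableType d) (R : realType) (P : probability T R).
Implicit Types A B : set T.

Definition prb A : R := fine (P A).

Lemma prbE A : measurable A -> P A = (prb A)%:E.
Proof. by move=> mA; rewrite /prb fineK//; exact: fin_num_measure. Qed.

Lemma prb_ge0 A : 0 <= prb A. Proof. exact: fine_ge0. Qed.

Lemma prbT : prb setT = 1. Proof. by rewrite /prb probability_setT. Qed.

Lemma prb0 : prb set0 = 0. Proof. by rewrite /prb measure0. Qed.

Lemma prb_le A B : measurable A -> measurable B -> A `<=` B -> prb A <= prb B.
Proof.
by move=> mA mB AB; rewrite -lee_fin -!prbE// le_measure// inE.
Qed.

Lemma prb_le1 A : measurable A -> prb A <= 1.
Proof. by move=> mA; rewrite -prbT; exact: prb_le. Qed.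

Lemma prb_setD A B : measurable A -> measurable B -> B `<=` A ->
  prb (A `\` B) = prb A - prb B.
Proof.
move=> mA mB BA; apply: EFin_inj.
rewrite EFinB -!prbE//; last exact: measurableD.
rewrite measureD// ?ltey_eq ?fin_num_measure//.
by congr (_ - P _)%E; exact/setIidr.
Qed.

Lemma prb_setC A : measurable A -> prb (~` A) = 1 - prb A.
Proof. by move=> mA; rewrite -setTD prb_setD ?prbT. Qed.

Lemma prb_setU A B : measurable A -> measurable B -> prb (A `|` B) <= prb A + prb B.
Proof.
move=> mA mB; rewrite -lee_fin EFinD -!prbE//; last exact: measurableU.
exact: measureU2.
Qed.

Lemma prb_bigcup_le (A : nat -> set T) (e : R) : 0 <= e ->
  (forall k, measurable (A k)) -> (forall k, prb (A k) <= e / 2 ^+ k.+1) ->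
  prb (\bigcup_k A k) <= e.
Proof.
move=> e0 mA Ae; rewrite -lee_fin -prbE; last exact: bigcupT_measurable.
apply: (le_trans _ (epsilon_trick0 xpredT e0)).
apply: (le_trans (generalized_Boole_inequality P mA (bigcupT_measurable A mA))).
apply: lee_nneseries => [k _ _|k _]; first by [].
by apply: (@le_trans _ _ (prb (A k))%:E); [rewrite -prbE|rewrite lee_fin natrX].
Qed.

Lemma prb_bigcup_gt (A : nat -> set T) (r : R) :
  (forall k, measurable (A k)) -> {homo A : m n / (m <= n)%N >-> m `<=` n} ->
  r < prb (\bigcup_k A k) -> exists k, r < prb (A k).
Proof.
move=> mA hA rA; apply: contrapT => /forallNP nA.
have : (P (\bigcup_k A k) <= r%:E)%E.
  have cA : P \o A @ \oo --> P (\bigcup_k A k).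
    apply: nondecreasing_cvg_mu => //; first exact: bigcupT_measurable.
    by move=> m n mn; apply/subsetPset; exact: hA.
  apply: (cvge_to_le cA); near=> k; rewrite /= prbE// lee_fin leNgt; apply/negP; exact: nA.
by rewrite prbE ?lee_fin ?leNgt ?rA//; exact: bigcupT_measurable.
Unshelve. all: by end_near. Qed.

End real_probability.

(** * Measurable hulls and outer measure *)

Section hull.
Context d (T : measurableType d) (R : realType) (P : probability T R).

Lemma hull_ex (S : set T) : exists B, [/\ measurable B, S `<=` B &
  forall B', measurable B' -> S `<=` B' -> prb P B <= prb P B'].
Proof.
pose V := [set prb P B | B in [set B | measurable B /\ S `<=` B]].
have V0 : has_inf V.
  by split; [exists (prb P setT), setT|exists 0 => _ [B _ <-]; exact: prb_ge0].
have /choice[B BP] : forall k : nat, exists B,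
    [/\ measurable B, S `<=` B & prb P B < inf V + k.+1%:R^-1].
  move=> k; have [_ [B [mB SB] <-] Bk] : exists2 x, V x & x < inf V + k.+1%:R^-1.
    by apply: inf_adherent => //; rewrite invr_gt0.
  by exists B.
exists (\bigcap_k B k); split.
- by apply: bigcapT_measurable => k; have [] := BP k.
- by move=> s Ss k _; have [_ /(_ s Ss)] := BP k.
- move=> B' mB' SB'; apply: (@le_trans _ _ (inf V)); last first.
    by apply: ge_inf; [exact: V0.2|exists B'].
  apply/ler_addgt0Pr => e e0; have [k ke] := exists_invS_lt e0.
  have [mB _ Bk] := BP k; apply: ltW; apply: le_lt_trans (lt_trans Bk _); last by rewrite ltrD2l.
  apply: prb_le => //; first by apply: bigcapT_measurable => i; have [] := BP i.
  exact: bigcap_inf.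
Qed.

Definition outer_prb (S : set T) : R := prb P (sval (cid (hull_ex S))).

Lemma outer_prb_le S B : measurable B -> S `<=` B -> outer_prb S <= prb P B.
Proof. by rewrite /outer_prb; case: cid => B' /= [mB' SB' h]; exact: h. Qed.

Lemma outer_prb_hull S : exists B, [/\ measurable B, S `<=` B & prb P B = outer_prb S].
Proof. by rewrite /outer_prb; case: cid => B' /= [mB' SB' h]; exists B'. Qed.

Lemma outer_prb_measurable B : measurable B -> outer_prb B = prb P B.
Proof.
move=> mB; apply/eqP; rewrite eq_le outer_prb_le//=.
by have [B' [mB' BB' <-]] := outer_prb_hull B; exact: prb_le.
Qed.

Lemma outer_prb_mono S S' : S `<=` S' -> outer_prb S <= outer_prb S'.
Proof.
move=> SS'; have [B' [mB' BB' <-]] := outer_prb_hull S'.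
by apply: outer_prb_le => //; exact: subset_trans BB'.
Qed.

Lemma outer_prb_ge0 S : 0 <= outer_prb S.
Proof. exact: prb_ge0. Qed.

(** Hulls of increasing sets need not increase; [C k], the intersection of all hulls from index k
    on, is still a hull of [S k] and does increase. *)
Lemma outer_prb_bigcup (S : nat -> set T) r : {homo S : m n / (m <= n)%N >-> m `<=` n} ->
  r < outer_prb (\bigcup_k S k) -> exists k, r < outer_prb (S k).
Proof.
move=> hS rS.
have /choice[B BP] := fun k => outer_prb_hull (S k).
pose C k := \bigcap_i B (i + k)%N.
have mC k : measurable (C k) by apply: bigcapT_measurable => i; have [] := BP (i + k)%N.
have CS k : S k `<=` C k.
  by move=> s Ss i _; have [_ + _] := BP (i + k)%N; apply; apply: hS Ss; exact: leq_addl.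
have [k] : exists k, r < prb P (C k).
  apply: prb_bigcup_gt => //.
    move=> m n mn s Cs i _; have := Cs (i + (n - m))%N I.
    by rewrite -addnA subnK.
  apply: lt_le_trans rS _; apply: outer_prb_le; first exact: bigcupT_measurable.
  exact: subset_bigcup.
move=> rk; exists k; apply: lt_le_trans rk _; have [mB SB <-] := BP k.
by apply: prb_le => // s; move=> /(_ 0%N I); rewrite add0n.
Qed.

End hull.

(** * Regularity of probabilities on Baire space *)

Section regularity.
Context (R : realType) (P : probability NN R).

Lemma open_inner (U : set baire) (e : R) : open U -> 0 < e ->
  exists2 C : set baire, closed C & C `<=` U /\ prb P (U `\` C) < e.
Proof.
move=> oU e0; pose A k := if unpickle k is Some p then
  if `[< cyl p `<=` U >] then cyl p else set0 else set0.
have cA k : closed (A k).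
  rewrite /A; case: unpickle => [p|]; last exact: closed0.
  by case: ifP => _; [exact: closed_cyl|exact: closed0].
have AU k : A k `<=` U.
  rewrite /A; case: unpickle => [p|]; last exact: sub0set.
  by case: asboolP => // _; exact: sub0set.
have UA : U `<=` \bigcup_k A k.
  rewrite {1}(open_bigcup_cyl oU) => x [p /= pU px]; exists (pickle p) => //.
  by rewrite /A pickleK asboolT.
pose C n := \bigcup_(k < n) A k.
have cC n : closed (C n).
  rewrite /C bigcup_mkord; apply: (big_ind closed); [exact: closed0|exact: closedU|by []].
have mU : measurable (U : set NN) by exact: measurable_open.
have mC n : measurable (C n : set NN) by exact: measurable_closed.
have [n nP] : exists n, prb P U - e < prb P (C n).
  apply: prb_bigcup_gt => //.
    by move=> i j ij x [k /= ki Ak]; exists k => //; exact: leq_trans ki ij.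
  suff -> : \bigcup_k C k = U by rewrite ltrBlDr ltrDl.
  apply/seteqP; split => [x [k _ [i _]]|x /UA[k _ Ak]]; first exact: AU.
  by exists k.+1 => //; exists k => /=.
exists (C n) => //; split; first by move=> x [k _]; exact: AU.
have CU : C n `<=` U by move=> x [k _]; exact: AU.
by rewrite (prb_setD _ mU)//; lra.
Qed.

(** The sets with such approximations form a sigma-algebra. For a countable union the open sets are
    united outright and the closed ones cut off after finitely many terms, each at a cost of half
    the error. *)
Lemma regular (B : set NN) (e : R) : measurable B -> 0 < e ->
  exists C U : set baire, [/\ closed C, open U, C `<=` B, B `<=` U & prb P (U `\` C) < e].
Proof.
pose G := [set B : set NN | forall e, 0 < e -> exists C U : set baire,
  [/\ closed C, open U, C `<=` B, B `<=` U & prb P (U `\` C) < e]].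
have mo := measurable_open; have mc := measurable_closed.
suff : <<s @open baire >> `<=` G by move=> sub mB e0; exact: (sub B mB e e0).
apply: smallest_sub; last first.
  move=> U oU e' e'0; have [C cC [CU PC]] := open_inner oU e'0.
  by exists C, U; split.
split.
- by move=> e' e'0; exists set0, set0; split => //; [exact: closed0|exact: open0|rewrite setD0 prb0].
- move=> A GA e' e'0; rewrite setTD; have [C [U [cC oU CA AU PUC]]] := GA e' e'0.
  exists (~` U), (~` C); split; [exact: open_closedC|exact: closed_openC|exact: subsetC|exact: subsetC|].
  by rewrite setDE setCK setIC -setDE.
- move=> A GA e' e'0.
  have /choice[CU CUP] : forall k, exists CU : set baire * set baire,
     [/\ closed CU.1, open CU.2, CU.1 `<=` A k, A k `<=` CU.2 &
       prb P (CU.2 `\` CU.1) < (e' / 2) / 2 ^+ k.+1].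
    move=> k; have [|C [U ?]] := GA k ((e' / 2) / 2 ^+ k.+1); last by exists (C, U).
    by rewrite !divr_gt0// exprn_gt0.
  pose C n := \bigcup_(k < n) (CU k).1.
  have cC n : closed (C n).
    rewrite /C bigcup_mkord; apply: (big_ind closed); [exact: closed0|exact: closedU|].
    by move=> i _; have [] := CUP i.
  have oU : open (\bigcup_k (CU k).2) by apply: bigcup_open => k _; have [] := CUP k.
  have mCk k : measurable ((CU k).1 : set NN) by apply: mc; have [] := CUP k.
  have mUk k : measurable ((CU k).2 : set NN) by apply: mo; have [] := CUP k.
  have [n nP] : exists n, prb P (\bigcup_k (CU k).1) - e' / 2 < prb P (C n).
    apply: prb_bigcup_gt; first by move=> k; exact: mc.
      by move=> i j ij x [k /= ki Ak]; exists k => //; exact: leq_trans ki ij.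
    suff -> : \bigcup_k C k = \bigcup_k (CU k).1 by lra.
    apply/seteqP; split => [x [k _ [i _]]|x [k _ Ak]]; first by exists i.
    by exists k.+1 => //; exists k => /=.
  exists (C n), (\bigcup_k (CU k).2); split => //.
  + by move=> x [k _ Ck]; exists k => //; have [_ _ + _ _] := CUP k; apply.
  + by move=> x [k _ Ck]; exists k => //; have [_ _ _ + _] := CUP k; apply.
  have mD : measurable (\bigcup_k (CU k).2 `\` \bigcup_k (CU k).1 : set NN).
    by apply: measurableD; exact: bigcupT_measurable.
  have mE : measurable (\bigcup_k (CU k).1 `\` C n : set NN).
    by apply: measurableD; [exact: bigcupT_measurable|exact: mc].
  have CC : C n `<=` \bigcup_k (CU k).1 by move=> x [k _ ?]; exists k.
  have E1 : prb P (\bigcup_k (CU k).1 `\` C n) < e' / 2.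
    by rewrite prb_setD//; [lra|exact: bigcupT_measurable|exact: mc].
  have E2 : prb P (\bigcup_k (CU k).2 `\` \bigcup_k (CU k).1) <= e' / 2.
    apply: (@le_trans _ _ (prb P (\bigcup_k ((CU k).2 `\` (CU k).1)))).
      apply: prb_le => //; first by apply: bigcupT_measurable => k; exact: measurableD.
      by move=> x [[k _ Uk] nC]; exists k => //; split => // Ck; apply: nC; exists k.
    apply: prb_bigcup_le; [lra|by move=> k; exact: measurableD|].
    by move=> k; apply: ltW; have [] := CUP k.
  apply: (@le_lt_trans _ _ (prb P (\bigcup_k (CU k).2 `\` \bigcup_k (CU k).1) +
     prb P (\bigcup_k (CU k).1 `\` C n))); last by lra.
  apply: le_trans (prb_setU P mD mE); apply: prb_le.
  + by apply: measurableD; [exact: mo|exact: mc].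
  + exact: measurableU.
  + move=> x [Ux nC]; have [?|?] := pselect ((\bigcup_k (CU k).1) x); first by right.
    by left.
Qed.

Lemma outer_open (S : set NN) r : outer_prb P S < r ->
  exists2 U : set baire, open U & S `<=` U /\ prb P U < r.
Proof.
have [B [mB SB <-]] := outer_prb_hull P S => Br.
have [|C [U [cC oU CB BU PUC]]] := @regular B (r - prb P B) mB; first by lra.
have mU : measurable (U : set NN) by exact: measurable_open.
have mC : measurable (C : set NN) by exact: measurable_closed.
exists U => //; split; first exact: subset_trans BU.
have := prb_le P mC mB CB; move: PUC; rewrite prb_setD//; last exact: subset_trans BU.
by lra.
Qed.

End regularity.

Lemma continuous_closure_agree (X : baire -> baire) (c x : baire) : continuous X ->
  (forall n, exists2 c', cyl (mkseq c n) c' & X c' = x) -> X c = x.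
Proof.
move=> cX cx; apply/funext => i.
have /nbhs_cyl[k kX] := baire_continuous cX i c.
by have [c' /kX /= <- ->] := cx k.
Qed.

Lemma baire_hausdorff : hausdorff_space baire.
Proof. by apply: hausdorff_product => _; exact: discrete_hausdorff. Qed.

Lemma compact_bounded (K : baire) : compact [set c : baire | forall i, (c i <= K i)%N].
Proof.
apply: (@tychonoff nat (fun=> nat) (fun i => [set v | (v <= K i)%N])) => i.
apply: finite_compact; rewrite (_ : [set _ | _] = `I_(K i).+1); first exact: finite_II.
by apply/seteqP; split => v /=; rewrite ltnS.
Qed.

(** * Borel right inverses of continuous maps on sets of large measure *)

Section lusin.
Context (R : realType) (P : probability NN R).
Variables (X : baire -> baire) (cX : continuous X).

Let bounded n (K : nat -> nat) : set baire := [set c | forall i, (i < n)%N -> (c i <= K i)%N].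

(** Outer measure is continuous from below, so the coordinates can be bounded one after the other
    without dropping to [r]. *)
Let bound_ex r : r < outer_prb P (range X : set NN) ->
  exists K : nat -> nat, forall n, r < outer_prb P (X @` bounded n K : set NN).
Proof.
move=> rX.
pose good q := r < outer_prb P (X @` bounded (size q) (nth 0%N q) : set NN).
have step q : good q -> exists k, good (rcons q k).
  move=> gq; have [||k] := @outer_prb_bigcup _ NN _ P
      (fun k => X @` bounded (size q).+1 (nth 0%N (rcons q k))) r.
  - move=> m n mn; apply: image_subset => c cm i; rewrite ltnS leq_eqVlt => /orP[/eqP ->|iq].
      by have := cm (size q) (leqnn _); rewrite !nth_rcons ltnn eqxx => /leq_trans; exact.
    by have := cm i (ltnW iq); rewrite !nth_rcons iq.
  - apply: (lt_le_trans gq); apply: outer_prb_mono => _ [c cq <-].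
    exists (c (size q)) => //; exists c => // i; rewrite ltnS leq_eqVlt => /orP[/eqP ->|iq].
      by rewrite nth_rcons ltnn eqxx.
    by rewrite nth_rcons iq; exact: cq.
  by move=> rk; exists k; rewrite /good size_rcons.
have /choice[f fP] : forall q, exists k, good q -> good (rcons q k).
  by move=> q; have [/step[k]|nq] := pselect (good q); [exists k|exists 0%N].
pose L n := iter n (fun q => rcons q (f q)) [::].
have LE n : L n = mkseq (fun n => f (L n)) n.
  by elim: n => // n IHn; rewrite mkseqS -IHn.
exists (fun n => f (L n)) => n.
have : good (L n).
  elim: n => [|n]; last exact: fP.
  rewrite /good /= (_ : bounded _ _ = setT)//.
  by apply/seteqP; split.
rewrite /good LE size_mkseq; congr (_ < outer_prb P (X @` _)).
by apply/seteqP; split => c cn i ni; have := cn i ni; rewrite nth_mkseq.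
Qed.

(** The bounds confine preimages to the compact set [LK], whose pieces have closed images, so
    following the leftmost branch is Borel. The bounds hold for finitely many coordinates at a time,
    and outer measure is not continuous from above; compactness takes the place of that limit. *)
Lemma lusin r : r < outer_prb P (range X : set NN) ->
  exists (D : set NN) (h : NN -> NN), [/\ measurable D, measurable_fun setT h,
    (forall x, D x -> X (h x) = x) & r <= prb P D].
Proof.
move=> /bound_ex[K KP].
pose LK : set baire := [set c | forall i, (c i <= K i)%N].
pose D (p : seq nat) : set NN := X @` (LK `&` cyl p).
have mD p : measurable (D p).
  apply: measurable_closed; apply: compact_closed; first exact: baire_hausdorff.
  apply: continuous_compact; first by apply: continuous_subspaceT => c; exact: cX.
  by apply: compact_closedI; [exact: compact_bounded|exact: closed_cyl].
pose pre x := fix pre n := if n is m.+1 then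
  rcons (pre m) (least [set k | D (rcons (pre m) k) x]) else [::].
pose h x n := least [set k | D (rcons (pre x n) k) x].
have preE x n : pre x n = mkseq (h x) n by elim: n => // n IHn; rewrite mkseqS -IHn.
have mpre n : cmeas (fun x : NN => pre x n).
  elim: n => [|n IHn]; first exact: cmeas_cst.
  apply: (cmeas_bind (g := fun p x => rcons p (least [set k | D (rcons p k) x]))) => // p.
  by apply: (cmeas_comp (rcons p)); exact: cmeas_least.
have mh : measurable_fun setT (h : NN -> NN).
  apply: measurable_NN => n.
  apply: (cmeas_bind (g := fun p x => least [set k | D (rcons p k) x])) => // p.
  exact: cmeas_least.
exists (D [::]), h; split => //.
- move=> x Dx; have Dpre n : D (pre x n) x.
    elim: n => // n [c [LKc pc] cx].
    suff : [set k | D (rcons (pre x n) k) x] !=set0 by move=> /leastP[].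
    exists (c (size (pre x n))), c => //; split => //.
    by rewrite /cyl /= size_rcons mkseqS pc.
  apply: continuous_closure_agree => // n; rewrite -preE.
  by have [c [_ pc] cx] := Dpre n; exists c.
- rewrite leNgt; apply/negP => Dr.
  have [|O oO [DO Or]] := @outer_open R P (D [::]) r; first by rewrite outer_prb_measurable.
  have : forall n, exists c, bounded n K c /\ ~ O (X c).
    move=> n; apply: contrapT => nc.
    have : outer_prb P (X @` bounded n K : set NN) <= prb P (O : set NN).
      apply: outer_prb_le; first exact: measurable_open.
      by move=> _ [c cn <-]; apply: contrapT => nO; apply: nc; exists c.
    by have := KP n; lra.
  move=> /choice[c cP].
  (* [c'] truncates the n-th point into [LK] without altering its first n coordinates, so a cluster
     point in [LK] forces some [X (c n)] into [O]. *)
  pose c' n : baire := fun i => minn (c n i) (K i).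
  have [|c0 [LKc0 /= clc0]] := @compact_bounded K (c' @ \oo).
    by exists 0%N => // n _ i; exact: geq_minr.
  have : nbhs c0 (X @^-1` O).
    apply: open_nbhs_nbhs; split; first exact: open_preimage.
    by apply: DO; exists c0 => //; split.
  move=> /nbhs_cyl[k kO].
  have nc : (c' @ \oo) (c' @` [set n | (k <= n)%N]).
    by exists k => // n kn; exists n.
  have /(clc0 _ _ nc)[_ [[n kn <-]]] : nbhs c0 (cyl (mkseq c0 k)) by apply/nbhs_cyl; exists k.
  move=> /cyl_mkseq c'c0; apply: (cP n).2; apply: kO; apply/cyl_mkseq => i ik.
  rewrite -c'c0// /c'; apply/esym/minn_idPl; apply: (cP n).1.
  exact: leq_trans kn.
Qed.

End lusin.

(** * The covering game *)

Section covering_game.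

Definition cylU (L : seq (seq nat)) : set baire := [set x | exists2 p, p \in L & cyl p x].

Lemma measurable_cylU L : measurable (cylU L : set NN).
Proof.
rewrite (_ : cylU L = \big[setU/set0]_(p <- L) cyl p).
  by apply: bigsetU_measurable => p _; exact: measurable_cyl.
by rewrite -bigcup_seq.
Qed.

(* Player II's move [m] codes the clopen set [clopen m]. *)
Definition clopen (m : nat) : set baire :=
  if unpickle m is Some (L1, L2) then cylU L1 `\` cylU L2 else set0.

Lemma measurable_clopen m : measurable (clopen m : set NN).
Proof.
rewrite /clopen; case: unpickle => [[L1 L2]|]; last exact: measurable0.
by apply: measurableD; exact: measurable_cylU.
Qed.

Lemma clopenE L1 L2 : clopen (pickle (L1, L2)) = cylU L1 `\` cylU L2.
Proof. by rewrite /clopen pickleK. Qed.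

(* Player I's moves, read as bits, enumerate the graph of a real. Bits keep the
   number of positions of length n finite; the first move is ignored, so that
   player II's first move depends on nothing. *)
Definition bits_valid (a : nat -> nat) : Prop :=
  forall k : nat, exists v : nat, a (pickle (k, v)).+1 <> 0%N.

Definition decode (a : nat -> nat) : nat -> nat :=
  fun k : nat => least [set v : nat | a (pickle (k, v)).+1 <> 0%N].

Definition bits (w : nat -> nat) : nat -> nat := fun n =>
  if n is m.+1 then if unpickle m is Some (k, v) then w k == v : nat else 0%N else 0%N.

Arguments bits : simpl never.

Lemma bits_le1 w n : (bits w n <= 1)%N.
Proof. rewrite /bits; case: n => // m; by case: unpickle => // -[k v]; case: eqP. Qed.

Lemma bitsE w k v : bits w (pickle (k, v)).+1 = (w k == v).
Proof. by rewrite /bits pickleK. Qed.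

Lemma bits_validP w : bits_valid (bits w).
Proof. by move=> k; exists (w k); rewrite bitsE eqxx. Qed.

Lemma decodeK w : decode (bits w) = w.
Proof.
apply/funext => k; rewrite /decode.
have := @leastP [set v | bits w (pickle (k, v)).+1 <> 0%N].
case; first by exists (w k); rewrite /= bitsE eqxx.
by rewrite /= bitsE; case: eqP.
Qed.

Lemma measurable_decode d (T : measurableType d) (F : T -> NN) :
  measurable_fun setT F -> measurable_fun setT (fun t => decode (F t) : NN).
Proof.
move=> mF; apply: measurable_NN => k.
apply: (cmeas_least (S := fun v => [set t | F t (pickle (k, v)).+1 <> 0%N])) => v.
exact: (measurable_eval (pickle (k, v)).+1 [set u | u <> 0%N] mF).
Qed.

Lemma measurable_bits_valid : measurable (bits_valid : set NN).
Proof.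
rewrite (_ : bits_valid = \bigcap_(k : nat) \bigcup_(v : nat) [set a : NN | a (pickle (k, v)).+1 <> 0%N]).
  apply: bigcapT_measurable => k; apply: bigcupT_measurable => v.
  exact: (@measurable_eval _ NN id (pickle (k, v)).+1 [set u | u <> 0%N]).
apply/seteqP; split => [a av k _|a av k]; first by have [v] := av k; exists v.
by have [v _ ?] := av k I; exists v.
Qed.

Lemma continuous_decode (T : topologicalType) (F : T -> baire) : continuous F ->
  (forall t, bits_valid (F t)) -> continuous (fun t => decode (F t) : baire).
Proof.
move=> cF vF; apply: continuous_baire => k t.
have [Fv vmin] := leastP (vF t k); set v := least _ in Fv vmin.
(* The prefix must contain every bit that decides a value u up to v; the bit at position
   [(pickle (k, u)).+1] requires length [.+2]. *)
have /(cF t) := nbhs_prefix (F t) (\max_(u < v.+1) (pickle (k, val u)).+2).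
 rewrite /nbhs /=; apply: filterS => t' /cyl_mkseq tt'.
have eqF u : (u <= v)%N -> F t' (pickle (k, u)).+1 = F t (pickle (k, u)).+1.
  move=> uv; apply: tt'.
  by rewrite (leq_trans _ (leq_bigmax (Ordinal (uv : (u < v.+1)%N)))).
have [Fv' vmin'] := leastP (vF t' k); rewrite /= -[decode (F t) k]/v.
apply/eqP; rewrite eqn_leq vmin'/=; last by rewrite eqF.
by apply: vmin => /=; rewrite -eqF//; apply: vmin'; rewrite /= eqF.
Qed.

Variable R : realType.

(** Up to round n player I has 2^n binary positions, so the factor 4^n leaves e / 2^n for all
    replies of that round together. Round 0 has a single position and gets r. *)
Definition bound (r e : R) n : R := if n is 0 then r else e / 4 ^+ n.

(** The plays won by I: I produces a pair (x, y) in [C], and either x escapes all the clopen sets of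
    II or one of them exceeds its bound. Making I play y too is the unfolding: the payoff has the
    complexity of [C], not that of its projection. *)
Definition covering (P : probability NN R) (r e : R) (C : set (NN * NN)) : set (NN * NN) :=
  [set ac | [/\ bits_valid ac.1, C (slice 0 (decode ac.1) : NN, slice 1 (decode ac.1) : NN) &
    (forall n, ~ clopen (ac.2 n) (slice 0 (decode ac.1))) \/
    (exists n, bound r e n < prb P (clopen (ac.2 n)))]].

Lemma prb_bigsetU (P : probability NN R) (I : Type) (s : seq I) (A : I -> set NN) :
  (forall i, measurable (A i)) ->
  prb P (\big[setU/set0]_(i <- s) A i) <= \sum_(i <- s) prb P (A i).
Proof.
move=> mA; elim: s => [|i s IHs]; first by rewrite !big_nil prb0.
rewrite !big_cons; apply: (le_trans (prb_setU P (mA i) _)); last by rewrite lerD2l.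
exact: bigsetU_measurable.
Qed.

(** The replies of a winning strategy of II, over all binary positions of I, cover the projection;
    their total measure is bounded by a geometric series. *)
Lemma covering_II (P : probability NN R) (r e : R) C : 0 <= r -> 0 <= e ->
  (exists t, forall a, ~ covering P r e C (a, resp2 t a)) ->
  outer_prb P [set x | exists y, C (x, y)] <= r + e.
Proof.
move=> r0 e0 [t tP].
(* The leading 0 is I's ignored first move. A reply above its bound is replaced by the empty set,
   since such a reply cannot be what defeats I. *)
pose G (q : seq bool) : set NN :=
  let m := t (pickle (0%N :: map nat_of_bool q)) in
  if prb P (clopen m) <= bound r e (size q) then clopen m else set0.
have mG q : measurable (G q).
  by rewrite /G; case: ifP => // _; exact: measurable_clopen.
have bound0 n : 0 <= bound r e n.
  by case: n => //= n; rewrite divr_ge0// exprn_ge0.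
have PG q : prb P (G q) <= bound r e (size q).
  by rewrite /G; case: ifP => // _; rewrite prb0.
pose H n : set NN := \big[setU/set0]_(q : n.-tuple bool) G q.
have mH n : measurable (H n) by exact: bigsetU_measurable.
have PH n : prb P (H n) <= 2 ^+ n * bound r e n.
  apply: (le_trans (prb_bigsetU P _ (fun q : n.-tuple bool => mG q))).
  apply: (@le_trans _ _ (\sum_(q : n.-tuple bool) bound r e n)).
    by apply: ler_sum => q _; apply: le_trans (PG q) _; rewrite size_tuple.
  by rewrite sumr_const card_tuple card_bool -natrX mulr_natl.
have CH : [set x | exists y, C (x, y)] `<=` H 0%N `|` \bigcup_n H n.+1.
  move=> x [y Cxy]; pose a := bits (join2 x y).
  have [n Fn] : exists n, clopen (resp2 t a n) x /\ prb P (clopen (resp2 t a n)) <= bound r e n.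
    have nW := tP a; apply: contrapT => nn; apply: nW; split; first exact: bits_validP.
      by rewrite /= decodeK !slice_join.
    have [nF|] := pselect (forall n, ~ clopen (resp2 t a n) x).
      by left; rewrite /= decodeK slice_join.
    move=> /existsNP[n /contrapT Fx]; right; exists n.
    by rewrite ltNge; apply/negP => le1; apply: nn; exists n.
  pose q := mkseq (fun i => bits (join2 x y) i.+1 != 0%N) n.
  have Hx : H n x.
    rewrite /H -bigcup_seq; have sq : size q == n by rewrite size_mkseq.
    exists (Tuple sq); first by rewrite /= mem_index_enum.
    rewrite /G /= size_mkseq; case: Fn; rewrite /resp2.
    suff -> : mkseq a n.+1 = 0%N :: map nat_of_bool q by move=> + ->.
    rewrite /mkseq /= /q /mkseq -map_comp (iotaDl 1 0) -map_comp; congr cons.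
    apply: eq_map => i /=; rewrite add1n.
    by have := bits_le1 (join2 x y) i.+1; rewrite /a; case: (bits _ _) => [|[|]].
  by case: n Hx {Fn q} => [|n] Hx; [left|right; exists n].
have mU : measurable (\bigcup_n H n.+1) by exact: bigcupT_measurable.
apply: le_trans (outer_prb_le P _ CH) _; first exact: measurableU.
apply: le_trans (prb_setU P (mH 0%N) mU) _; apply: lerD.
  by have := PH 0%N; rewrite expr0 mul1r.
apply: prb_bigcup_le => // n; apply: le_trans (PH n.+1) _.
rewrite /bound (_ : 4 = 2 * 2 :> R); last by lra.
rewrite exprMn; have : (2 : R) ^+ n.+1 != 0 by rewrite expf_neq0.
move: (2 ^+ n.+1) => p p0; rewrite (_ : p * (e / (p * p)) = e / p)//.
by field.
Qed.

(** If the points produced by [s] had outer measure below r, II could exhaust an open superset of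
    measure below r by clopen sets within the bounds, and [s] would lose. *)
Lemma covering_I (P : probability NN R) (r e : R) C s : 0 < e ->
  (forall c, covering P r e C (resp1 s c, c)) ->
  r <= outer_prb P (range (fun c : baire => slice 0 (decode (resp1 s c)) : NN)).
Proof.
move=> e0 sP; rewrite leNgt; apply/negP => /outer_open [] O oO [XO Or].
pose L n := [seq p <- pmap unpickle (iota 0 n) | `[< cyl p `<=` O >]].
have LO n : cylU (L n) `<=` O.
  by move=> x [p]; rewrite mem_filter => /andP[/asboolP pO _]; exact: pO.
have Lmono : {homo (fun n => cylU (L n)) : m n / (m <= n)%N >-> m `<=` n}.
  move=> m n mn x [p pm px]; exists p => //; move: pm.
  rewrite !mem_filter !mem_pmap => /andP[-> /mapP[i im ->]] /=.
  by apply: map_f; move: im; rewrite !mem_iota; lia.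
have OL : \bigcup_n cylU (L n) = O.
  apply/seteqP; split => [x [n _]|x]; first exact: LO.
  rewrite {1}(open_bigcup_cyl oO) => -[p /= pO px]; exists (pickle p).+1 => //.
  exists p => //; rewrite mem_filter asboolT// andTb mem_pmap.
  by apply/mapP; exists (pickle p); rewrite ?pickleK// mem_iota add0n leqnn.
have mO : measurable (O : set NN) by exact: measurable_open.
have mL n : measurable (cylU (L n) : set NN) by exact: measurable_cylU.
have /choice[j jP] : forall n, exists j, (n <= j)%N /\
    prb P O - prb P (cylU (L j)) < bound r e n.+1.
  move=> n; have b0 : 0 < bound r e n.+1 by rewrite divr_gt0// exprn_gt0.
  have [|k kP] := @prb_bigcup_gt _ _ R P (fun n => cylU (L n)) (prb P O - bound r e n.+1) mL Lmono.
    by rewrite OL; lra.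
  exists (maxn n k); rewrite leq_maxl; split => //.
  by have := prb_le P (mL k) (mL (maxn n k)) (Lmono _ _ (leq_maxr n k)); lra.
(* The first set stays below r because [O] does; each later one is a difference of consecutive
   finite unions, and [j] makes what is left of [O] smaller than the next bound. *)
pose c n := if n is m.+1 then pickle (L (j m.+1), L (j m)) else pickle (L (j 0%N), [::] : seq (seq nat)).
have cE0 : clopen (c 0%N) = cylU (L (j 0%N)).
  by rewrite clopenE; apply/seteqP; split => [x []//|x Lx]; split => // -[].
have := sP c; set x := slice 0 (decode (resp1 s c)); move=> [/= _ _ []]; last first.
  move=> [[|n]].
    rewrite cE0 /= => rL; have := prb_le P (mL (j 0%N)) mO (LO _); lra.
  rewrite clopenE => rL; have [_ jn] := jP n.
  have : prb P (cylU (L (j n.+1)) `\` cylU (L (j n)) : set NN) <= prb P (O `\` cylU (L (j n)) : set NN).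
    by apply: prb_le; [exact: measurableD|exact: measurableD|move=> y [/LO]].
  by rewrite (prb_setD P mO)//; lra.
move=> nF; have Ox : O x by apply: XO; exists c.
have [n0 n0x] : [set n | cylU (L (j n)) x] !=set0.
  by move: Ox; rewrite -OL => -[n _ Lx]; exists n; apply: Lmono Lx; exact: (jP n).1.
have [Lx nmin] := leastP (ex_intro _ n0 n0x); move: (least _) Lx nmin => [|n] Lx nmin.
  by apply: (nF 0%N); rewrite cE0.
apply: (nF n.+1); rewrite clopenE; split => // Ln.
by have := nmin n Ln; rewrite ltnn.
Qed.

(** A winning strategy turns the moves of II continuously into a pair of [C]; choosing the moves in
    a Borel way from the first component, by [lusin], yields the second component. *)
Lemma covering_I_selection (P : probability NN R) (r r' e : R) C s : 0 < e -> r' < r ->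
  (forall c, covering P r e C (resp1 s c, c)) ->
  exists (D : set NN) (h : NN -> NN), [/\ measurable D, measurable_fun setT h,
    (forall x, D x -> C (x, h x)) & r' <= prb P D].
Proof.
move=> e0 rr sP; have cd : continuous (fun c : baire => decode (resp1 s c) : baire).
  apply: continuous_decode; first exact: continuous_resp1.
  by move=> c; have [] := sP c.
have cX := @continuous_slice _ _ 0%N cd.
have [D [h [mD mh Dh PD]]] := lusin cX (lt_le_trans rr (covering_I e0 sP)).
exists D, (fun x => slice 1 (decode (resp1 s (h x)))); split => //.
  by apply: measurable_slice; apply: measurable_decode; exact: measurable_resp1.
by move=> x /Dh hx; have [_ + _] := sP (h x); rewrite /= hx.
Qed.

End covering_game.

(** * Uniformization, universal measurability and the measure quantifier *)

Section measure_quantifier.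
Variables (R : realType) (m : nat).
Hypothesis det : Pi1_determinacy m.+1.

Lemma measurable_clopen_hit d (T : measurableType d) (F G : T -> NN) n :
  measurable_fun setT F -> measurable_fun setT G ->
  measurable [set t | clopen (F t n) (G t)].
Proof.
move=> mF mG; rewrite (_ : [set _ | _] = \bigcup_k ([set t | F t n = k] `&` G @^-1` (clopen k))).
  apply: bigcupT_measurable => k; apply: measurableI; first exact: (measurable_eval n [set k] mF).
  rewrite -[X in measurable X]setTI; apply: mG => //; exact: measurable_clopen.
by apply/seteqP; split => [t Ft|t [k _ [/= ->]]//]; exists (F t n).
Qed.

Lemma Pi_covering n d (T : measurableType d) (nu : T -> probability NN R) (r e : R)
    (C : set (T * NN * NN)) (A : T -> NN) (c : T -> NN) :
  (forall B, measurable B -> measurable_fun setT (fun t => prb (nu t) B)) ->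
  measurable_fun setT A -> measurable_fun setT c -> Pi n C ->
  Pi n [set t | covering (nu t) r e [set xy | C ((t, xy.1), xy.2)] (A t, c t)].
Proof.
move=> mnu mA mc PC.
have mdec k : measurable_fun setT (fun t => slice k (decode (A t)) : NN).
  exact/measurable_slice/measurable_decode.
rewrite (_ : [set _ | _] = (A @^-1` bits_valid) `&`
    ((fun t => ((t, slice 0 (decode (A t)) : NN), slice 1 (decode (A t)) : NN)) @^-1` C) `&`
    ((~` \bigcup_n [set t | clopen (c t n) (slice 0 (decode (A t)))]) `|`
     \bigcup_n \bigcup_k ([set t | c t n = k] `&` [set t | bound r e n < prb (nu t) (clopen k)]))).
  apply: Pi_setI; [apply: Pi_setI|].
  - by apply: Pi_preimage mA _; apply: measurable_Pi; exact: measurable_bits_valid.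
  - by apply: Pi_preimage PC; apply: measurable_fun_pair => //; apply: measurable_fun_pair.
  - apply: measurable_Pi; apply: measurableU.
      apply: measurableC; apply: bigcupT_measurable => k.
      exact: (measurable_clopen_hit k mc (mdec 0%N)).
    apply: bigcupT_measurable => i; apply: bigcupT_measurable => k.
    apply: measurableI; first exact: (measurable_eval i [set k] mc).
    rewrite -[X in measurable X]setTI (_ : [set _ | _] =
      (fun t => prb (nu t) (clopen k)) @^-1` `]bound r e i, +oo[%classic).
      by apply: mnu => //; exact: measurable_clopen.
    by apply/seteqP; split => t /=; rewrite in_itv/= andbT.
apply/seteqP; split => t.
  move=> [va Ct [nF|[i iP]]]; split => //; first by left => -[i _]; exact: nF.
  by right; exists i => //; exists (c t i).
move=> [[va Ct] [nF|[i _ [k _ [<- iP]]]]]; split => //; last by right; exists i.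
by left => i Fi; apply: nF; exists i.
Qed.

Lemma covering_determined n (P : probability NN R) (r e : R) (C : set (NN * NN)) :
  (n <= m.+1)%N -> Pi n C ->
  (exists s, forall c, covering P r e C (resp1 s c, c)) \/
  (exists t, forall a, ~ covering P r e C (a, resp2 t a)).
Proof.
move=> nm PC; apply: (game_determined_le det nm).
have := @Pi_covering n _ (NN * NN)%type (fun=> P) r e
  [set z : (NN * NN) * NN * NN | C (z.1.2, z.2)] fst snd.
rewrite (_ : [set t | _] = covering P r e C); last by apply/seteqP; split => -[a c].
apply => //; apply: (@Pi_preimage _ _ _ _ _ (fun z : (NN * NN) * NN * NN => (z.1.2, z.2))) PC.
by mtac.
Qed.

(** The covering game gives a selection up to any positive error; countably many are glued, using at
    x the first one whose domain contains x. *)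
Lemma uniformization n (P : probability NN R) (C : set (NN * NN)) :
  (n <= m.+1)%N -> Pi n C ->
  exists (D : set NN) (h : NN -> NN), [/\ measurable D, measurable_fun setT h,
    (forall x, D x -> C (x, h x)) & prb P D = outer_prb P [set x | exists y, C (x, y)]].
Proof.
move=> nm PC; set A := [set x | _].
have /choice[Dh DhP] : forall k : nat, exists Dh : set NN * (NN -> NN),
    [/\ measurable Dh.1, measurable_fun setT Dh.2, (forall x, Dh.1 x -> C (x, Dh.2 x)) &
      outer_prb P A - k.+1%:R^-1 <= prb P Dh.1].
  move=> k; have : 0 < k.+1%:R^-1 :> R by rewrite invr_gt0.
  (* With threshold [e / 3] below the outer measure and tolerance [e / 4], a win of II would bound
     the outer measure by [r + e / 4], which is smaller; so I wins. *)
  move: k.+1%:R^-1 => e e0; pose r := outer_prb P A - e / 3.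
  have [r0|r0] := ltP r 0.
    exists (set0, id); split => //=.
    by rewrite prb0; move: r0; rewrite /r; lra.
  have [[s sP]|tP] := covering_determined P r (e / 4) nm PC.
    have [||D [h [? ? ? ?]]] := @covering_I_selection _ P r
      (outer_prb P A - e) (e / 4) C s _ _ sP; [lra|rewrite /r; lra|].
    by exists (D, h).
  have e4 : 0 <= e / 4 by lra.
  by have := covering_II r0 e4 tP; rewrite -/A /r; lra.
pose D k := (Dh k).1; pose h k := (Dh k).2.
have mD k : measurable (D k) by have [] := DhP k.
exists (\bigcup_k D k), (fun x => h (least [set k | D k x]) x); split.
- exact: bigcupT_measurable.
- apply: measurable_NN => i.
  apply: (cmeas_bind (g := fun k x => h k x i)); first exact: cmeas_least.
  by move=> k; have [_ mh _ _] := DhP k; exact: (@cmeas_eval _ _ _ i mh).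
- move=> x [k _ Dk]; have [Dx _] := leastP (ex_intro [set k | D k x] k Dk).
  by have [_ _ + _] := DhP (least [set k | D k x]); apply.
- apply/eqP; rewrite eq_le; apply/andP; split.
    rewrite -(outer_prb_measurable P (bigcupT_measurable _ mD)); apply: outer_prb_mono.
    move=> x [k _ Dk]; have [_ _ Ch _] := DhP k; exists (h k x); exact: Ch.
  apply/ler_addgt0Pr => e e0; have [k ke] := exists_invS_lt e0.
  have [_ _ _ Pk] := DhP k.
  have : prb P (D k) <= prb P (\bigcup_k D k).
    by apply: prb_le => //; [exact: bigcupT_measurable|move=> x Dx; exists k].
  by move: k.+1%:R^-1 ke Pk => e'; rewrite -/(D k); lra.
Qed.

(** Membership in the completion of the sigma-algebra with respect to [P]. *)
Definition sandwiched d (T : measurableType d) (P : probability T R) (A : set T) :=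
  exists B C : set T, [/\ measurable B, measurable C, B `<=` A, A `<=` C & prb P B = prb P C].

Lemma Sig_sandwiched n (P : probability NN R) (A : set NN) : (n <= m.+1)%N ->
  Sig n.+1 A -> sandwiched P A.
Proof.
move=> nm /Sig_inv[C PC AC]; have [D [h [mD mh Dh PD]]] := uniformization P nm PC.
have [B [mB AB PB]] := outer_prb_hull P A.
exists D, B; split => //; last by rewrite PD PB AC.
by move=> x /Dh Cx; rewrite AC; exists (h x).
Qed.

(** By determinacy, outer measure above r means that I wins the covering game for some rational
    bound above r and some tolerance. A winning strategy is one existential real, and checking it is
    a universal condition over the plays of II. *)
Lemma Sig_outer_gt n d (T : measurableType d) (nu : T -> probability NN R) (r : R)
    (A : set (T * NN)) : (n.+1 <= m.+1)%N -> 0 <= r ->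
  (forall B, measurable B -> measurable_fun setT (fun t => prb (nu t) B)) ->
  Sig n.+2 A -> Sig n.+2 [set t | r < outer_prb (nu t) [set x | A (t, x)]].
Proof.
move=> nm r0 mnu /Sig_inv[C PC AC].
pose Ct t : set (NN * NN) := [set xy | C ((t, xy.1), xy.2)].
have ACt t : [set x | A (t, x)] = [set x | exists y, Ct t (x, y)].
  by rewrite AC; apply/seteqP; split.
pose W (q : rat) k := [set t | exists s : NN,
  [set z : T * NN | forall c : NN, covering (nu z.1) (ratr q) k.+1%:R^-1 (Ct z.1) (resp1 z.2 c, c)] (t, s)].
have SW q k : Sig n.+2 (W q k).
  apply: Sig_ex; apply: (@Pi_all _ _ _ [set z : (T * NN) * NN |
    covering (nu z.1.1) (ratr q) k.+1%:R^-1 (Ct z.1.1) (resp1 z.1.2 z.2, z.2)]).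
  have := @Pi_covering n.+1 _ ((T * NN) * NN)%type (fun z => nu z.1.1) (ratr q) k.+1%:R^-1
    [set z | C ((z.1.1.1.1, z.1.2), z.2)] (fun z => resp1 z.1.2 z.2) snd.
  apply.
  - by move=> B mB; apply: (measurableT_comp (mnu B mB)); mtac.
  - by mtac.
  - by mtac.
  - apply: (@Pi_preimage _ _ _ _ _ (fun z : (T * NN) * NN * NN * NN => ((z.1.1.1.1, z.1.2), z.2))) PC.
    by mtac.
rewrite (_ : [set t | _] = \bigcup_(q : rat) (if r < ratr q then \bigcup_k W q k else set0)).
  apply: Sig_bigcup_countable; first exact/measurable_Sig/measurable0.
  move=> q; case: ifP => _; last exact/measurable_Sig/measurable0.
  exact: Sig_bigcup.
apply/seteqP; split => [t /= rt|t [q _]].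
  have [q] := rat_in_itvoo rt; rewrite in_itv/= => /andP[rq qt].
  exists q => //; rewrite rq; set o := outer_prb _ _ in qt.
  have e0 : 0 < o - ratr q by lra.
  have [k ke] := exists_invS_lt e0.
  have k0 : 0 < k.+1%:R^-1 :> R by rewrite invr_gt0.
  have PCt : Pi n.+1 (Ct t).
    apply: (@Pi_preimage _ _ _ (NN * NN)%type _ (fun xy : NN * NN => ((t, xy.1), xy.2))) PC.
    by mtac; exact: measurable_cst.
  have [[s sP]|tP] := covering_determined (nu t) (ratr q) k.+1%:R^-1 nm PCt.
    by exists k => //; exists s.
  have := covering_II _ (ltW k0) tP; rewrite -ACt -/o.
  by move: k.+1%:R^-1 ke => e' e'o /(_ (le_trans r0 (ltW rq))); lra.
case: ifP => // rq [k _ [s sP]]; apply: (lt_le_trans rq).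
have k0 : 0 < k.+1%:R^-1 :> R by rewrite invr_gt0.
apply: le_trans (covering_I k0 sP) _; apply: outer_prb_mono => _ [c _ <-].
by rewrite ACt; exists (slice 1 (decode (resp1 s c))); have [] := sP c.
Qed.

End measure_quantifier.

(** * Codes of measures *)

Definition mfun_of d d' (T : measurableType d) (U : measurableType d') (f : T -> U)
    (mf : measurable_fun setT f) : {mfun T >-> U} :=
  HB.pack f (isMeasurableFun.Build _ _ _ _ f mf).

Definition push d d' (T : measurableType d) (U : measurableType d') (R : realType)
    (P : probability T R) (f : T -> U) (mf : measurable_fun setT f) : probability U R :=
  distribution P (mfun_of mf).

Lemma pushE d d' (T : measurableType d) (U : measurableType d') (R : realType)
    (P : probability T R) (f : T -> U) (mf : measurable_fun setT f) B :
  push P mf B = P (f @^-1` B).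
Proof. by []. Qed.

Lemma prb_push d d' (T : measurableType d) (U : measurableType d') (R : realType)
    (P : probability T R) (f : T -> U) (mf : measurable_fun setT f) B :
  prb (push P mf) B = prb P (f @^-1` B).
Proof. by []. Qed.

Lemma prb_setI1 d (T : measurableType d) (R : realType) (P : probability T R) (A B : set T) :
  measurable A -> measurable B -> prb P B = 1 -> prb P (A `&` B) = prb P A.
Proof.
move=> mA mB B1; have mAB : measurable (A `&` B) by exact: measurableI.
apply/eqP; rewrite eq_le; apply/andP; split; first by apply: prb_le => // x [].
have -> : prb P (A `&` B) = prb P (A `&` B) + prb P (~` B) by rewrite prb_setC// B1 subrr addr0.
apply: le_trans (prb_setU P mAB (measurableC mB)); apply: prb_le => //.
  by apply: measurableU => //; exact: measurableC.
by move=> x Ax; have [Bx|nBx] := pselect (B x); [left|right].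
Qed.

Section codes_of_measures.
Variable R : realType.

Let U : probability (measurableTypeR R) R := uniform_prob (@ltr01 R).

Lemma uniform01_itv (a b : R) : 0 <= a -> a <= b -> b <= 1 -> U `[a, b[%classic = (b - a)%:E.
Proof.
move=> a0 ab b1; have mab : measurable (`[a, b[%classic : set R) by exact: measurable_itv.
rewrite -[`[a, b[%classic]setIT -integral_indic// integral_uniform//; last first.
  exact/measurable_EFinP.
rewrite subr0 invr1 mul1e integral_indic//.
rewrite (_ : `[a, b[%classic `&` _ = `[a, b[%classic); last first.
  apply/setIidPl => x /=; rewrite !in_itv/= => /andP[ax xb].
  by rewrite (le_trans a0 ax)/= (le_trans (ltW xb)).
rewrite [LHS](lebesgue_measure_itv `[a, b[)/= lte_fin; move: ab; rewrite le_eqVlt => /orP[/eqP ->|->//].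
by rewrite ltxx subrr.
Qed.

Lemma prob_cyl_unique (P Q : probability NN R) :
  (forall p, P (cyl p) = Q (cyl p)) -> forall B, measurable B -> P B = Q B.
Proof.
move=> PQ; pose G : set (set NN) := [set B | B = set0 \/ exists p, B = cyl p].
apply: (@measure_unique _ R NN G (fun=> setT)).
- apply/seteqP; split => B.
    suff sub : @open baire `<=` <<s G >>.
      by apply: smallest_sub => //; exact: smallest_sigma_algebra.
    move=> V oV; rewrite (open_bigcup_cyl oV).
    rewrite (_ : \bigcup_(p in _) _ = \bigcup_(p : seq nat) (if `[< cyl p `<=` V >] then cyl p else set0)).
      rewrite (bigcup_unpickle (I := seq nat)); apply: sigma_algebra_bigcup => k.
      by apply: sub_sigma_algebra; case: ifP => _; [right; eexists|left].
    apply/seteqP; split => [t [p /= pU pt]|t [p _]]; first by exists p => //; rewrite asboolT.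
    by case: asboolP => // pU pt; exists p.
  apply: smallest_sub; first exact: sigma_algebra_measurable.
  by move=> _ [->|[p ->]]; [exact: measurable0|exact: measurable_cyl].
- move=> A B [->|[p ->]]; first by rewrite set0I; left.
  move=> [->|[q ->]]; first by rewrite setI0; left.
  have [[x [px qx]]|nx] := pselect ((cyl p `&` cyl q) !=set0); last first.
    by left; apply/seteqP; split => // x xpq; apply: nx; exists x.
  right; exists (mkseq x (maxn (size p) (size q))).
  apply/seteqP; split => y; last first.
    move=> /cyl_mkseq xy; rewrite /cyl /= in px qx *; split.
      by rewrite -[RHS]px; apply/mkseq_eqP => i ip; rewrite xy// leq_max ip.
    by rewrite -[RHS]qx; apply/mkseq_eqP => i ip; rewrite xy// leq_max ip orbT.
  move=> [py qy]; apply/cyl_mkseq => i; rewrite /cyl /= in px qx py qy.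
  rewrite leq_max => /orP[ip|iq].
    by move: py; rewrite -{2}px => /mkseq_eqP; exact.
  by move: qy; rewrite -{2}qx => /mkseq_eqP; exact.
- by move=> _; right; exists [::]; apply/seteqP; split.
- by rewrite bigcup_const.
- by move=> A [->|[p ->]]; [rewrite (measure0 P) (measure0 Q)|exact: PQ].
- by move=> _; rewrite [X in (X < _)%E](probability_setT P) ltry.
Qed.

(* The first n moves of the x-th branch of the partition of [0, 1[ whose
   intervals have the right ends coded by z. *)
Let branch (S : seq nat -> nat -> Prop) : nat -> seq nat := fix branch n :=
  if n is m.+1 then rcons (branch m) (least (S (branch m))) else [::].

(** For each p and k, [z] marks a set of rationals whose supremum serves as the right end of the
    interval of [rcons p k]; x lies to its left when some marked rational exceeds x. *)
Definition below (z : NN) (x : R) (p : seq nat) (k : nat) : Prop :=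
  exists q : rat, z (pickle (p, k, q)) <> 0%N /\ x < ratr q.

Definition quantile (z : NN) (x : R) : NN := fun n => least (below z x (branch (below z x) n)).

Let branchE z x n : branch (below z x) n = mkseq (quantile z x) n.
Proof. by elim: n => // n IHn; rewrite mkseqS -IHn. Qed.

Let measurable_below p k : measurable [set zx : NN * measurableTypeR R | below zx.1 zx.2 p k].
Proof.
rewrite (_ : [set _ | _] = \bigcup_(q : rat) ([set zx : NN * measurableTypeR R |
  zx.1 (pickle (p, k, q)) <> 0%N] `&` (snd @^-1` `]-oo, ratr q[%classic))).
  apply: bigcupT_measurable_rat => q; apply: measurableI.
    exact: (@measurable_eval _ (NN * measurableTypeR R)%type fst (pickle (p, k, q)) [set u | u <> 0%N]).
  rewrite -[X in measurable X]setTI; apply: measurable_snd => //.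
by apply/seteqP; split => -[z x] /=; [move=> [q [zq xq]]; exists q => //; split => //=; rewrite in_itv
  |move=> [q _ /= [zq]]; rewrite in_itv/= => xq; exists q].
Qed.

Lemma measurable_quantile :
  measurable_fun setT (fun zx : NN * measurableTypeR R => quantile zx.1 zx.2).
Proof.
have mb n : cmeas (fun zx : NN * measurableTypeR R => branch (below zx.1 zx.2) n).
  elim: n => [|n IHn]; first exact: cmeas_cst.
  apply: (cmeas_bind (g := fun p (zx : NN * measurableTypeR R) =>
    rcons p (least (below zx.1 zx.2 p)))) => // p.
  by apply: (cmeas_comp (rcons p)); apply: (cmeas_least (measurable_below p)).
apply: measurable_NN => n.
apply: (cmeas_bind (g := fun p (zx : NN * measurableTypeR R) =>
  least (below zx.1 zx.2 p)) (mb n)) => p.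
exact: (cmeas_least (measurable_below p)).
Qed.

Let measurable_quantile2 z : measurable_fun setT (quantile z : measurableTypeR R -> NN).
Proof. exact: (measurableT_comp measurable_quantile (pair1_measurable z)). Qed.

(** The image of the uniform measure under the quantile map. Every real codes some probability, so a
    quantifier over measures is a quantifier over all reals. *)
Definition coded_prob (z : NN) : probability NN R := push U (measurable_quantile2 z).

Lemma measurable_coded_prob B : measurable B ->
  measurable_fun setT (fun z => prb (coded_prob z) B).
Proof.
move=> mB; have mQ : measurable [set zx : NN * measurableTypeR R | B (quantile zx.1 zx.2)].
  by rewrite -[X in measurable X]setTI; exact: measurable_quantile.
have := measurable_fun_xsection U mQ => mx.
apply: (measurableT_comp (fine_measurable measurableT)) => //.
rewrite (_ : (fun _ => _) = U \o xsection [set zx : NN * measurableTypeR R | B (quantile zx.1 zx.2)])//.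
apply/funext => z; rewrite -[LHS]/(U (quantile z @^-1` B)); congr (U _).
by apply/seteqP; split => x; rewrite /xsection /= in_setE.
Qed.

(** The cylinders of a given length, in lexicographic order, divide the unit interval into
    consecutive pieces of their [P]-measure; [z] marks the right ends and the quantile map sends
    each piece into its cylinder. *)
Lemma coded_prob_surj (P : probability NN R) :
  exists z, forall B, measurable B -> coded_prob z B = P B.
Proof.
(* The reals that come lexicographically before the whole cylinder of p. *)
pose lex p : set NN := [set y | exists2 i, (i < size p)%N &
  (forall j, (j < i)%N -> y j = nth 0%N p j) /\ (y i < nth 0%N p i)%N].
have lexS p k : lex (rcons p k) = lex p `|` (cyl p `&` [set y | (y (size p) < k)%N]).
  apply/seteqP; split => y.
    move=> [i]; rewrite size_rcons ltnS leq_eqVlt => /orP[/eqP ->|ip] [yj yi].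
      right; split; last by move: yi; rewrite nth_rcons ltnn eqxx.
      rewrite /cyl /=; apply: (@eq_from_nth _ 0%N); rewrite ?size_mkseq// => j jp.
      by rewrite nth_mkseq// yj// nth_rcons jp.
    left; exists i => //; rewrite nth_rcons ip in yi; split => // j ji.
    by rewrite yj// nth_rcons (ltn_trans ji ip).
  move=> [[i ip [yj yi]]|[py yk]].
    exists i; first by rewrite size_rcons ltnW.
    rewrite nth_rcons ip; split => // j ji.
    by rewrite yj// nth_rcons (ltn_trans ji ip).
  exists (size p); first by rewrite size_rcons.
  rewrite nth_rcons ltnn eqxx; split => // j jp.
  by rewrite nth_rcons jp -(nth_mkseq 0%N y jp) py.
have mcut p k : measurable (cyl p `&` [set y : NN | (y (size p) < k)%N] : set NN).
  apply: measurableI; first exact: measurable_cyl.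
  exact: (@measurable_eval _ NN id (size p) [set v | (v < k)%N]).
have mlex p : measurable (lex p).
  elim/last_ind: p => [|p k IHp]; last by rewrite lexS; exact: measurableU.
  rewrite (_ : lex _ = set0); first exact: measurable0.
  by apply/seteqP; split => // y [].
have lexI p : lex p `&` cyl p = set0.
  apply/seteqP; split => // y [[i ip [_]]]; rewrite /cyl /= => + py.
  by rewrite -(nth_mkseq 0%N y ip) py ltnn.
pose lo p := prb P (lex p); pose up p := prb P (lex p `|` cyl p).
have upE p : up p = lo p + prb P (cyl p).
  apply: EFin_inj; rewrite EFinD -!prbE//; try exact: measurable_cyl.
    by rewrite measureU//; exact: measurable_cyl.
  by apply: measurableU => //; exact: measurable_cyl.
have upS p k : up (rcons p k) = lo (rcons p k.+1).
  rewrite /up /lo; congr prb; rewrite !lexS -setUA; congr setU.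
  apply/seteqP; split => y.
    move=> [[py yk]|]; first by split => //; exact: leqW.
    rewrite /cyl /= size_rcons mkseqS => /rcons_inj[py <-]; split => //=.
  move=> [py /=]; rewrite ltnS leq_eqVlt => /orP[/eqP yk|yk]; last by left.
  by right; rewrite /cyl /= size_rcons mkseqS py yk.
have lo0 p : lo (rcons p 0%N) = lo p.
  by rewrite /lo lexS; congr prb; apply/seteqP; split => y; [move=> [//|[_]]|left].
have lo_mono p k l : (k <= l)%N -> lo (rcons p k) <= lo (rcons p l).
  move=> kl; apply: prb_le => //; rewrite !lexS; apply: setUS => y [py yk].
  by split => //=; exact: leq_trans yk kl.
have lo_up p k : lo (rcons p k) <= up p.
  rewrite /lo /up lexS; apply: prb_le; last by apply: setUS => y [].
    exact: measurableU.
  by apply: measurableU => //; exact: measurable_cyl.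
(* The right end of the interval of [rcons p k] is [up (rcons p k)], which by [upS] is the left end
   of the next one. *)
pose z : NN := fun m => if @unpickle (seq nat * nat * rat)%type m is Some (p, k, q) then
  nat_of_bool (ratr q <= lo (rcons p k.+1))%R else 0%N.
have belowE p k x : below z x p k <-> x < lo (rcons p k.+1).
  split=> [[q [zq xq]]|xk].
    apply: (lt_le_trans xq); move: zq; rewrite /z pickleK.
    by case: (ratr q <= _).
  have [q] := rat_in_itvoo xk; rewrite in_itv/= => /andP[xq qk].
  by exists q; split => //; rewrite /z pickleK (ltW qk).
exists z; apply: prob_cyl_unique => p.
have quantP x p' : 0 <= x < 1 -> cyl p' (quantile z x) <-> lo p' <= x < up p'.
  move=> /andP[x0 x1]; elim/last_ind: p' => [|p' k IHp].
    rewrite /lo /up (_ : lex _ = set0); last by apply/seteqP; split => // y [].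
    rewrite set0U (_ : cyl _ = setT); last by apply/seteqP; split.
    by rewrite prb0 prbT x0 x1; split.
  have qk : cyl p' (quantile z x) -> (quantile z x (size p') = k <->
      lo (rcons p' k) <= x < lo (rcons p' k.+1)).
    move=> px; rewrite /quantile branchE px.
    have ex : [set l | below z x p' l] !=set0.
      have /andP[xlo xup] := IHp.1 px.
      have [|||l xl] := @prb_bigcup_gt _ _ _ P (fun l => lex (rcons p' l)) x.
      - by move=> l.
      - move=> l l' ll'; rewrite !lexS; apply: setUS => y [py yk].
        by split => //=; exact: leq_trans yk ll'.
      - rewrite (_ : \bigcup_k _ = lex p' `|` cyl p')//; apply/seteqP; split => y.
          by move=> [l _]; rewrite lexS => -[|[]]; [left|right].
        move=> ply; exists (y (size p')).+1 => //; rewrite lexS.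
        by case: ply => ply; [left|right; split => /=].
      exists l; apply/belowE; apply: (lt_le_trans xl); exact: lo_mono.
    have [/belowE Sl lmin] := leastP ex; split=> [lk|/andP[xlo xup]].
      move: Sl lmin; rewrite -[[set l | below z x p' l]]/(below z x p') lk => -> lmin.
      rewrite andbT; case: k lmin {lk} => [|l] lmin.
        by have /andP[] := IHp.1 px; rewrite lo0.
      rewrite leNgt; apply/negP => /belowE xl.
      by have := lmin l xl; rewrite ltnn.
    apply/eqP; rewrite eqn_leq lmin/=; last exact/belowE.
    rewrite leqNgt; apply/negP => lk; have := lo_mono p' _ _ lk.
    by move: Sl xlo; case: (least _) => // *; lra.
  rewrite upS; split=> [|/andP[xlo xup]].
    rewrite {1}/cyl /= size_rcons mkseqS => /rcons_inj[px xk].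
    exact/qk.
  have px : cyl p' (quantile z x).
    apply/IHp/andP; split.
      by apply: le_trans xlo; rewrite -lo0; exact: lo_mono.
    by apply: (lt_le_trans xup); exact: lo_up.
  rewrite /cyl /= size_rcons mkseqS px; congr rcons; apply/qk => //.
  by rewrite xlo xup.
have mc : measurable (cyl p : set NN) by exact: measurable_cyl.
rewrite -[LHS]/(U (quantile z @^-1` cyl p)).
have -> : U (quantile z @^-1` cyl p) = U `[lo p, up p[%classic.
  have U01 (V : set (measurableTypeR R)) : measurable V -> U V = U (V `&` `[0, 1[%classic).
    move=> mV; have m01 : measurable (`[(0 : R), 1[%classic : set (measurableTypeR R)).
      exact: measurable_itv.
    rewrite !prbE//; last exact: measurableI.
    by rewrite prb_setI1// /prb uniform01_itv// subr0.
  have mi : measurable (`[lo p, up p[%classic : set (measurableTypeR R)) by exact: measurable_itv.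
  have mq : measurable (quantile z @^-1` cyl p : set (measurableTypeR R)).
    by rewrite -[X in measurable X]setTI; exact: measurable_quantile2.
  rewrite U01// [RHS]U01//; congr (U _); apply/seteqP.
  by split => x [qx x01]; split => //; have := x01; rewrite /= in_itv/= => /quantP h;
    move: qx; rewrite /= ?in_itv/= => /h.
rewrite uniform01_itv; first by rewrite upE addrC addKr prbE.
- exact: prb_ge0.
- by rewrite upE lerDl prb_ge0.
- by apply: prb_le1; apply: measurableU.
Qed.

End codes_of_measures.

(** * Polish spaces as images of Baire space *)

Section polish_coding.
Context (R : realType) (X : ptopologicalType).

Let e (n : nat) : R := (2 ^+ n)^-1.

Let e_gt0 n : 0 < e n. Proof. by rewrite invr_gt0 exprn_gt0. Qed.

Let eS n : e n = 2 * e n.+1.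
Proof. by rewrite /e exprS invfM mulrA mulfV ?mul1r. Qed.

Let e_small r : 0 < r -> exists n, e n < r.
Proof.
move=> /exists_invS_lt[n nr]; exists n; apply: le_lt_trans nr.
rewrite /e lef_pV2 ?posrE ?exprn_gt0 ?ltr0n// -natrX ler_nat.
exact: ltn_expl.
Qed.

Lemma dense_sequence (D : set X) (d : X -> X -> R) : countable D -> dense D -> metrizes d ->
  exists q : nat -> X, forall x r, 0 < r -> exists n, d x (q n) < r.
Proof.
move=> cD dD dm; have /countable_injP[f finj] := cD.
have /choice[q qP] : forall n, exists x, (exists y, D y /\ f y = n) -> D x /\ f x = n.
  by move=> n; have [[y yn]|ny] := pselect (exists y, D y /\ f y = n); [exists y|exists point].
exists q => x r r0; have : nbhs x [set y | d x y < r] by apply/dm; exists r.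
rewrite nbhsE => -[V [oV Vx] Vr].
have [y [Vy Dy]] : V `&` D !=set0 by apply: dD => //; exists x.
exists (f y); have [Dq fq] := qP (f y) (ex_intro _ y (conj Dy erefl)).
by rewrite (_ : q (f y) = y); [exact: Vr|apply: finj; rewrite ?inE].
Qed.

(** A real lists indices into a dense sequence and is forced to be Cauchy by refusing large jumps;
    [phi] takes the limit. The section [g] lists at n the least index within 2^-n of x. *)
Lemma polish_coding : polish R X -> exists (phi : baire -> X) (g : borel X -> NN),
  [/\ continuous phi, measurable_fun setT g & forall x, phi (g x) = x].
Proof.
move=> [[D cD dD] [d [[d0 d1 dC dT] dm dc]]].
have ball_nbhs x r : 0 < r -> nbhs x [set y | d x y < r].
  by move=> r0; apply/dm; exists r.
have [q qP] : exists q : nat -> X, forall x r, 0 < r -> exists n, d x (q n) < r.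
  have /countable_injP[f finj] := cD.
  have /choice[q qP] : forall n, exists x, (exists y, D y /\ f y = n) -> D x /\ f x = n.
    by move=> n; have [[y yn]|ny] := pselect (exists y, D y /\ f y = n); [exists y|exists point].
  exists q => x r r0; have := ball_nbhs x r r0; rewrite nbhsE => -[V [oV Vx] Vr].
  have [y [Vy Dy]] : V `&` D !=set0 by apply: dD => //; exists x.
  exists (f y); have [Dq fq] := qP (f y) (ex_intro _ y (conj Dy erefl)).
  by rewrite (_ : q (f y) = y); [exact: Vr|apply: finj; rewrite ?inE].
(* Points within [e m] and [e m.+1] of x are less than [2 * e m] apart, so the codes produced by [g]
   are never corrected; the jumps from n on sum to at most [4 * e n]. *)
pose p (y : nat -> nat) := fix p n := if n is m.+1 then
  if d (q (p m)) (q (y m.+1)) < 2 * e m then y m.+1 else p m else y 0%N.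
have pS y n : d (q (p y n)) (q (p y n.+1)) < 2 * e n.
  rewrite /=; case: ifP => // _; rewrite (d1 _ _).2//; have := e_gt0 n; lra.
have pC y n k : d (q (p y n)) (q (p y (n + k)%N)) <= 4 * e n - 4 * e (n + k)%N.
  elim: k => [|k IHk]; first by rewrite addn0 (d1 _ _).2// subrr.
  apply: le_trans (dT _ (q (p y (n + k)%N)) _) _.
  by rewrite addnS; have := pS y (n + k)%N; have := eS (n + k)%N; lra.
have pC' y n m : (n <= m)%N -> d (q (p y n)) (q (p y m)) <= 4 * e n.
  move=> nm; have := pC y n (m - n)%N; rewrite subnKC//.
  by have := e_gt0 m; lra.
have /choice[phi phiP] : forall y : baire, exists x : X, (fun n => q (p y n)) @ \oo --> x.
  move=> y; apply: dc => r r0; have [|n nr] := @e_small (r / 8); first by lra.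
  exists n => i j ni nj; apply: le_lt_trans (dT _ (q (p y n)) _) _.
  by rewrite dC; have := pC' y n i ni; have := pC' y n j nj; lra.
have phi_le y n : d (q (p y n)) (phi y) <= 4 * e n.
  apply/ler_addgt0Pr => r r0.
  have [N _ NP] := phiP y _ (ball_nbhs (phi y) r r0).
  have := NP (maxn n N) (leq_maxr _ _); have := pC' y n (maxn n N) (leq_maxl _ _).
  rewrite /=; have := dT (q (p y n)) (q (p y (maxn n N))) (phi y).
  by rewrite (dC (q (p y (maxn n N))) (phi y)); lra.
have oB k n : open [set x : X | d x (q k) < e n].
  rewrite openE => x /= xk; apply/dm; exists (e n - d x (q k)); first by lra.
  by move=> y /= xy; apply: le_lt_trans (dT _ x _) _; rewrite (dC y x); lra.
exists phi, (fun x n => least [set k | d x (q k) < e n]); split.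
- move=> y U /dm[r r0 rU]; have [|n nr] := @e_small (r / 16); first by lra.
  have := nbhs_prefix y n.+1; apply: filterS => y' /cyl_mkseq y'y; apply: rU => /=.
  have pE : p y' n = p y n.
    elim: n y'y {nr} => [|n IHn] y'y /=; first by rewrite y'y.
    by rewrite IHn => [|i ni]; rewrite y'y// ltnW.
  apply: le_lt_trans (dT _ (q (p y n)) _) _.
  by have := phi_le y n; have := phi_le y' n; rewrite pE (dC (phi y)); lra.
- apply: measurable_NN => n; apply: (cmeas_least (S := fun k => [set x : borel X | d x (q k) < e n])) => k.
  by apply: open_measurable_borel; exact: oB.
- move=> x; set y : nat -> nat := fun n => _.
  have yP n : d x (q (y n)) < e n by have [] := leastP (qP x _ (e_gt0 n)).
  have py n : p y n = y n.
    elim: n => //= n ->; rewrite ifT//; apply: le_lt_trans (dT _ x _) _.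
    by rewrite (dC _ x); have := yP n; have := yP n.+1; have := eS n; have := e_gt0 n; lra.
  apply/d1/eqP; rewrite eq_le d0 andbT; apply/ler_addgt0Pr => r r0; rewrite add0r.
  have [|n nr] := @e_small (r / 8); first by lra.
  apply: le_trans (dT _ (q (y n)) _) _; have := phi_le y n.
  by rewrite py (dC _ (phi y)) (dC _ x); have := yP n; lra.
Qed.

End polish_coding.

(** * Completed measures and expected payoffs *)

Section completion.
Context (R : realType).

Lemma outer_prb_le_mu_ext d (T : measurableType d) (P : probability T R) S :
  ((outer_prb P S)%:E <= (P^*)%mu S)%E.
Proof.
apply: le_ereal_inf_tmp => _ [F [mF SF] <-].
have mUF : measurable (\bigcup_k F k) by exact: bigcup_measurable.
apply: (@le_trans _ _ (P (\bigcup_k F k))); first by rewrite prbE// lee_fin outer_prb_le.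
exact: measure_sigma_subadditive.
Qed.

Lemma sandwiched_measurable (d : measure_display) (T : measurableType d) (P : probability T R) S :
  measurable S -> sandwiched P S.
Proof. by move=> mS; exists S, S; split. Qed.

Lemma sandwiched_outer d (T : measurableType d) (P : probability T R) S B C :
  measurable B -> measurable C -> B `<=` S -> S `<=` C -> prb P B = prb P C ->
  outer_prb P S = prb P B.
Proof.
move=> mB mC BS SC BC; apply/eqP; rewrite eq_le {1}BC outer_prb_le//=.
by rewrite -outer_prb_measurable// outer_prb_mono.
Qed.

Context (T : ptopologicalType) (mu : Delta R T).
Implicit Types S : set (borel T).

Lemma measurable_completion S : sandwiched mu S ->
  measurable (S : set (caratheodory_type (outer mu))).
Proof.
move=> [B [C [mB mC BS SC BC]]].
rewrite -(setDUK BS).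
apply: (@measurableU _ (caratheodory_type (outer mu)) B (S `\` B)).
  exact: caratheodory_measurable_mu_ext.
apply: le_caratheodory_measurable => X.
rewrite [X in (X + _)%E](_ : _ = 0%E) ?add0e; first by apply: le_outer_measure; exact: subIsetl.
apply/eqP; rewrite eq_le; apply/andP; split; last exact: outer_measure_ge0.
have mCB : measurable (C `\` B) by exact: measurableD.
apply: (@le_trans _ _ (outer mu (C `\` B))).
  by apply: le_outer_measure => x [_ [Sx nBx]]; split => //; exact: SC.
rewrite [outer mu _](_ : _ = mu (C `\` B)); last exact: measurable_mu_extE.
rewrite prbE// prb_setD// ?BC ?subrr//.
exact: subset_trans SC.
Qed.

Lemma completionE S : sandwiched mu S -> completion mu S = (outer_prb mu S)%:E.
Proof.
move=> [B [C [mB mC BS SC BC]]]; apply/eqP; rewrite eq_le outer_prb_le_mu_ext andbT.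
rewrite (sandwiched_outer mB mC)// BC -prbE// -(measurable_mu_extE mu)//.
exact: le_mu_ext.
Qed.

Lemma completion_setT : completion mu setT = 1%E.
Proof.
rewrite completionE ?outer_prb_measurable// ?prbT//.
exact: sandwiched_measurable.
Qed.

(** This form trades Caratheodory measurability for a Borel subset of full measure, which also
    serves sets not known to be Borel. *)
Lemma has_measure_oneP S : has_measure_one mu S <->
  exists2 B, measurable B & B `<=` S /\ prb mu B = 1.
Proof.
split=> [[mS S1]|[B mB [BS B1]]]; last first.
  have sS : sandwiched mu S by exists B, setT; split; rewrite ?prbT.
  split; [exact: measurable_completion|rewrite completionE//].
  by rewrite (sandwiched_outer (C := setT) mB)// ?B1 ?prbT.
have CS0 : completion mu (~` S) = 0%E.
  have e1 : (completion mu setT = completion mu S + completion mu (~` S))%E.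
    by rewrite -[X in completion mu X](setUCr S); apply: measureU; rewrite ?setICr//; exact: measurableC.
  move: e1; rewrite completion_setT S1.
  by case: (completion mu (~` S)) => //= r; rewrite -EFinD => -[] r1; congr (_%:E); lra.
have [B [mB SB B0]] := outer_prb_hull mu (~` S).
exists (~` B); first exact: measurableC.
split; first by rewrite -[S]setCK; exact: subsetC.
rewrite prb_setC// B0; have := outer_prb_le_mu_ext mu (~` S).
rewrite [X in (_ <= X)%E](_ : _ = 0%E)// lee_fin => S0.
have := outer_prb_ge0 mu (~` S); lra.
Qed.

End completion.

(** * Integrals approximated by measures of superlevel sets *)

Section layers.
Context d (T : measurableType d) (R : realType).

Lemma measurable_fun_gt (f : T -> R) : (forall q, measurable [set x | q < f x]) ->
  measurable_fun setT f.
Proof.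
move=> mf; apply: (measurability _ (RGenOInfty.measurableE R)) => //.
move=> _ [_ [q ->] <-]; rewrite setTI (_ : _ @^-1` _ = [set x | q < f x])//.
by apply/seteqP; split => x /=; rewrite in_itv/= andbT.
Qed.

Lemma layer_sum (x : R) N : 0 <= x ->
  Num.min x N%:R <= \sum_(k < N) (k%:R < x)%R%:R <= x + 1.
Proof.
move=> x0; elim: N => [|N /andP[IH1 IH2]]; first by rewrite big_ord0 ge_min lexx orbT addr_ge0.
have SN : \sum_(k < N) (k%:R < x)%R%:R <= N%:R :> R.
  apply: (@le_trans _ _ (\sum_(k < N) 1)); last by rewrite sumr_const card_ord.
  by apply: ler_sum => i _; rewrite lern1 leq_b1.
rewrite big_ord_recr/= -natr1; case: (ltP N%:R x) => Nx/=.
  by apply/andP; split; [move: IH1; rewrite (min_r (ltW Nx)) => IH1; rewrite ge_min; apply/orP; right; lra|lra].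
by rewrite addr0 IH2 andbT ge_min; apply/orP; left; move: IH1; rewrite (min_l Nx).
Qed.

Variable mu : {measure set T -> \bar R}.
Hypothesis mu1 : mu setT = 1%E.

Lemma bounded_integrable (f : T -> R) M : measurable_fun setT f -> (forall x, `|f x| <= M) ->
  mu.-integrable setT (EFin \o f).
Proof.
move=> mf fM; apply: measurable_bounded_integrable => //; first by rewrite mu1 ltry.
by exists M; split; [exact: num_real|move=> r /ltW Mr x _ /=; exact: le_trans Mr].
Qed.

Lemma Rintegral_indic_sum (A : nat -> set T) N : (forall k, measurable (A k)) ->
  mu.-integrable setT (EFin \o (fun x => \sum_(k < N) \1_(A k) x : R)) /\
  \int[mu]_x (\sum_(k < N) \1_(A k) x) = \sum_(k < N) fine (mu (A k)).
Proof.
move=> mA; have iA k : mu.-integrable setT (EFin \o (\1_(A k) : T -> R)).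
  apply: (@bounded_integrable _ 1); first exact: measurable_indic.
  by move=> x; rewrite indicE ger0_norm// lern1 leq_b1.
elim: N => [|N [IH1 IH2]].
  rewrite (_ : (fun x => _) = cst 0); last by apply/funext => x; rewrite big_ord0.
  split; last by rewrite Rintegral_cst// mul0r big_ord0.
  by apply: (@bounded_integrable _ 0) => // x; rewrite normr0.
rewrite (_ : (fun x => _) = (fun x => \sum_(k < N) \1_(A k) x + \1_(A N) x)); last first.
  by apply/funext => x; rewrite big_ord_recr.
split; first by rewrite (_ : _ \o _ = (EFin \o (fun x => \sum_(k < N) \1_(A k) x)) \+ (EFin \o \1_(A N)))//;
  exact: integrableD.
rewrite RintegralD// IH2 big_ord_recr/=; congr (_ + _).
by rewrite /Rintegral integral_indic// setIT.
Qed.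

(** The range of f is cut into layers of height 2M / (N + 1). The integral is then known up to one
    layer from the measures of superlevel sets, which reduces its complexity or measurability to
    theirs. *)
Lemma Rintegral_layers (f : T -> R) (M : R) N (L : R) : 0 < M -> (forall x, `|f x| <= M) ->
  (forall q, measurable [set x | q < f x]) ->
  L = \sum_(k < N.+1) fine (mu [set x | k%:R * (2 * M / N.+1%:R) - M < f x]) ->
  2 * M / N.+1%:R * (L - 1) - M <= \int[mu]_x f x <= 2 * M / N.+1%:R * L - M.
Proof.
move=> M0 fM mf LN; set a := 2 * M / N.+1%:R.
have a0 : 0 < a by rewrite divr_gt0// mulr_gt0.
have aN : a * N.+1%:R = 2 * M by rewrite divfK// pnatr_eq0.
pose A k := [set x | k%:R * a - M < f x].
have [iS LE] := @Rintegral_indic_sum A N.+1 (fun k => mf _).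
have LE' : L = \int[mu]_x (\sum_(k < N.+1) \1_(A k) x) by rewrite LE LN.
have bnd x : f x <= a * (\sum_(k < N.+1) \1_(A k) x) - M <= f x + a.
  have /andP[fx1 fx2] : - M <= f x <= M by rewrite -ler_norml.
  have /(layer_sum N.+1) : 0 <= (f x + M) / a by apply: divr_ge0; [lra|exact: ltW].
  rewrite min_l; last by rewrite ler_pdivrMr// mulrC aN; lra.
  rewrite (_ : \sum_(k < N.+1) _ = \sum_(k < N.+1) \1_(A k) x); last first.
    apply: eq_bigr => k _; rewrite indicE; congr ((nat_of_bool _)%:R); apply/idP/idP.
      by rewrite ltr_pdivlMr// => h; rewrite inE /A/=; lra.
    by rewrite inE /A/= ltr_pdivlMr//; lra.
  rewrite ler_pdivrMr// => /andP[h1 h2]; rewrite [a * _]mulrC; apply/andP; split; first lra.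
  have := ler_wpM2r (ltW a0) h2; rewrite mulrDl divfK ?gt_eqF// mul1r; lra.
have mf' := measurable_fun_gt mf.
have intf := bounded_integrable mf' fM.
have iM : mu.-integrable setT (EFin \o cst M).
  by apply: (@bounded_integrable _ `|M|).
have ia : mu.-integrable setT (EFin \o cst a).
  by apply: (@bounded_integrable _ `|a|).
have iaS : mu.-integrable setT (EFin \o (fun x => a * (\sum_(k < N.+1) \1_(A k) x))).
  exact: (integrableZl measurableT a iS).
have iS' : mu.-integrable setT (EFin \o (fun x => a * (\sum_(k < N.+1) \1_(A k) x) - cst M x)).
  exact: (integrableB measurableT iaS iM).
have ifa : mu.-integrable setT (EFin \o (fun x => f x + cst a x)).
  exact: (integrableD measurableT intf ia).
have SE : \int[mu]_x (a * (\sum_(k < N.+1) \1_(A k) x) - cst M x) = a * L - M.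
  by rewrite RintegralB// RintegralZl// LE' Rintegral_cst// mu1 mulr1.
have fE : \int[mu]_x (f x + cst a x) = \int[mu]_x f x + a.
  by rewrite RintegralD// Rintegral_cst// mu1 mulr1.
have h1 : \int[mu]_x f x <= a * L - M.
  by rewrite -SE; apply: le_Rintegral => // x _; have /andP[] := bnd x.
have h2 : a * L - M <= \int[mu]_x f x + a.
  by rewrite -SE -fE; apply: le_Rintegral => // x _; have /andP[] := bnd x.
rewrite h1 andbT mulrBr mulr1; lra.
Qed.

End layers.

Section Sig_functions.
Context (R : realType).

(** Only strict lower bounds are in the class, so sums and positive multiples are allowed but
    negation is not; upper bounds require treating [- F] separately. *)
Definition lower_Sig n d (T : measurableType d) (F : T -> R) :=
  forall r, Sig n [set t | r < F t].

Context (n : nat) d (T : measurableType d).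
Implicit Types F G : T -> R.

Lemma lower_Sig_cst c : lower_Sig n (fun _ : T => c).
Proof.
by move=> r; apply: measurable_Sig; case: (ltP r c) => rc;
  [rewrite (_ : [set _ | _] = setT)|rewrite (_ : [set _ | _] = set0)];
  rewrite ?set_true ?set_false.
Qed.

Lemma lower_SigD F G : lower_Sig n F -> lower_Sig n G -> lower_Sig n (fun t => F t + G t).
Proof.
move=> hF hG r; rewrite (_ : [set t | _] = \bigcup_(q : rat)
  ([set t | ratr q < F t] `&` [set t | r - ratr q < G t])).
  apply: Sig_bigcup_countable => [|q]; first exact: measurable_Sig.
  by apply: Sig_setI; [exact: hF|exact: hG].
apply/seteqP; split => t /=; last by move=> [q _ []] /=; lra.
move=> rFG; have /rat_in_itvoo[q] : r - G t < F t by lra.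
by rewrite in_itv/= => /andP[q1 q2]; exists q => //; split => //=; lra.
Qed.

Lemma lower_SigZ c F : 0 < c -> lower_Sig n F -> lower_Sig n (fun t => c * F t).
Proof.
move=> c0 hF r; rewrite (_ : [set t | _] = [set t | r / c < F t]) => //.
by apply/seteqP; split => t /=; rewrite ltr_pdivrMr// mulrC.
Qed.

Lemma lower_Sig_sum (F : nat -> T -> R) N : (forall k, lower_Sig n (F k)) ->
  lower_Sig n (fun t => \sum_(k < N) F k t).
Proof.
move=> hF; elim: N => [|N IH] r.
  by under eq_set do rewrite big_ord0; exact: lower_Sig_cst.
by under eq_set do rewrite big_ord_recr; exact: lower_SigD.
Qed.

Lemma lower_Sig_approx (F : nat -> T -> R) G (e : nat -> R) : (forall k, lower_Sig n (F k)) ->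
  (forall k t, F k t <= G t <= F k t + e k) -> (forall r, 0 < r -> exists k, e k < r) ->
  lower_Sig n G.
Proof.
move=> hF FG e0 r; rewrite (_ : [set t | _] = \bigcup_k [set t | r < F k t]).
  by apply: Sig_bigcup => k; exact: hF.
apply/seteqP; split => t /=; last by move=> [k _ /= rF]; have /andP[h _] := FG k t; exact: lt_le_trans h.
move=> rG; have [|k ek] := e0 (G t - r); first by rewrite subr_gt0.
by exists k => //=; have /andP[_ h] := FG k t; lra.
Qed.

End Sig_functions.

Section Delta_lemmas.
Context (R : realType).

Lemma to_DeltaE (T : ptopologicalType) (P : probability (borel T) R) A :
  measurable A -> to_Delta P A = P A.
Proof. by move=> mA; rewrite /= /zero_off asboolT. Qed.

(** Both functions vanish off the Borel sets, so they agree on all sets; the remaining fields of the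
    structures are proofs. *)
Lemma Delta_eq (T : ptopologicalType) (mu nu : Delta R T) :
  (forall A, measurable A -> mu A = nu A) -> mu = nu.
Proof.
move=> h; have munu : (sval mu : set (borel T) -> \bar R) = sval nu.
  apply/funext => A; have [mA|nA] := pselect (measurable A); first exact: h.
  by rewrite (svalP mu A nA) (svalP nu A nA).
case: mu nu h munu => [P P0] [Q Q0] /= _ PQ.
suff PQ' : P = Q by rewrite -PQ' in Q0 *; congr (exist _ _ _); exact: Prop_irrelevance.
case: P Q PQ {P0 Q0} => [P p] [Q q] /= PQ.
rewrite -{}PQ in q *.
case: p q => [[p1 p2] [p3] [p4] [p5] [p6] [p7] [p8]] [[q1 q2] [q3] [q4] [q5] [q6] [q7] [q8]].
rewrite (Prop_irrelevance q1 p1) (Prop_irrelevance q2 p2) (Prop_irrelevance q3 p3).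
rewrite (Prop_irrelevance q4 p4) (Prop_irrelevance q5 p5) (Prop_irrelevance q6 p6).
by rewrite (Prop_irrelevance q7 p7) (Prop_irrelevance q8 p8).
Qed.

Lemma margE (T U : ptopologicalType) (f : {mfun borel T >-> borel U}) (mu : Delta R T) A :
  measurable A -> marg f mu A = mu (f @^-1` A).
Proof. by move=> mA; rewrite to_DeltaE. Qed.

Lemma prb_marg (T U : ptopologicalType) (f : {mfun borel T >-> borel U}) (mu : Delta R T) A :
  measurable A -> prb (marg f mu) A = prb mu (f @^-1` A).
Proof. by move=> mA; rewrite /prb margE. Qed.

End Delta_lemmas.

Section coded_measures.
Context (R : realType) (X : ptopologicalType) (phi : baire -> X) (g : borel X -> NN).
Hypothesis cphi : continuous phi.
Hypothesis mg : measurable_fun setT g.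
Hypothesis phig : forall x, phi (g x) = x.

Definition coded_Delta (z : NN) : Delta R X :=
  marg (mfun_of_continuous cphi : {mfun NN >-> borel X}) (to_Delta (coded_prob R z)).

Lemma prb_coded_Delta z A : measurable A ->
  prb (coded_Delta z) A = prb (coded_prob R z) (phi @^-1` A).
Proof.
move=> mA; rewrite prb_marg// /prb to_DeltaE//.
by rewrite -[X in measurable X]setTI; exact: continuous_borel.
Qed.

Lemma coded_Delta_surj (mu : Delta R X) : exists z, coded_Delta z = mu.
Proof.
have [z zP] := coded_prob_surj (push mu mg); exists z; apply: Delta_eq => A mA.
have mA' : measurable (phi @^-1` A : set NN).
  by rewrite -[X in measurable X]setTI; exact: continuous_borel.
rewrite margE// [LHS]to_DeltaE// zP// pushE; congr (mu _).
by apply/seteqP; split => x /=; rewrite phig.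
Qed.

Variable m : nat.
Hypothesis det : Pi1_determinacy m.+1.

(** Push [P] forward along the section [g] and pull the Borel bounds back; since [g] is a section,
    the preimage of [S] under [phi] returns to [S]. *)
Lemma decoded_sandwiched k (P : probability (borel X) R) (S : set X) : (k <= m.+1)%N ->
  Sig k.+1 (phi @^-1` S : set NN) -> sandwiched P S.
Proof.
move=> km SS; have [B [C [mB mC BS SC BC]]] := Sig_sandwiched det (push P mg) km SS.
exists (g @^-1` B), (g @^-1` C); split.
- by rewrite -[X in measurable X]setTI; exact: mg.
- by rewrite -[X in measurable X]setTI; exact: mg.
- by move=> x /BS /=; rewrite phig.
- by move=> x Sx; apply: SC; rewrite /= phig.
- by rewrite -!(prb_push _ mg).
Qed.

Lemma outer_coded_Delta k z (S : set X) : (k <= m.+1)%N ->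
  Sig k.+1 (phi @^-1` S : set NN) ->
  outer_prb (coded_Delta z) S = outer_prb (coded_prob R z) (phi @^-1` S).
Proof.
move=> km SS; have [B [C [mB mC BS SC BC]]] := decoded_sandwiched (coded_Delta z) km SS.
have mphi (A : set (borel X)) : measurable A -> measurable (phi @^-1` A : set NN).
  by move=> mA; rewrite -[X in measurable X]setTI; exact: continuous_borel.
rewrite (sandwiched_outer mB mC BS SC BC).
rewrite (sandwiched_outer (mphi _ mB) (mphi _ mC)) -?prb_coded_Delta//.
- exact: preimage_subset.
- exact: preimage_subset.
Qed.

Lemma completed_integral_layers (mu : Delta R X) (f : X -> R) (M : R) N : 0 < M ->
  (forall x, `|f x| <= M) -> (forall q, sandwiched mu [set x | q < f x]) ->
  let L := \sum_(k < N.+1) outer_prb mu [set x | k%:R * (2 * M / N.+1%:R) - M < f x] in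
  is_true (2 * M / N.+1%:R * (L - 1) - M <= completed_integral mu f <= 2 * M / N.+1%:R * L - M).
Proof.
move=> M0 fM sf L; apply: Rintegral_layers => //; first exact: completion_setT.
  by move=> q; exact: measurable_completion.
by apply: eq_bigr => k _; rewrite (completionE (sf _)).
Qed.

Lemma completed_integralN (mu : Delta R X) (f : X -> R) (M : R) :
  (forall x, `|f x| <= M) -> (forall q, sandwiched mu [set x | q < f x]) ->
  completed_integral mu (fun x => - f x) = - completed_integral mu f.
Proof.
move=> fM sf; rewrite -mulN1r -RintegralZl//; first by apply: eq_Rintegral => x _; rewrite mulN1r.
apply: (@bounded_integrable _ (caratheodory_type (outer mu)) R (completion mu) _ f M) => //;
  first exact: completion_setT.
by apply: measurable_fun_gt => q; exact: measurable_completion.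
Qed.

Lemma lower_Sig_integral k d (T : measurableType d) (nu : T -> NN) (f : T -> X -> R) (M : R) :
  (k.+1 <= m.+1)%N -> measurable_fun setT nu -> (forall t x, `|f t x| <= M) ->
  (forall q, Sig k.+2 [set tb : T * NN | q < f tb.1 (phi tb.2)]) ->
  lower_Sig k.+2 (fun t => completed_integral (coded_Delta (nu t)) (f t)).
Proof.
move=> km mnu fM Sf; pose M' := `|M| + 1.
have M0 : 0 < M' by apply: ltr_wpDl.
have fM' t x : `|f t x| <= M' by apply: le_trans (fM t x) _; rewrite /M'; have := ler_norm M; lra.
have Sft t q : Sig k.+2 (phi @^-1` [set x | q < f t x] : set NN).
  apply: (@Sig_preimage _ _ _ NN (T * NN)%type (fun b => (t, b)) _ _ (Sf q)).
  by apply: measurable_fun_pair => //; exact: measurable_cst.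
pose a N := 2 * M' / N.+1%:R.
have a0 N : 0 < a N by rewrite divr_gt0// mulr_gt0.
(* Subtracting the layer height [a N] turns the layer sum into a lower bound, with error at most
   [a N]. *)
apply: (lower_Sig_approx (e := a) (F := fun N t => a N * (\sum_(i < N.+1)
    outer_prb (coded_prob R (nu t)) [set b | i%:R * a N - M' < f t (phi b)]) + (- a N - M'))).
- move=> N; apply: lower_SigD; last exact: lower_Sig_cst.
  apply: lower_SigZ => //; apply: (lower_Sig_sum (F := fun i t => outer_prb (coded_prob R (nu t))
    [set b | i%:R * a N - M' < f t (phi b)])) => i r.
  (* [Sig_outer_gt] is for nonnegative thresholds; below 0 the condition always holds. *)
  have [r0|r0] := leP 0 r.
    apply: (Sig_outer_gt det (nu := fun t => coded_prob R (nu t))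
      (A := [set tb | i%:R * a N - M' < f tb.1 (phi tb.2)])) => // B mB.
    exact: measurableT_comp (measurable_coded_prob mB) mnu.
  rewrite (_ : [set t | _] = setT); first exact: measurable_Sig.
  by apply/seteqP; split => // t _ /=; apply: lt_le_trans (outer_prb_ge0 _ _).
- have lin (u v w x : R) : u - v - w <= x -> x <= u - w -> u + (- v - w) <= x <= u + (- v - w) + v.
    by move=> h1 h2; apply/andP; split; lra.
  move=> N t; have := completed_integral_layers (mu := coded_Delta (nu t)) N M0 (fM' t)
    (fun q => decoded_sandwiched (coded_Delta (nu t)) km (Sft t q)).
  under eq_bigr => i _ do rewrite (outer_coded_Delta _ km (Sft t _)).
  set I := completed_integral _ _; set S := (X in _ -> is_true (a N * X + _ <= _ <= _)).
  rewrite -/(a N) => /andP[h1 h2]; have {}h1 : a N * (S - 1) - M' <= I := h1.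
  have {}h2 : I <= a N * S - M' := h2.
  by rewrite mulrBr mulr1 in h1; exact: lin.
- move=> r r0; have [|N Nr] := @exists_invS_lt R (r / (2 * M')); first by rewrite divr_gt0// mulr_gt0.
  by exists N; move: Nr; rewrite ltr_pdivlMr ?mulr_gt0// /a mulrC.
Qed.

End coded_measures.

(** * The largest best-response family *)

Section coded_players.

(* A real codes a strategy of the player named by its first entry. *)
Definition side (x : NN) : player := if x 0%N == 0%N then One else Two.

Definition strip (x : NN) : NN := fun n => x n.+1.

Definition mark (i : player) (a : NN) : NN :=
  fun n => if n is k.+1 then a k else if i is One then 0%N else 1%N.

Lemma side_mark i a : side (mark i a) = i. Proof. by case: i. Qed.

Lemma strip_mark i a : strip (mark i a) = a. Proof. by []. Qed.

Lemma measurable_strip : measurable_fun setT strip.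
Proof. by apply: measurable_NN => n; exact: (@cmeas_eval _ NN id _ (@measurable_id _ NN setT)). Qed.

Lemma measurable_mark i : measurable_fun setT (mark i).
Proof. by apply: measurable_NN => -[|n]; [exact: cmeas_cst|exact: (@cmeas_eval _ NN id _ (@measurable_id _ NN setT))]. Qed.

Lemma measurable_side i : measurable [set x | side x = i].
Proof.
exact: (cmeas_pred (fun k => (if k == 0%N then One else Two) = i) (@cmeas_eval _ NN id 0 (@measurable_id _ NN setT))).
Qed.

End coded_players.

Section coded_game.
Context (R : realType) (G : game R).
Context (phi : forall i, baire -> strat G i) (g : forall i, borel (strat G i) -> NN).
Hypothesis cphi : forall i, continuous (phi i).
Hypothesis mg : forall i, measurable_fun setT (@g i).
Hypothesis phig : forall i x, phi i (g x) = x.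
Variables (m j : nat).
Hypothesis det : Pi1_determinacy m.+1.
Hypothesis jm : (j.+1.*2 <= m)%N.
Let n := j.*2.

Let code_Delta i z : Delta R (strat G i) := coded_Delta R (@cphi i) z.

Hypothesis pay_Sig : forall i q,
  Sig n.+2 [set z : NN * NN | q < payoff (phi i z.1) (phi (opponent i) z.2)].
Hypothesis pay_Pi : forall i q,
  Pi n.+2 [set z : NN * NN | q < payoff (phi i z.1) (phi (opponent i) z.2)].

Let nm : (n.+1 <= m.+1)%N. Proof. by move: jm; rewrite doubleS; lia. Qed.

Lemma payoff_bounded i : exists M : R, forall (s : strat G i) y, `|payoff s y| <= M.
Proof. by case: i; [have [M MP] := pay_bounded G One|have [M MP] := pay_bounded G Two];
  exists M => s y; exact: MP. Qed.

Lemma slice_payoff_sandwiched i s (mu : Delta R (strat G (opponent i))) q :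
  sandwiched mu [set y | q < payoff (i := i) s y].
Proof.
rewrite -(phig s); have h := @decoded_sandwiched R _ _ _ (@mg (opponent i)) (@phig (opponent i)) m det n.+1 mu _ nm. refine (h _ _).
apply: (@Sig_preimage _ _ _ NN (NN * NN)%type (fun b => (g s, b)) _ _ (pay_Sig i q)).
by apply: measurable_fun_pair => //; exact: measurable_cst.
Qed.

Definition coded_br i : set (NN * NN) :=
  [set p | best_response (i := i) (phi i p.1, code_Delta (opponent i) p.2)].

(** A failure is a better strategy together with a rational separating the two expected payoffs. It
    bounds one integral from below and the other from above, hence the appeal to both [pay_Sig] and
    [pay_Pi]. *)
Lemma Pi_coded_br i : Pi n.+2 (coded_br i).
Proof.
pose U (p : NN * NN) : R := expected (i := i) (phi i p.1) (code_Delta (opponent i) p.2).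
have [M MP] := payoff_bounded i.
have lU : lower_Sig n.+2 U.
  refine (@lower_Sig_integral R _ _ _ (@cphi (opponent i)) (@mg (opponent i)) (@phig (opponent i))
    m det n _ (NN * NN)%type snd (fun p => payoff (i := i) (phi i p.1)) M nm measurable_snd _ _) => // q.
  apply: (@Sig_preimage _ _ _ ((NN * NN) * NN)%type (NN * NN)%type
    (fun pb : (NN * NN) * NN => (pb.1.1, pb.2)) _ _ (pay_Sig i q)).
  by mtac.
have lUN : lower_Sig n.+2 (fun p => - U p).
  rewrite (_ : (fun p => - U p) = fun p => completed_integral (code_Delta (opponent i) p.2)
      (fun y => - payoff (i := i) (phi i p.1) y)); last first.
    apply/funext => p; symmetry; apply: completed_integralN (MP _) _ => q.
    exact: slice_payoff_sandwiched.
  refine (@lower_Sig_integral R _ _ _ (@cphi (opponent i)) (@mg (opponent i)) (@phig (opponent i))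
    m det n _ (NN * NN)%type snd (fun p y => - payoff (i := i) (phi i p.1) y) M nm measurable_snd _ _).
    by move=> t x; rewrite normrN.
  move=> q.
  (* A strict upper bound on the payoff is a countable union of denied strict lower bounds, so the
     Pi hypothesis makes it Sigma. *)
  rewrite (_ : [set _ | _] = \bigcup_k ((fun pb : (NN * NN) * NN => (pb.1.1, pb.2)) @^-1`
      ~` [set z : NN * NN | - q - k.+1%:R^-1 < payoff (i := i) (phi i z.1) (phi (opponent i) z.2)])).
    apply: Sig_bigcup => k; apply: (@Sig_preimage _ _ _ _ (NN * NN)%type); last exact: pay_Pi.
    by mtac.
  apply/seteqP; split => pb /=; last first.
    move=> [k _] /=; have : (0 : R) < k.+1%:R^-1 by rewrite invr_gt0.
    by move: k.+1%:R^-1 => e e0 /negP; rewrite -leNgt; lra.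
  move=> qp; have [|k kq] := @exists_invS_lt R (- q - payoff (i := i) (phi i pb.1.1) (phi (opponent i) pb.2)).
    lra.
  by exists k => //=; apply/negP; rewrite -leNgt; move: k.+1%:R^-1 kq => e; lra.
rewrite /Pi /= (_ : ~` _ = [set p | exists a : NN, (\bigcup_(q : rat)
  ([set pa : (NN * NN) * NN | ratr q < U (pa.2, pa.1.2)] `&` [set pa | - ratr q < - U pa.1])) (p, a)]).
  apply: Sig_proj; apply: Sig_bigcup_countable => [|q]; first exact: measurable_Sig.
  apply: Sig_setI.
    apply: (@Sig_preimage _ _ _ ((NN * NN) * NN)%type (NN * NN)%type
      (fun pa : (NN * NN) * NN => (pa.2, pa.1.2)) _ _ (lU (ratr q))).
    by mtac.
  exact: (@Sig_preimage _ _ _ ((NN * NN) * NN)%type (NN * NN)%type fst _ measurable_fst (lUN (- ratr q))).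
apply/seteqP; split => p.
  move=> /existsNP[s' /negP]; rewrite -ltNge -(phig s') => Us'.
  have [q] := rat_in_itvoo Us'; rewrite in_itv/= => /andP[q1 q2].
  by exists (g s'), q => //; split => //=; rewrite ltrN2.
move=> [a [q _ [/= q1 q2]]] /(_ (phi i a)); apply/negP; rewrite -ltNge.
by apply: lt_trans q1; rewrite -ltrN2.
Qed.

(** Outer measure one, phrased by Borel supersets so that it makes sense for families not known to
    be measurable. *)
Definition weak_support i (mu : Delta R (strat G i)) (S : set (strat G i)) :=
  forall B : set (borel (strat G i)), measurable B -> S `<=` B -> prb mu B = 1.

Lemma Sig_outer1 k d (T : measurableType d) (nu : T -> NN) (A : set (T * NN)) :
  (k.+1 <= m.+1)%N -> measurable_fun setT nu -> Sig k.+2 A ->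
  Sig k.+2 [set t | outer_prb (coded_prob R (nu t)) [set b | A (t, b)] = 1].
Proof.
move=> km mnu SA; rewrite (_ : [set t | _] = \bigcap_l
    [set t | 1 - l.+2%:R^-1 < outer_prb (coded_prob R (nu t)) [set b | A (t, b)]]).
  apply: Sig_bigcap => l; apply: (Sig_outer_gt det (nu := fun t => coded_prob R (nu t))) => //.
    by rewrite subr_ge0 invf_le1// ler1n.
  move=> B mB; exact: measurableT_comp (measurable_coded_prob mB) mnu.
apply/seteqP; split => t /=; first by move=> o1 l _ /=; rewrite o1 ltrBlDr ltrDl invr_gt0.
move=> h; apply/eqP; rewrite eq_le; apply/andP; split.
  by apply: le_trans (outer_prb_le _ measurableT (@subsetT _ _)) _; rewrite prbT.
rewrite leNgt; apply/negP => lt1.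
have [|l lP] := @exists_invS_lt R (1 - outer_prb (coded_prob R (nu t)) [set b | A (t, b)]).
  by rewrite subr_gt0.
have /= := h l I; have : (l.+2%:R : R)^-1 <= l.+1%:R^-1 by rewrite lef_pV2 ?posrE// ler_nat.
by move: (l.+2%:R^-1) (l.+1%:R^-1) lP => u v; lra.
Qed.

Let nm' : (n.+2 <= m.+1)%N. Proof. by move: jm; rewrite doubleS; lia. Qed.

Lemma coded_measure_one i z (S : set (strat G i)) : Sig n.+3 (phi i @^-1` S : set NN) ->
  has_measure_one (code_Delta i z) S <-> outer_prb (coded_prob R z) (phi i @^-1` S) = 1.
Proof.
move=> SS; have oE := @outer_coded_Delta R _ _ _ (@cphi i) (@mg i) (@phig i) m det n.+2 z S nm' SS.
have [B [C [mB mC BS SC BC]]] := @decoded_sandwiched R _ _ _ (@mg i) (@phig i)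
  m det n.+2 (code_Delta i z) S nm' SS.
rewrite -oE (sandwiched_outer mB mC BS SC BC); split.
  move=> /has_measure_oneP[A mA [AS A1]]; apply/eqP; rewrite eq_le prb_le1//= BC -A1.
  by apply: prb_le => //; exact: subset_trans SC.
by move=> B1; apply/has_measure_oneP; exists B.
Qed.

(** Norm induction, applied to the elimination operator, gives the set V of eliminated codes; Y
    consists of the strategies with a code outside V. *)
Lemma largest_br_family : exists Y : forall i, set (strat G i),
  [/\ forall i, Sig n.+3 (phi i @^-1` Y i : set NN),
      forall i s, Y i s -> exists mu : Delta R (strat G (opponent i)),
        best_response (s, mu) /\ has_measure_one mu (Y (opponent i)) &
      forall Y' : (forall i, set (strat G i)),
        (forall i s, Y' i s -> exists mu : Delta R (strat G (opponent i)),
          best_response (s, mu) /\ weak_support mu (Y' (opponent i))) ->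
        forall i, Y' i `<=` Y i].
Proof.
(* [Z] stands for the codes eliminated so far: x is good when it is a best response to a measure
   whose outer measure of the rest is one. *)
pose good (Z : set NN) (x : NN) := exists z : NN, coded_br (side x) (strip x, z) /\
  outer_prb (coded_prob R z) [set b | ~ Z (mark (opponent (side x)) b)] = 1.
have [|V [lt [PV Plt VP ltV wf]]] := @norm_induction n.+2 (fun Z x => ~ good Z x)
    (norm_property_Pi_odd det jm).
  move=> Z PZ.
  rewrite /Pi /= (_ : ~` _ = (([set p : NN * NN | side p.2 = One] `&` [set p : NN * NN | exists z : NN,
      coded_br One (strip p.2, z) /\ outer_prb (coded_prob R z) [set b | ~ Z (p, mark Two b)] = 1]) `|`
      ([set p : NN * NN | side p.2 = Two] `&` [set p : NN * NN | exists z : NN,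
      coded_br Two (strip p.2, z) /\ outer_prb (coded_prob R z) [set b | ~ Z (p, mark One b)] = 1]))).
    have Sside i : Sig n.+3 [set p : NN * NN | side p.2 = i].
      apply: measurable_Sig; rewrite -[X in measurable X]setTI.
      exact: (@measurable_snd _ _ NN NN measurableT _ (measurable_side i)).
    have Sgood i i' : Sig n.+3 [set p : NN * NN | exists z : NN, coded_br i (strip p.2, z) /\
        outer_prb (coded_prob R z) [set b | ~ Z (p, mark i' b)] = 1].
      apply: (@Sig_proj _ _ _ [set pz : (NN * NN) * NN | coded_br i (strip pz.1.2, pz.2) /\
        outer_prb (coded_prob R pz.2) [set b | ~ Z (pz.1, mark i' b)] = 1]).
      apply: Sig_setI.
        apply: Pi_sub_Sig; apply: (@Pi_preimage _ _ _ ((NN * NN) * NN)%type (NN * NN)%type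
          (fun pz => (strip pz.1.2, pz.2)) _ _ (Pi_coded_br i)).
        apply: measurable_fun_pair; last exact: measurable_snd.
        by apply: (measurableT_comp measurable_strip); mtac.
      apply: (@Sig_outer1 n.+1 _ _ snd [set pb : ((NN * NN) * NN) * NN | ~ Z (pb.1.1, mark i' pb.2)]
        nm' measurable_snd).
      apply: (@Sig_preimage _ _ _ (((NN * NN) * NN) * NN)%type ((NN * NN) * NN)%type
        (fun pb => (pb.1.1, mark i' pb.2)) _ _ PZ).
      apply: measurable_fun_pair; first by mtac.
      exact: measurableT_comp (measurable_mark i') measurable_snd.
    by apply: Sig_setU; apply: Sig_setI.
  apply/seteqP; split => p.
    by move=> /contrapT; rewrite /good /=; case: (side p.2) => h; [left|right].
  by move=> pP; apply; move: pP; rewrite /good /= => -[] [-> ].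
have lt_sub x : [set y | lt y x] `<=` V by move=> y; exact: (ltV x y).1.
have good_mono Z Z' x : Z `<=` Z' -> good Z' x -> good Z x.
  move=> ZZ' [z [bz oz]]; exists z; split => //; apply/eqP; rewrite eq_le.
  rewrite (le_trans (outer_prb_le _ measurableT (@subsetT _ _))) ?prbT//= -oz outer_prb_mono//.
  by move=> b nZ' /ZZ'.
(* For x outside V, the part of V below x is all of V, so the recursion becomes the fixed point
   equation. *)
have nVP x : ~ V x <-> good V x.
  split=> [nVx|gx Vx].
    have ltVE : [set y | lt y x] = V.
      by apply/seteqP; split; [exact: lt_sub|move=> y Vy; exact: (ltV x y).2].
    by apply: contrapT; rewrite -{1}ltVE => /VP.
  by have /VP := Vx; apply; apply: good_mono gx; exact: lt_sub.
pose Y i : set (strat G i) := [set s | exists2 a, phi i a = s & ~ V (mark i a)].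
have goodE Z i a : good Z (mark i a) <-> exists z : NN, coded_br i (a, z) /\
    outer_prb (coded_prob R z) [set b | ~ Z (mark (opponent i) b)] = 1.
  by rewrite /good side_mark.
have YP i a : Y i (phi i a) <-> ~ V (mark i a).
  split=> [[b ba]|nV]; last by exists a.
  by rewrite !nVP !goodE => -[z [bz oz]]; exists z; split => //; rewrite /coded_br /= -ba.
have YE i : phi i @^-1` Y i = ~` [set a | V (mark i a)].
  by apply/seteqP; split => a /YP.
have SY i : Sig n.+3 (phi i @^-1` Y i : set NN).
  rewrite YE; exact: (Sig_preimage (measurable_mark i) PV).
exists Y; split => //.
- move=> i s [a <-]; rewrite nVP goodE => -[z [bz oz]]; exists (code_Delta (opponent i) z); split => //.
  by apply/(coded_measure_one _ (SY _)); rewrite YE.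
- move=> Y' Y'P i s Y's; rewrite -(phig s); apply/YP => Vs.
  (* An eliminated code of a member of Y' leads to one of smaller norm: otherwise the reals not
     below x would contain the codes of all of Y' on the other side and have outer measure one,
     which contradicts the elimination of x. *)
  have step (x : NN) : V x /\ Y' (side x) (phi _ (strip x)) ->
      exists y : NN, (V y /\ Y' (side y) (phi _ (strip y))) /\ lt y x.
    move=> [Vx Y'x]; have [mu [br ws]] := Y'P _ _ Y'x.
    set j' := opponent (side x) in mu br ws *.
    have [z zP] := coded_prob_surj (push mu (@mg j')).
    have zmu : code_Delta j' z = mu.
      apply: Delta_eq => A mA; have mA' : measurable (phi j' @^-1` A : set NN).
        by rewrite -[X in measurable X]setTI; exact: continuous_borel.
      rewrite margE// [LHS]to_DeltaE// zP// pushE; congr (Delta_prob mu _).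
      by apply/seteqP; split => y /=; rewrite phig.
    apply: contrapT => noy; have /VP := Vx; apply; exists z; split.
      by rewrite /coded_br /= -/j' zmu.
    have [C [mC SC C1]] := outer_prb_hull (coded_prob R z) [set b | ~ lt (mark j' b) x].
    rewrite /= -/j' -C1 /prb zP// pushE; apply: (ws (@g j' @^-1` C)).
      by rewrite -[X in measurable X]setTI; exact: mg.
    move=> y Y'y; apply: SC => /= lty; apply: noy; exists (mark j' (g y)); split => //.
    by split; [exact: (ltV _ _).1 lty|rewrite side_mark strip_mark phig].
  pose T := {x : NN | V x /\ Y' (side x) (phi _ (strip x))}.
  have /choice[f fP] : forall x : T, exists y : T, lt (sval y) (sval x).
    by move=> [x xP]; have [y [yP yx]] := step x xP; exists (exist _ y yP).
  have x0P : V (mark i (g s)) /\ Y' (side (mark i (g s))) (phi _ (strip (mark i (g s)))).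
    by rewrite side_mark strip_mark phig.
  apply: (wf (fun k => sval (iter k f (exist _ _ x0P : T)))) => k; last exact: fP.
  exact: (svalP (iter k f _)).1.
Qed.

(** The relation between a strategy and the code of a supporting measure is Sigma; adjoining its
    witness leaves a Pi relation, to which almost everywhere uniformization applies. *)
Lemma br_selection (Y : forall i, set (strat G i)) :
  (forall i, Sig n.+3 (phi i @^-1` Y i : set NN)) ->
  (forall i s, Y i s -> exists mu : Delta R (strat G (opponent i)),
     best_response (s, mu) /\ has_measure_one mu (Y (opponent i))) ->
  forall i (mu : Delta R (strat G i)), has_measure_one mu (Y i) ->
  exists (D : set (borel (strat G i))) (f : strat G i -> Delta R (strat G (opponent i))),
  [/\ measurable D, prb mu D = 1,
      forall s, D s -> best_response (s, f s) /\ has_measure_one (f s) (Y (opponent i)) &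
      forall B : set (borel (strat G (opponent i))), measurable B ->
        measurable_fun setT (fun s : borel (strat G i) => prb (f s) B)].
Proof.
move=> SY Ybr i mu /has_measure_oneP[B mB [BY B1]].
pose Q : set (NN * NN) := [set p | coded_br i p /\
  outer_prb (coded_prob R p.2) (phi (opponent i) @^-1` Y (opponent i)) = 1].
have SQ : Sig n.+3 Q.
  apply: Sig_setI; first exact/Pi_sub_Sig/Pi_coded_br.
  apply: (@Sig_outer1 n.+1 _ _ snd [set pb : (NN * NN) * NN | Y (opponent i) (phi _ pb.2)] nm' measurable_snd).
  exact: (@Sig_preimage _ _ _ ((NN * NN) * NN)%type NN snd _ measurable_snd (SY (opponent i))).
have [C PC QC] := Sig_inv SQ.
(* One real carries both the code of the measure and the witness of the Sigma condition. *)
pose C' : set (NN * NN) := [set p | C ((p.1, slice 0 p.2 : NN), slice 1 p.2 : NN)].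
have PC' : Pi n.+2 C'.
  apply: (@Pi_preimage _ _ _ (NN * NN)%type ((NN * NN) * NN)%type
    (fun p => ((p.1, slice 0 p.2 : NN), slice 1 p.2 : NN)) _ _ PC).
  by mtac.
have [D0 [h [mD0 mh D0h D0P]]] := uniformization det (push mu (@mg i)) nm' PC'.
have mz : measurable_fun setT (fun s : borel (strat G i) => slice 0 (h (g s)) : NN).
  exact: (measurableT_comp (measurable_sliceT 0) (measurableT_comp mh (@mg i))).
exists (@g i @^-1` D0), (fun s => code_Delta (opponent i) (slice 0 (h (g s)))); split.
- by rewrite -[X in measurable X]setTI; exact: mg.
- rewrite -(prb_push mu (@mg i)) D0P; apply/eqP; rewrite eq_le; apply/andP; split.
    by apply: le_trans (outer_prb_le _ measurableT (@subsetT _ _)) _; rewrite prbT.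
  have [A [mA CA <-]] := outer_prb_hull (push mu (@mg i)) [set a | exists w, C' (a, w)].
  rewrite prb_push -B1; apply: prb_le => //.
    by rewrite -[X in measurable X]setTI; exact: mg.
  move=> s /BY Ys; apply: CA => /=; have [nu [br nu1]] := Ybr i s Ys.
  have [z zE] := coded_Delta_surj (@cphi (opponent i)) (@mg (opponent i)) (@phig (opponent i)) nu.
  have : Q (g s, z).
    split; first by rewrite /coded_br /= phig /code_Delta zE.
    by apply/(coded_measure_one z (SY (opponent i))); rewrite /code_Delta zE.
  by rewrite QC => -[y Cy]; exists (join2 z y); rewrite /C' /= !slice_join.
- move=> s /D0h Cs; have : Q (g s, slice 0 (h (g s)) : NN) by rewrite QC; exists (slice 1 (h (g s))).
  by rewrite /Q /= /coded_br /= phig => -[br /(coded_measure_one _ (SY (opponent i)))].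
- move=> A mA; rewrite (_ : (fun s => _) =
    (fun z => prb (coded_prob R z) (phi (opponent i) @^-1` A)) \o (fun s => slice 0 (h (g s)))).
    apply: measurableT_comp mz; apply: measurable_coded_prob.
    by rewrite -[X in measurable X]setTI; exact: (continuous_borel (@cphi (opponent i))).
  by apply/funext => s /=; rewrite prb_coded_Delta.
Qed.

End coded_game.

(** * Transfinite elimination *)

Section well_orders.
Context (W : Type) (le : rel W) (wo : wochoice.well_order le).

Lemma well_order_min (S : set W) : S !=set0 -> exists2 a, S a & forall b, S b -> le a b.
Proof.
move=> [x Sx]; have [|a [[Sa amin] _]] := wo (A := [pred x | `[< S x >]]).
  by exists x; apply/asboolP.
exists a; first by exact/asboolP.
by move=> b Sb; apply: amin; apply/asboolP.
Qed.

Lemma well_order_refl a : le a a.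
Proof. by have [|b -> ba] := well_order_min (S := [set a]); [exists a|exact: ba]. Qed.

Lemma well_order_anti a b : le a b -> le b a -> a = b.
Proof.
move=> ab ba; have [|c [_ cu]] := wo (A := [pred x | `[< x = a \/ x = b >]]).
  by exists a; apply/asboolP; left.
have P x y : x = a \/ x = b -> y = a \/ y = b -> le x y.
  by move=> [->|->] [->|->] //; exact: well_order_refl.
have m x : x = a \/ x = b -> wochoice.minimum_of le [pred x | `[< x = a \/ x = b >]] x.
  by move=> xab; split; [exact/asboolP|move=> y /asboolP; exact: P].
by rewrite -(cu a) ?(cu b)//; apply: m; [right|left].
Qed.

Lemma well_order_total a b : le a b \/ le b a.
Proof.
have [|c [] -> h] := well_order_min (S := [set x | x = a \/ x = b]); first by exists a; left.
  by left; apply: h; right.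
by right; apply: h; left.
Qed.

Lemma well_order_precedes a b : ~ le a b <-> precedes le b a.
Proof.
split=> [nab|[ba ab] ab']; last by apply: ab; exact: well_order_anti.
split; first by have [] := well_order_total a b.
by move=> ba; apply: nab; rewrite ba; exact: well_order_refl.
Qed.

Lemma precedes_wf : well_founded (precedes le).
Proof.
move=> a; apply: contrapT => na.
have [|b nb bmin] := well_order_min (S := [set b | ~ Acc (precedes le) b]); first by exists a.
apply: nb; constructor => c cb; apply: contrapT => nc.
exact: (well_order_precedes b c).2 cb (bmin c nc).
Qed.

End well_orders.

(** Cantor's theorem: [W] is the power set of [F], so no map from it into [F] is injective. *)
Lemma well_order_large (F : Type) : exists (W : eqType) (le : rel W),
  wochoice.well_order le /\ forall f : W -> F, exists x y, [/\ x <> y & f x = f y].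
Proof.
pose W := set F : Type.
have [le wo] := wochoice.well_ordering_principle {classic W}.
exists {classic W}, le; split => // f; apply: contrapT => nf.
pose D : {classic W} := [set y : F | exists2 x : W, f x = y & ~ x y].
have [DD|nD] := pselect ((D : set F) (f D)); last by apply: (nD); exists D.
have [x xD nx] := DD; have [xDE|xD'] := pselect (x = D); first by apply: nx; rewrite {1}xDE.
by apply: nf; exists x, D.
Qed.

Section rationalizable.
Context (R : realType) (G : game R).
Implicit Type Y : forall i, set (strat G i).

Lemma has_measure_one_mono (T : ptopologicalType) (mu : Delta R T) (S S' : set T) :
  S `<=` S' -> has_measure_one mu S -> has_measure_one mu S'.
Proof.
move=> SS' /has_measure_oneP[B mB [BS B1]]; apply/has_measure_oneP.
by exists B => //; split => //; exact: subset_trans SS'.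
Qed.

Lemma reduce_mono Y Y' : (forall i, Y i `<=` Y' i) -> forall i, reduce Y (i := i) `<=` reduce Y' (i := i).
Proof.
move=> YY' i s [Ys [mu [m1 br]]]; split; first exact: YY'.
by exists mu; split => //; exact: has_measure_one_mono m1.
Qed.

(** Stage a is the intersection of the reductions of all earlier stages, one formula covering the
    least, successor and limit cases. Since the well order is too long for distinct stages, two of
    them coincide. *)
Lemma reduction_sequence_ex : exists (W : Type) (le : rel W) (Y : W -> forall i, set (strat G i)),
  [/\ wochoice.well_order le, reduction_sequence le Y,
      (forall a i, Y a i = \bigcap_(b in [set b | precedes le b a]) reduce (Y b) (i := i)) &
      exists a, stable (Y a)].
Proof.
have [W [le [wo inj]]] := well_order_large (forall i, set (strat G i)).
pose F a (f : forall b, precedes le b a -> forall i, set (strat G i)) : forall i, set (strat G i) :=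
  fun i => [set s | forall b (ba : precedes le b a), reduce (f b ba) s].
pose Y := Fix (precedes_wf wo) (fun _ => forall i, set (strat G i)) F.
have YE a i : Y a i = \bigcap_(b in [set b | precedes le b a]) reduce (Y b) (i := i).
  rewrite {1}/Y Fix_eq// => {}a f f' ff'; congr (F a _).
  by apply: functional_extensionality_dep => b; apply: functional_extensionality_dep => ba; exact: ff'.
have Yanti b a : precedes le b a -> forall i, Y a i `<=` reduce (Y b) (i := i).
  by move=> ba i; rewrite YE => s; exact.
exists W, le, Y; split => //.
- split.
  + move=> a least i; rewrite YE; apply/seteqP; split => // s _ b /= /(well_order_precedes wo).
    by case; exact: least.
  + move=> b a [ba bP] i; apply/seteqP; split; first exact: Yanti.
    move=> s sb; rewrite YE => c /= ca.
    have [->//|cb] := pselect (c = b).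
    have {}cb : precedes le c b.
      apply/(well_order_precedes wo) => bc; have := (well_order_precedes wo a c).2 ca; apply.
      by apply: bP; split => //; exact: nesym.
    apply: reduce_mono sb => k t; rewrite [in X in X -> _]YE => tb.
    by have [] := tb c cb.
  + move=> a [_ nsucc] i; apply/seteqP; split => s; first by move=> Ya b /Yanti/(_ i s Ya)[].
    move=> sY; rewrite YE => b /= ba; have [c [bc ca]] : exists c, precedes le b c /\ precedes le c a.
      apply: contrapT => nc; apply: nsucc; exists b; split => // c bc.
      by apply: contrapT => /(well_order_precedes wo) ca; apply: nc; exists c.
    exact: (Yanti _ _ bc) (sY c ca).
(* Stages decrease and stage a is contained in the reduction of stage b for b before a, so two equal
   stages make the earlier one stable. *)
- apply: contrapT => ns; have [a [b [ab Yab]]] := inj Y.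
  wlog ba : a b ab Yab / precedes le b a.
    move=> h; have [le_ab|le_ba] := well_order_total wo a b.
      exact: (h b a (nesym ab) (esym Yab) (conj le_ab ab)).
    exact: (h a b ab Yab (conj le_ba (nesym ab))).
  apply: ns; exists b => i; apply/seteqP; split; first by move=> s [].
  by rewrite -[X in X `<=` _](congr1 (fun h => h i) Yab); exact: Yanti.
Qed.

(** A stable stage is itself a best-response family, hence inside Y; conversely, Y survives every
    stage by induction, because [reduce] is monotone. *)
Lemma RAT_largest Y :
  (forall i s, Y i s -> exists mu : Delta R (strat G (opponent i)),
     best_response (s, mu) /\ has_measure_one mu (Y (opponent i))) ->
  (forall Y', (forall i s, Y' i s -> exists mu : Delta R (strat G (opponent i)),
     best_response (s, mu) /\ has_measure_one mu (Y' (opponent i))) -> forall i, Y' i `<=` Y i) ->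
  forall i, RAT G i = Y i.
Proof.
move=> Ybr Ymax i; apply/seteqP; split => s.
  move=> [W [le [Z [a [wo rs st _ Zs]]]]]; apply: (Ymax (Z a)) => // k t Zt.
  by have := st k => sk; move: Zt; rewrite -sk => -[_ [mu [m1 br]]]; exists mu.
move=> Ys; have [W [le [Z [wo rs ZE [a0 st0]]]]] := reduction_sequence_ex.
have [|a st amin] := well_order_min wo (S := [set a | stable (Z a)]); first by exists a0.
exists W, le, Z, a; split => //; first by move=> b /(well_order_precedes wo) ab /amin.
elim/(well_founded_ind (precedes_wf wo)): a i s Ys {st amin} => a IH i s Ys.
rewrite ZE => b /= ba; split; first exact: IH.
have [mu [br m1]] := Ybr i s Ys; exists mu; split => //.
by apply: has_measure_one_mono m1 => t; exact: IH.
Qed.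

End rationalizable.

(** * Countable bases of cozero sets *)

Section product_topology.
Context (I : Type) (K : I -> topologicalType).

Lemma product_proj_continuous i : continuous (fun x : prod_topology K => x i).
Proof.
move=> x U; have /(@cvg_sup _ _ _ _ x)/(_ i) : nbhs x --> x by [].
move=> xi /(@initial_continuous _ _ (fun f : (forall i, K i) => f i) x U) Ui.
exact: xi.
Qed.

(** The support of a basic box is a list used through [List.In], since the index type has no
    decidable equality; the same reason forces the transport along equations in the proof. *)
Lemma product_nbhs (x : prod_topology K) (U : set (prod_topology K)) : nbhs x U ->
  exists (s : seq I) (W : forall i, set (K i)), (forall i, nbhs (x i) (W i)) /\
    [set y : prod_topology K | forall i, List.In i s -> W i (y i)] `<=` U.
Proof.
pose D := (seq I * (forall i, set (K i)))%type.
pose F := filter_from [set p : D | forall i, nbhs (x i) (p.2 i)]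
  (fun p => [set y : prod_topology K | forall i, List.In i p.1 -> p.2 i (y i)]).
have FF : Filter F.
  apply: filter_from_filter.
    by exists ([::], fun i => setT) => i /=; exact: filterT.
  move=> [s W] [s' W'] /= xW xW'; exists ((s ++ s')%SEQ, fun i => W i `&` W' i).
    by move=> i /=; exact: filterI.
  by move=> y /= yW; split => i si; have [] := yW i (List.in_or_app _ _ _ _) => //; tauto.
have : F --> x.
  apply/(@cvg_sup) => i U' /=; rewrite (@nbhsE (initial_topology (fun f : (forall i, K i) => f i))) => -[B [[V oV VB] Bx] BU'].
  exists ([:: i], fun k => [set v : K k | forall e : k = i, V (eq_rect k K v i e)]).
    move=> k /=; have [ki|ki] := pselect (k = i); last by apply: filterS filterT => v _ e; case: (ki e).
    have : nbhs (x k) [set v : K k | V (eq_rect k K v i ki)].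
      by subst i; apply: open_nbhs_nbhs; split => //=; rewrite -VB in Bx.
    by apply: filterS => v Vv e; rewrite (Prop_irrelevance e ki).
  move=> y /= yV; apply: BU'; rewrite -VB /=; exact: (yV i (or_introl erefl) erefl).
by move=> Fx /Fx[[s W] /= xW sW]; exists s, W.
Qed.

End product_topology.

Section cozero_base.
Context (R : realType).

(* This is all that is used of the topology of the spaces of hierarchies; unlike
   metrizability it passes to [Delta] without any compactness argument. *)
Definition cozero_base (T : topologicalType) (I : countType) (u : I -> T -> R) : Prop :=
  [/\ forall k, continuous (u k), forall k x, 0 <= u k x <= 1,
      forall x U, nbhs x U -> exists k, 0 < u k x /\ [set y | 0 < u k y] `<=` U &
      forall x y, (forall k, 0 < u k x <-> 0 < u k y) -> x = y].

Definition has_cozero_base (T : topologicalType) : Prop :=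
  exists (I : countType) (u : I -> T -> R), cozero_base u.

Lemma open_cozero (T : topologicalType) (f : T -> R) r : continuous f -> open [set x | r < f x].
Proof. by move=> cf; exact: (open_preimage cf (@open_gt R r)). Qed.

Definition clamp (x : R) : R := Num.max 0 (Num.min 1 x).

Lemma clamp_itv x : 0 <= clamp x <= 1.
Proof. by rewrite /clamp le_max lexx/= ge_max ler01 ge_min lexx. Qed.

Lemma clamp_gt0 x : (0 < clamp x) = (0 < x).
Proof. by rewrite /clamp lt_max ltxx/= lt_min ltr01. Qed.

Lemma continuous_clamp (T : topologicalType) (f : T -> R) : continuous f -> continuous (clamp \o f).
Proof.
move=> cf x; apply: (@continuous_max R T (cst 0) (fun y => Num.min 1 (f y))); first exact: cvg_cst.
by apply: (@continuous_min R T (cst 1) f); [exact: cvg_cst|exact: cf].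
Qed.

Lemma continuous_subr (T : topologicalType) (f : T -> R) c :
  continuous f -> continuous (fun x => f x - c).
Proof. by move=> cf x; apply: (@cvgB _ R^o); [exact: cf|exact: cvg_cst]. Qed.

Lemma cozero_base_measurable (T : ptopologicalType) (I : countType) (u : I -> T -> R)
    d (S : measurableType d) (F : S -> T) : cozero_base u ->
  (forall k, measurable [set s | 0 < u k (F s)]) -> measurable_fun setT (F : S -> borel T).
Proof.
move=> [cu u01 base sep] mF; apply: (@measurability _ _ _ (borel T) _ _ open) => //.
move=> _ [U oU <-]; rewrite setTI.
rewrite (_ : F @^-1` U = \bigcup_(k : I) (if `[< [set y | 0 < u k y] `<=` U >]
    then [set s | 0 < u k (F s)] else set0)).
  by apply: countable_bigcupT_measurable => // k; case: ifP.
apply/seteqP; split => [s Us|s [k _]]; last by case: ifP => // /asboolP kU us; exact: kU.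
have : nbhs (F s) U by apply: open_nbhs_nbhs; split.
by move=> /base[k [us kU]]; exists k => //; rewrite asboolT.
Qed.

Lemma cozero_base_polish (T : ptopologicalType) : polish R T -> has_cozero_base T.
Proof.
move=> [[D cD dD] [d [[d0 d1 dC dT] dm dc]]].
have ball_nbhs x r : 0 < r -> nbhs x [set y | d x y < r].
  by move=> r0; apply/dm; exists r.
have [q qP] := dense_sequence cD dD dm.
pose u (p : nat * nat) (x : T) : R := clamp (p.2.+1%:R^-1 - d x (q p.1)).
have base x U : nbhs x U -> exists k, 0 < u k x /\ [set y | 0 < u k y] `<=` U.
  move=> /dm[r r0 rU]; have [|n nr] := @exists_invS_lt R (r / 2); first by lra.
  have n0 : (0 : R) < n.+1%:R^-1 by rewrite invr_gt0.
  have [k kx] := qP x _ n0; exists (k, n); rewrite /u clamp_gt0/=; split; first by rewrite subr_gt0.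
  move=> y /=; rewrite clamp_gt0 => ny; apply: rU => /=; apply: le_lt_trans (dT _ (q k) _) _.
  by rewrite (dC _ y); move: n0 nr kx ny; move: (n.+1%:R^-1) => e; lra.
exists (nat * nat)%type, u; split => //.
- move=> [k n]; apply: continuous_clamp => x.
  apply: (@cvgB _ R^o); first exact: cvg_cst.
  apply/(@cvgrPdist_lt _ R^o) => e e0; have := ball_nbhs x e e0; apply: filterS => y /= xy.
  have := dT x y (q k); have := dT y x (q k); rewrite (dC y x) => h1 h2.
  by rewrite ltr_norml; apply/andP; split; lra.
- by move=> k x; exact: clamp_itv.
- move=> x y xy; apply/d1/eqP; rewrite eq_le d0 andbT leNgt; apply/negP => xy0.
  have [k [kx /(_ y)]] := base x _ (ball_nbhs x _ xy0).
  by rewrite /= ltxx => h; have := h ((xy k).1 kx).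
Qed.

Lemma cozero_base_pair (T U : topologicalType) (I J : countType) (u : I -> T -> R) (v : J -> U -> R) :
  cozero_base u -> cozero_base v -> cozero_base (fun (k : I * J) (z : T * U) => u k.1 z.1 * v k.2 z.2).
Proof.
move=> [cu u01 ub us] [cv v01 vb vs].
have uv0 k l x y : (0 < u k x * v l y) = (0 < u k x) && (0 < v l y).
  have /andP[u0 _] := u01 k x; have /andP[v0 _] := v01 l y.
  by rewrite !lt0r mulf_eq0 negb_or mulr_ge0// u0 v0 !andbT.
split.
- move=> k z; apply: (@continuousM R _ (fun z => u k.1 z.1) (fun z => v k.2 z.2)).
    exact: (continuous_compose (@continuous_fst T U) (cu k.1)).
  exact: (continuous_compose (@continuous_snd T U) (cv k.2)).
- move=> k z; have /andP[u0 u1] := u01 k.1 z.1; have /andP[v0 v1] := v01 k.2 z.2.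
  by rewrite mulr_ge0//= mulr_ile1.
- move=> [x y] W [[A B] [/= /ub[k [kx kA]] /vb[l [ly lB]]] AB]; exists (k, l).
  rewrite /= uv0 kx ly; split => // -[x' y'] /=; rewrite uv0 => /andP[/kA Ax /lB By].
  exact: (AB (x', y')).
- move=> [x y] [x' y'] /= xy; have h (T' : topologicalType) (K : countType) (w : K -> T' -> R) a :
    (forall z W, nbhs z W -> exists k, 0 < w k z /\ [set y | 0 < w k y] `<=` W) -> exists k, 0 < w k a.
    by move=> wb; have [k []] := wb a setT filterT; exists k.
  have [kx kxP] := h _ _ _ x ub; have [kx' kxP'] := h _ _ _ x' ub.
  have [ly lyP] := h _ _ _ y vb; have [ly' lyP'] := h _ _ _ y' vb.
  congr (_, _).
    apply: us => k; split => kP.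
      by have := (xy (k, ly)).1; rewrite /= !uv0 kP lyP => /(_ isT)/andP[].
    by have := (xy (k, ly')).2; rewrite /= !uv0 kP lyP' => /(_ isT)/andP[].
  apply: vs => l; split => lP.
    by have := (xy (kx, l)).1; rewrite /= !uv0 lP kxP => /(_ isT)/andP[].
  by have := (xy (kx', l)).2; rewrite /= !uv0 lP kxP' => /(_ isT)/andP[].
Qed.

(** The Borel sigma-algebra of a product may exceed the product sigma-algebra in general; a
    countable base of rectangles excludes this. *)
Lemma measurable_pair_borel (T U : ptopologicalType) d (S : measurableType d) (F : S -> T) (G : S -> U) :
  has_cozero_base T -> has_cozero_base U ->
  measurable_fun setT (F : S -> borel T) -> measurable_fun setT (G : S -> borel U) ->
  measurable_fun setT ((fun s => (F s, G s)) : S -> borel (T * U)%type).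
Proof.
move=> [I [u ubase]] [J [v vbase]] mF mG.
apply: (cozero_base_measurable (cozero_base_pair ubase vbase)) => -[k l] /=.
have [cu u01 _ _] := ubase; have [cv v01 _ _] := vbase.
rewrite (_ : [set s | _] = F @^-1` [set x | 0 < u k x] `&` G @^-1` [set y | 0 < v l y]).
  apply: measurableI; rewrite -[X in measurable X]setTI.
    by apply: mF => //; apply: (@open_measurable_borel T [set x | 0 < u k x]); exact: (@open_cozero T (u k) 0).
  by apply: mG => //; apply: (@open_measurable_borel U [set x | 0 < v l x]); exact: (@open_cozero U (v l) 0).
apply/seteqP; split => s /=; have /andP[u0 _] := u01 k (F s); have /andP[v0 _] := v01 l (G s).
  by rewrite !lt0r mulf_eq0 negb_or u0 v0 !andbT => /andP[/andP[]].
by move=> [? ?]; exact: mulr_gt0.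
Qed.

Lemma measurable_eq_borel (T : ptopologicalType) d (S : measurableType d) (F G : S -> T) :
  has_cozero_base T -> measurable_fun setT (F : S -> borel T) ->
  measurable_fun setT (G : S -> borel T) -> measurable [set s | F s = G s].
Proof.
move=> [I [u [cu u01 _ us]]] mF mG; pose A k (H : S -> T) := [set s | 0 < u k (H s)].
have mA k H : measurable_fun setT (H : S -> borel T) -> measurable (A k H).
  move=> mH; have -> : A k H = setT `&` H @^-1` [set x | 0 < u k x] by rewrite setTI.
  apply: mH => //.
  by apply: (@open_measurable_borel T [set x | 0 < u k x]); exact: (@open_cozero T (u k) 0).
rewrite (_ : [set s | _] = ~` \bigcup_(k : I) ((A k F `\` A k G) `|` (A k G `\` A k F))).
  apply: measurableC; apply: countable_bigcupT_measurable => // k.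
  by apply: measurableU; apply: measurableD; exact: mA.
apply/seteqP; split => s /=; first by move=> FG [k _ []] []; rewrite /A /= FG.
move=> h; apply: us => k; split => ks; apply: contrapT => nks; apply: h; exists k => //;
  by [left|right].
Qed.

End cozero_base.

(** * A countable cozero base for the weak topology *)

Section Delta_base.
Context (R : realType) (T : ptopologicalType) (I : countType) (u : I -> T -> R).
Hypothesis ubase : cozero_base u.

(** For a positive slope l it has height |q| where the cozero function is at least 1/l and vanishes
    off its cozero set; the absolute value makes every index give a nonnegative function. *)
Definition tent (p : rat * nat * I) (x : T) : R :=
  `|ratr p.1.1| * Num.min 1 (p.1.2%:R * u p.2 x).

Definition tents (L : seq (rat * nat * I)) (x : T) : R :=
  foldr (fun p a => Num.max (tent p x) a) 0 L.

Let cu k : continuous (u k). Proof. by have [] := ubase. Qed.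

Let u01 k x : 0 <= u k x <= 1. Proof. by have [] := ubase. Qed.

Lemma continuous_tents L : continuous (tents L).
Proof.
elim: L => [|p L IH] x; first exact: cvg_cst.
apply: (@continuous_max R T (tent p) (tents L)); last exact: IH.
apply: (@continuousM R T (cst `|ratr p.1.1|)); first exact: cvg_cst.
apply: (@continuous_min R T (cst 1) (fun x => p.1.2%:R * u p.2 x)); first exact: cvg_cst.
by apply: (@continuousM R T (cst p.1.2%:R)); [exact: cvg_cst|exact: cu].
Qed.

Lemma tents_ge0 L x : 0 <= tents L x.
Proof. by elim: L => //= p L IH; rewrite le_max IH orbT. Qed.

Lemma tents_le L x c : 0 <= c -> (forall p, List.In p L -> tent p x <= c) -> tents L x <= c.
Proof.
move=> c0; elim: L => //= p L IH pL; rewrite ge_max pL ?IH//; last by left.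
by move=> q qL; apply: pL; right.
Qed.

Lemma le_tents L x p : List.In p L -> tent p x <= tents L x.
Proof.
elim: L => //= q L IH [->|/IH h]; first by rewrite le_max lexx.
by rewrite le_max h orbT.
Qed.

Lemma tents_bounded L : exists M, forall x, `|tents L x| <= M.
Proof.
elim: L => [|p L [M MP]]; first by exists 0 => x; rewrite normr0.
exists (Num.max `|ratr p.1.1| M) => x; rewrite (ger0_norm (tents_ge0 (p :: L) x)) /=.
rewrite ge_max !le_max; apply/andP; split; apply/orP; [left|right].
  by rewrite ler_piMr// ge_min lexx.
by have := MP x; rewrite (ger0_norm (tents_ge0 L x)).
Qed.

Lemma measurable_tents L : measurable_fun setT (tents L : borel T -> R).
Proof.
apply: (@measurable_fun_gt _ (borel T)) => q; apply: (@open_measurable_borel T (fun x => q < tents L x)).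
refine (@open_cozero R T (tents L) q (@continuous_tents L)).
Qed.

(* A lower semicontinuous f >= 0 is the supremum of the countably many tents
   below it. *)
Lemma tents_approx (P : probability (borel T) R) (f : T -> R) M e : 0 < e ->
  (forall x, 0 <= f x <= M) -> (forall r, open [set x | r < f x]) ->
  exists2 L, (forall x, tents L x <= f x) &
    \int[P]_x (f : borel T -> R) x - e < \int[P]_x (tents L : borel T -> R) x.
Proof.
move=> e0 f0M fo.
have f0 x : 0 <= f x by have /andP[] := f0M x.
pose L N := [seq p <- pmap (@pickle_inv (rat * nat * I)%type) (iota 0 N) | `[< forall x, tent p x <= f x >]].
have InL N p : List.In p (L N) <-> (pickle p < N)%N /\ forall x, tent p x <= f x.
  have -> : List.In p (L N) <-> p \in L N.
    elim: (L N) => //= q s IH; rewrite inE; split.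
      by move=> [->|/IH->]; rewrite ?eqxx ?orbT.
    by move=> /orP[/eqP->|/IH]; [left|right].
  rewrite mem_filter mem_pmap; split.
    move=> /andP[/asboolP pf /mapP[k]]; rewrite mem_iota add0n => /andP[_ kN] pk.
    split => //; rewrite (_ : pickle p = k)//; move: pk.
    by move=> pk; have := @pickle_invK (rat * nat * I)%type k; rewrite -pk.
  move=> [pN pf]; apply/andP; split; first exact/asboolP.
  by apply/mapP; exists (pickle p); rewrite ?mem_iota ?pickleK_inv.
have Lf N x : tents (L N) x <= f x by apply: tents_le => // p /InL[_].
apply: contrapT => nL.
have nL' N : \int[P]_x (tents (L N) : borel T -> R) x <= \int[P]_x (f : borel T -> R) x - e.
  by rewrite leNgt; apply/negP => h; apply: nL; exists (L N).
have mf : measurable_fun setT (f : borel T -> R).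
  by apply: (@measurable_fun_gt _ (borel T)) => q; exact: open_measurable_borel.
have int g : measurable_fun setT (g : borel T -> R) -> (forall x, 0 <= g x <= M) ->
    (\int[P]_x (g x)%:E = (\int[P]_x g x)%:E)%E.
  move=> mg g0M; rewrite /Rintegral fineK//; apply: integrable_fin_num => //.
  apply: (@bounded_integrable _ (borel T) R P _ g M) => //; first exact: probability_setT.
  by move=> x; have /andP[g0 gM] := g0M x; rewrite ger0_norm.
have intL N : (\int[P]_x (tents (L N) x)%:E = (\int[P]_x (tents (L N) : borel T -> R) x)%:E)%E.
  apply: int; first exact: measurable_tents.
  by move=> x; have /andP[_ fM] := f0M x; rewrite tents_ge0 (le_trans (Lf N x)).
have ndL x : nondecreasing_seq (fun N => (tents (L N) x)%:E).
  move=> N N' NN'; rewrite lee_fin; apply: tents_le; first exact: tents_ge0.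
  by move=> p /InL[pN pf]; apply: le_tents; apply/InL; split => //; exact: leq_trans NN'.
have limL x : (limn (fun N => (tents (L N) x)%:E) = (f x)%:E)%E.
  apply/cvg_lim => //; apply/cvg_EFin; first by near=> N.
  apply/(@cvgrPdist_lt _ R^o) => r r0.
  have [p px pf] : exists2 p, f x - r < tent p x & forall y, tent p y <= f y.
    (* When f x < r the zero tent suffices; an index for it exists because some cozero set contains
       x. *)
    have [fr|fr] := ltP (f x) r.
      have [k _] : I * unit by have [_ _ ub _] := ubase; have [k _] := cid (ub x setT filterT).
      exists (0, 0%N, k); rewrite /tent/= ?raddf0 ?normr0 ?mul0r ?subr_lt0//.
      by move=> y; rewrite mul0r.
    have [q] := @rat_in_itvoo R (f x - r) (f x) (ltac:(lra)); rewrite in_itv/= => /andP[q1 q2].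
    have q0 : 0 <= ratr q :> R by lra.
    have [_ _ ub _] := ubase.
    have [k [kx kU]] := ub x [set y | ratr q < f y] (open_nbhs_nbhs (conj (fo _) q2)).
    have [l lk] := exists_invS_lt kx.
    exists (q, l.+1, k); rewrite /tent/= (ger0_norm q0).
      rewrite min_l ?mulr1// -ler_pdivrMl ?ltr0n// mulr1; exact: ltW.
    move=> y; have [uy|uy] := ltP 0 (u k y).
      by apply: le_trans (ltW (kU y uy)); rewrite ler_piMr// ge_min lexx.
    rewrite (_ : u k y = 0); last by apply/eqP; rewrite eq_le uy; have /andP[] := u01 k y.
    by rewrite mulr0 min_r ?ler01// mulr0.
  near=> N; rewrite ger0_norm ?subr_ge0 ?Lf// ltrBlDr -ltrBlDl.
  apply: lt_le_trans px _; apply: le_tents; apply/InL; split => //.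
  by near: N; exact: nbhs_infty_gt.
have mL N : measurable_fun setT (fun x : borel T => (tents (L N) x)%:E).
  by apply/measurable_EFinP; exact: measurable_tents.
have L0 N (x : borel T) : setT x -> (0 <= (tents (L N) x)%:E)%E by rewrite lee_fin tents_ge0.
have := @monotone_convergence _ (borel T) R P setT measurableT (fun N x => (tents (L N) x)%:E)
  mL L0 (fun x _ => ndL x).
under eq_integral do rewrite limL.
rewrite int// => lE; have : ((\int[P]_x (f : borel T -> R) x)%:E <= (\int[P]_x (f : borel T -> R) x - e)%:E)%E.
  rewrite {1}lE; apply: lime_le.
    apply: ereal_nondecreasing_is_cvgn => N N' NN'; apply: ge0_le_integral => //.
      exact: L0.
    by move=> x _; exact: ndL.
  by near=> N; rewrite intL lee_fin.
by rewrite lee_fin; lra.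
Unshelve. all: by end_near. Qed.

Let mass (p : seq (rat * nat * I) * rat) (nu : Delta R T) : R :=
  clamp (\int[nu]_x (tents p.1 : borel T -> R) x - ratr p.2).

(** A product of clamped excesses, so that positivity is the conjunction of finitely many strict
    lower bounds on integrals of tents. *)
Definition Delta_cozero (s : seq (seq (rat * nat * I) * rat)) (nu : Delta R T) : R :=
  foldr (fun p a => mass p nu * a) 1 s.

Let mass_itv p nu : 0 <= mass p nu <= 1. Proof. exact: clamp_itv. Qed.

Lemma Delta_cozero_gt0 s (nu : Delta R T) : 0 < Delta_cozero s nu <->
  forall p, List.In p s -> ratr p.2 < \int[nu]_x (tents p.1 : borel T -> R) x.
Proof.
have mass0 p : 0 <= mass p nu by have /andP[] := mass_itv p nu.
have D0 s' : 0 <= Delta_cozero s' nu by elim: s' => //= p s' IH; exact: mulr_ge0.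
elim: s => [|p s IH] /=; first by rewrite ltr01.
rewrite lt0r mulr_ge0// andbT mulf_eq0 negb_or; split.
  move=> /andP[p0 s0] q [<-|qs].
    by move: p0; rewrite neq_lt ltNge mass0/= clamp_gt0 subr_gt0.
  by apply: IH.1 => //; rewrite lt0r s0 D0.
move=> h; rewrite !gt_eqF//; first by apply/IH => q qs; apply: h; right.
by rewrite clamp_gt0 subr_gt0; apply: h; left.
Qed.

Lemma continuous_integral (f : bounded_continuous R T) :
  continuous (fun nu : Delta R T => \int[nu]_x (sval f : borel T -> R) x).
Proof.
exact: (continuous_compose (@initial_continuous _ _ (@Delta_eval R T))
  (@product_proj_continuous _ (fun _ : bounded_continuous R T => R) f)).
Qed.

Lemma continuous_Delta_cozero s : continuous (Delta_cozero s).
Proof.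
elim: s => [|p s IH]; first exact: (@cst_continuous _ R^o 1).
move=> nu; apply: (@continuousM R (Delta R T) (mass p) (Delta_cozero s)); last exact: IH.
apply: (@continuous_clamp R _ (fun nu : Delta R T => \int[nu]_x (tents p.1 : borel T -> R) x - ratr p.2)).
have cb : continuous (tents p.1) /\ exists M : R, forall x, `|tents p.1 x| <= M.
  by split; [exact: continuous_tents|exact: tents_bounded].
pose bc : bounded_continuous R T := exist _ _ cb.
refine (@continuous_subr R (Delta R T) _ _ (@continuous_integral bc)).
Qed.

Let bounded_integrable' (P : probability (borel T) R) (f : T -> R) M : continuous f ->
  (forall x, `|f x| <= M) -> P.-integrable setT (EFin \o (f : borel T -> R)).
Proof.
move=> cf fM; apply: (@bounded_integrable _ (borel T) R P _ f M) => //; first exact: probability_setT.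
apply: (@measurable_fun_gt _ (borel T)) => q; apply: (@open_measurable_borel T (fun x => q < f x)).
exact: (@open_cozero R T f q).
Qed.

Lemma le_Rintegral_bounded (P : probability (borel T) R) (f g : T -> R) M N :
  continuous f -> continuous g -> (forall x, `|f x| <= M) -> (forall x, `|g x| <= N) ->
  (forall x, f x <= g x) -> \int[P]_x (f : borel T -> R) x <= \int[P]_x (g : borel T -> R) x.
Proof.
move=> cf cg fM gN fg; apply: le_Rintegral => //; [exact: bounded_integrable' fM|exact: bounded_integrable' gN].
Qed.

(** Lower bounds on integrals alone generate the weak topology: approximating both f + M and M - f
    from below controls the integral of f from both sides. *)
Let Delta_base_nbhs (mu : Delta R T) U : nbhs mu U ->
  exists s, 0 < Delta_cozero s mu /\ [set nu | 0 < Delta_cozero s nu] `<=` U.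
Proof.
have step (f : bounded_continuous R T) (e : R) : 0 < e -> exists s, 0 < Delta_cozero s mu /\
    forall nu, 0 < Delta_cozero s nu ->
    `|\int[mu]_x (sval f : borel T -> R) x - \int[nu]_x (sval f : borel T -> R) x| < e.
  case: f => f [cf [M fM]] /= e0.
  have cM : continuous (cst M : T -> R) by move=> x; exact: cvg_cst.
  have half (g : T -> R) (N : R) : continuous g -> (forall x, 0 <= g x <= N) ->
      exists p, ratr p.2 < \int[mu]_x (tents p.1 : borel T -> R) x /\ forall nu : Delta R T,
      ratr p.2 < \int[nu]_x (tents p.1 : borel T -> R) x ->
      \int[mu]_x (g : borel T -> R) x - e < \int[nu]_x (g : borel T -> R) x.
    move=> cg gN; have [L Lg muL] := tents_approx mu e0 gN (fun r => @open_cozero R T g r cg).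
    have [q] := rat_in_itvoo muL; rewrite in_itv/= => /andP[q1 q2]; exists (L, q); split => // nu /= qnu.
    apply: lt_le_trans (lt_trans q1 qnu) _.
    have [N' LN'] := tents_bounded L; apply: le_Rintegral_bounded LN' _ Lg => //; first exact: continuous_tents.
    by move=> x; have /andP[g0 gx] := gN x; rewrite ger0_norm//; exact: gx.
  have iM (P : probability (borel T) R) : P.-integrable setT (EFin \o (cst M : borel T -> R)).
    exact: (@bounded_integrable' P (cst M) `|M| cM (fun x => lexx `|M|)).
  have intc (P : probability (borel T) R) : \int[P]_x (cst M : borel T -> R) x = M.
    rewrite Rintegral_cst// [X in fine X](_ : _ = 1%E) ?mulr1//; exact: probability_setT.
  have intM (P : probability (borel T) R) : \int[P]_x (f x + M : R) = \int[P]_x (f : borel T -> R) x + M.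
    have -> : \int[P]_x (f x + M : R) = \int[P]_x (f x + (cst M : borel T -> R) x) by [].
    rewrite (RintegralD measurableT (@bounded_integrable' P f M cf fM) (iM P)).
    by rewrite intc.
  have intN (P : probability (borel T) R) : \int[P]_x (M - f x : R) = M - \int[P]_x (f : borel T -> R) x.
    have -> : \int[P]_x (M - f x : R) = \int[P]_x ((cst M : borel T -> R) x - f x) by [].
    rewrite (RintegralB measurableT (iM P) (@bounded_integrable' P f M cf fM)).
    by rewrite intc.
  have fM' x : - M <= f x <= M by rewrite -ler_norml.
  have [||p [pmu pP]] := half (fun x => f x + M) (M + M).
  + by move=> x; apply: (@cvgD _ R^o); [exact: cf|exact: cvg_cst].
  + by move=> x; have /andP[? ?] := fM' x; apply/andP; split; lra.
  have [||q [qmu qP]] := half (fun x => M - f x) (M + M).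
  + by move=> x; apply: (@cvgB _ R^o); [exact: cvg_cst|exact: cf].
  + by move=> x; have /andP[? ?] := fM' x; apply/andP; split; lra.
  exists [:: p; q]; split.
    by apply/Delta_cozero_gt0 => r [<-//|[<-//|[]]].
  move=> nu /Delta_cozero_gt0 h.
  have := pP nu (h p (or_introl erefl)); have := qP nu (h q (or_intror (or_introl erefl))).
  by rewrite !intM !intN ltr_norml => h1 h2; apply/andP; split; lra.
rewrite (@nbhsE (initial_topology (@Delta_eval R T))) => -[B [[V oV VB] Bmu] BU].
have : nbhs (Delta_eval mu) V by apply: open_nbhs_nbhs; split => //; rewrite -VB in Bmu.
move=> /product_nbhs[l [W [Wmu WV]]].
suff [s [smu sW]] : exists s, 0 < Delta_cozero s mu /\ forall nu, 0 < Delta_cozero s nu ->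
    forall f, List.In f l -> W f (Delta_eval nu f).
  by exists s; split => // nu /= /sW h; apply: BU; rewrite -VB; exact: WV.
elim: l {WV} => [|f l [s [smu sW]]]; first by exists [::]; split => //=; exact: ltr01.
have /(@nbhs_ballP _ R^o)[e /= e0 eW] := Wmu f; have [s' [s'mu s'W]] := step f e e0.
exists (s' ++ s)%SEQ; split.
  by apply/Delta_cozero_gt0 => p /(List.in_app_or s')[]; [move/Delta_cozero_gt0: s'mu|move/Delta_cozero_gt0: smu]; exact.
move=> nu /Delta_cozero_gt0 nuP f' [<-|f'l]; last first.
  by apply: sW f'l; apply/Delta_cozero_gt0 => p ps; apply: nuP; apply: List.in_or_app; right.
apply: eW; rewrite /ball/=; apply: s'W; apply/Delta_cozero_gt0 => p ps.
by apply: nuP; apply: List.in_or_app; left.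
Qed.

(** Indicators of open sets are lower semicontinuous, so integrals of tents determine the measures
    of open sets, and these form a generating pi-system. *)
Let Delta_base_separates (mu nu : Delta R T) :
  (forall s, 0 < Delta_cozero s mu <-> 0 < Delta_cozero s nu) -> mu = nu.
Proof.
move=> munu.
have tE L : \int[mu]_x (tents L : borel T -> R) x = \int[nu]_x (tents L : borel T -> R) x.
  have h (a b : Delta R T) : (forall s, 0 < Delta_cozero s a <-> 0 < Delta_cozero s b) ->
      \int[a]_x (tents L : borel T -> R) x <= \int[b]_x (tents L : borel T -> R) x.
    move=> ab; rewrite leNgt; apply/negP => /rat_in_itvoo[q]; rewrite in_itv/= => /andP[q1 q2].
    have /Delta_cozero_gt0/(_ _ (or_introl erefl)) : 0 < Delta_cozero [:: (L, q)] b.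
      by apply/ab/Delta_cozero_gt0 => p [<-//|[]].
    by move=> /(lt_trans q1); rewrite ltxx.
  by apply/eqP; rewrite eq_le !h// => s; rewrite munu.
have openE (U : set T) : open U -> forall a b : Delta R T,
    (forall L, \int[a]_x (tents L : borel T -> R) x = \int[b]_x (tents L : borel T -> R) x) ->
    prb a U <= prb b U.
  move=> oU a b ab; have mU : measurable (U : set (borel T)) by exact: open_measurable_borel.
  have intU (P : probability (borel T) R) : \int[P]_x (\1_U x : R) = prb P U.
    by rewrite /Rintegral integral_indic// setIT.
  apply/ler_addgt0Pr => e e0.
  have [||L Lf aL] := @tents_approx a (\1_U : T -> R) 1 e e0.
  - by move=> x; rewrite indicE; case: (_ \in _); rewrite ?ler01 ?lexx.
  - move=> r; have [r0|r0] := ltP r 0.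
      rewrite (_ : [set _ | _] = setT); first exact: openT.
      by apply/seteqP; split => // x _ /=; rewrite indicE; apply: lt_le_trans r0 _.
    have [r1|r1] := ltP r 1.
      rewrite (_ : [set _ | _] = U)//; apply/seteqP; split => x /=; rewrite indicE.
        by case: (boolP (x \in U)) => [/set_mem//|_]; rewrite ltNge r0.
      by move=> Ux; rewrite mem_set.
    rewrite (_ : [set _ | _] = set0); first exact: open0.
    apply/seteqP; split => // x /=; rewrite indicE.
    by case: (x \in U); rewrite ltNge ?r1// (le_trans ler01 r1).
  rewrite intU in aL; rewrite -lerBlDr (le_trans (ltW aL))// ab -intU.
  have [N LN] := tents_bounded L.
  apply: le_Rintegral => //.
  - exact: (@bounded_integrable' b (tents L) N (@continuous_tents L) LN).
  - apply: (@bounded_integrable _ (borel T) R b _ _ 1); first exact: probability_setT.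
      exact: measurable_indic.
    by move=> x; rewrite indicE ger0_norm// lern1 leq_b1.
apply: Delta_eq; apply: (@measure_unique _ R (borel T) (@open T) (fun=> setT)) => //.
+ by move=> A B; exact: openI.
+ by move=> _; exact: openT.
+ by rewrite bigcup_const.
+ move=> U oU; have mU : measurable (U : set (borel T)) by exact: open_measurable_borel.
  have e1 : prb mu U = prb nu U by apply/eqP; rewrite eq_le !openE.
  by rewrite [LHS](@prbE _ _ _ (Delta_prob mu))// e1 -prbE.
+ by move=> _; rewrite [X in (X < _)%E](probability_setT mu) ltry.
Qed.

Lemma Delta_cozero_base : cozero_base Delta_cozero.
Proof.
split; [exact: continuous_Delta_cozero| |exact: Delta_base_nbhs|exact: Delta_base_separates].
move=> s nu; elim: s => [|p s /andP[IH1 IH2]] /=; first by rewrite ler01 lexx.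
by have /andP[c1 c2] := mass_itv p nu; rewrite mulr_ge0//= mulr_ile1.
Qed.

Lemma measurable_Rintegral d (S : measurableType d) (F : S -> Delta R T) (h : borel T -> R) M :
  (forall B : set (borel T), measurable B -> measurable_fun setT (fun s => prb (F s) B)) ->
  measurable_fun setT h -> (forall x, `|h x| <= M) ->
  forall r, measurable [set s | r < \int[F s]_x h x].
Proof.
move=> mF mh hM; pose M' := `|M| + 1.
have M0 : 0 < M' by apply: ltr_wpDl.
have hM' x : `|h x| <= M' by apply: le_trans (hM x) _; rewrite /M'; have := ler_norm M; lra.
have mhq q : measurable [set x | q < h x].
  rewrite (_ : [set x | _] = h @^-1` `]q, +oo[%classic).
    by rewrite -[X in measurable X]setTI; apply: mh => //; exact: measurable_itv.
  by apply/seteqP; split => x /=; rewrite in_itv/= andbT.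
pose a N := 2 * M' / N.+1%:R.
have a0 N : 0 < a N by rewrite divr_gt0// mulr_gt0.
apply: (@lower_Sig_approx R 0 _ S (fun N s => a N * (\sum_(i < N.+1)
    prb (F s) [set x | i%:R * a N - M' < h x]) + (- a N - M')) _ a).
- move=> N; apply: lower_SigD; last exact: lower_Sig_cst.
  apply: lower_SigZ => //; apply: (lower_Sig_sum (F := fun i s => prb (F s) [set x | i%:R * a N - M' < h x])).
  move=> i r; rewrite (_ : [set s | _] = (fun s => prb (F s) [set x | i%:R * a N - M' < h x]) @^-1` `]r, +oo[%classic).
    by rewrite -[X in Sig 0 X]setTI; apply: mF => //; exact: measurable_itv.
  by apply/seteqP; split => x /=; rewrite in_itv/= andbT.
- move=> N s; have lin (y v w x : R) : y - v - w <= x -> x <= y - w -> y + (- v - w) <= x <= y + (- v - w) + v.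
    by move=> h1 h2; apply/andP; split; lra.
  have /andP[] := Rintegral_layers (N := N) (probability_setT (F s)) M0 hM' mhq erefl.
  by rewrite mulrBr mulr1; exact: lin.
- move=> r r0; have [|N Nr] := @exists_invS_lt R (r / (2 * M')); first by rewrite divr_gt0// mulr_gt0.
  by exists N; move: Nr; rewrite ltr_pdivlMr ?mulr_gt0// /a mulrC.
Qed.

(** A kernel is Borel as a map into the weak topology, because the countable base is described by
    integrals of tents, each measurable in the parameter. *)
Lemma measurable_Delta d (S : measurableType d) (F : S -> Delta R T) :
  (forall B : set (borel T), measurable B -> measurable_fun setT (fun s => prb (F s) B)) ->
  measurable_fun setT (F : S -> borel (Delta R T)).
Proof.
move=> mF; apply: (cozero_base_measurable Delta_cozero_base) => s.
rewrite (_ : [set _ | _] = [set x | forall p, List.In p s ->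
  ratr p.2 < \int[F x]_y (tents p.1 : borel T -> R) y]); last first.
  by apply/seteqP; split => x /=; rewrite Delta_cozero_gt0.
elim: s => [|p s IH]; first by rewrite (_ : [set _ | _] = setT)//; apply/seteqP; split => // x _ p [].
rewrite (_ : [set _ | _] = [set x | ratr p.2 < \int[F x]_y (tents p.1 : borel T -> R) y] `&`
  [set x | forall p, List.In p s -> ratr p.2 < \int[F x]_y (tents p.1 : borel T -> R) y]).
  apply: measurableI => //; have [M pM] := tents_bounded p.1.
  exact: (measurable_Rintegral mF (measurable_tents _) pM).
apply/seteqP; split => x /=.
  by move=> h; split => [|q qs]; apply: h; [left|right].
by move=> [h1 h2] q [<-|/h2].
Qed.

End Delta_base.

(** * Belief hierarchies *)

Lemma has_cozero_base_prod (R : realType) (T U : topologicalType) :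
  has_cozero_base R T -> has_cozero_base R U -> has_cozero_base R (T * U)%type.
Proof.
move=> [I [u ub]] [J [v vb]]; exists (I * J)%type, (fun k z => u k.1 z.1 * v k.2 z.2).
exact: cozero_base_pair.
Qed.

Lemma has_cozero_base_Delta (R : realType) (T : ptopologicalType) :
  has_cozero_base R T -> has_cozero_base R (Delta R T).
Proof. by move=> [I [u ub]]; eexists; eexists; exact: (Delta_cozero_base ub). Qed.

Section law.
Context (R : realType) (T U : ptopologicalType).

(* [point] is a junk value: belief hierarchies are defined by recursion before
   they are known to be Borel. *)
Definition law (h : T -> U) (mu : Delta R T) : Delta R U :=
  if pselect (measurable_fun setT (h : borel T -> borel U)) is left mh
  then marg (mfun_of mh) mu else point.

Lemma lawE (h : T -> U) (mu : Delta R T) (A : set (borel U)) :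
  measurable_fun setT (h : borel T -> borel U) -> measurable A -> law h mu A = mu (h @^-1` A).
Proof. by move=> mh mA; rewrite /law; case: pselect => // mh'; rewrite margE. Qed.

End law.

Section type_structure.
Context (R : realType) (G : game R).

Lemma strat_polish i : polish R (strat G i).
Proof. by case: i; [exact: space1_polish|exact: space2_polish]. Qed.

Lemma level_base n i : has_cozero_base R (level G n i).
Proof.
elim: n i => [|n IH] i; first exact: cozero_base_polish (strat_polish _).
apply: has_cozero_base_prod => //; exact: has_cozero_base_Delta.
Qed.

(** A basic neighbourhood restricts finitely many coordinates, so it is pulled back from a level
    beyond all of them. *)
Lemma hierarchy_nbhs i (z : (strat G (opponent i) * hierarchy G (opponent i))%type) U : nbhs z U ->
  exists n (V : set (level G n i)), nbhs (@level_proj R G n i z) V /\ @level_proj R G n i @^-1` V `<=` U.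
Proof.
move=> [[A B] [/= Az /product_nbhs[s [W [zW sW]]]] AB].
pose box := fix box n : set (level G n i) := match n return set (level G n i) with
  | 0 => A | k.+1 => [set l | box k l.1 /\ W k l.2] end.
have boxz n : nbhs (@level_proj R G n i z) (box n).
  elim: n => [|n IH] //=; exists (box n, W n) => //=; split => //; exact: zW.
have boxE n x : box n (@level_proj R G n i x) -> A x.1 /\ forall k, (k < n)%N -> W k (x.2 k).
  elim: n => [|n IH] /=; first by split.
  by move=> [/IH[Ax Wx] Wn]; split => // k; rewrite ltnS leq_eqVlt => /orP[/eqP->|/Wx].
exists (foldr maxn 0%N [seq k.+1 | k <- s]), (box _); split; first exact: boxz.
move=> x /boxE[Ax Wx]; apply: (AB x); split => //=; apply: sW => k ks; apply: Wx.
by elim: s ks => //= a s IH [->|/IH]; rewrite leq_max; [rewrite leqnn|move=> ->; rewrite orbT].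
Qed.

Lemma hierarchy_base i : exists (I : nat -> countType) (u : forall n, I n -> level G n i -> R),
  (forall n, cozero_base (@u n)) /\
  cozero_base (fun (k : {n & I n}) z => u (tag k) (tagged k) (@level_proj R G (tag k) i z)).
Proof.
pose I n : countType := projT1 (cid (level_base n i)).
pose u n : I n -> level G n i -> R := projT1 (cid (projT2 (cid (level_base n i)))).
have ub n : cozero_base (@u n) by exact: (projT2 (cid (projT2 (cid (level_base n i))))).
exists I, u; split => //; split.
- move=> [n k]; apply: (continuous_compose (@level_proj_continuous R G n i)).
  by have [cu _ _ _] := ub n; exact: cu.
- by move=> [n k] z; have [_ u01 _ _] := ub n; exact: u01.
- move=> z U /hierarchy_nbhs[n [V [zV VU]]]; have [_ _ b _] := ub n.
  by have [k [kz kV]] := b _ _ zV; exists (Tagged I k); split => // x /= /kV; exact: VU.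
- move=> z z' zz'; have zE n : @level_proj R G n i z = @level_proj R G n i z'.
    by have [_ _ _ sep] := ub n; apply: sep => k; exact: (zz' (Tagged I k)).
  case: z z' {zz'} zE => [x t] [x' t'] zE; congr (_, _); first exact: (zE 0%N).
  by apply/functional_extensionality_dep => n; have [] := zE n.+1.
Qed.

(** The uniqueness half of Kolmogorov's extension theorem: sets pulled back from finite levels form
    a pi-system, which generates because the cozero base consists of such sets. *)
Lemma hierarchy_unique i (mu nu : Delta R (strat G (opponent i) * hierarchy G (opponent i))%type) :
  (forall n, marg (level_mfun G n i) mu = marg (level_mfun G n i) nu) -> mu = nu.
Proof.
move=> munu; have mlp n (B : set (borel (level G n i))) : measurable B -> measurable (@level_proj R G n i @^-1` B :
    set (borel (strat G (opponent i) * hierarchy G (opponent i))%type)).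
  by move=> mB; rewrite -[X in measurable X]setTI; exact: (continuous_borel (@level_proj_continuous R G n i)).
pose C := [set A : set (borel (strat G (opponent i) * hierarchy G (opponent i))%type) |
  exists n (B : set (borel (level G n i))), measurable B /\ A = @level_proj R G n i @^-1` B].
have [I [u [ub base]]] := hierarchy_base i.
(* Sets from two different levels are raised to a common one before being intersected. *)
have lift n k (B : set (borel (level G n i))) : measurable B ->
    exists B' : set (borel (level G (k + n) i)), measurable B' /\
    @level_proj R G n i @^-1` B = @level_proj R G (k + n) i @^-1` B'.
  move=> mB; elim: k => [|k [B' [mB' BB']]]; first by exists B.
  exists (fst @^-1` B'); split => //.
  rewrite -[X in measurable X]setTI.
  exact: (continuous_borel (@continuous_fst (level G (k + n) i) (Delta R (level G (k + n) (opponent i))))).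
apply: Delta_eq; apply: (@measure_unique _ R _ C (fun=> setT)).
- apply/seteqP; split => B.
    suff sub : @open (strat G (opponent i) * hierarchy G (opponent i))%type `<=` <<s C >>.
      by apply: smallest_sub => //; exact: smallest_sigma_algebra.
    move=> V oV; have [_ _ bV _] := base.
    rewrite (_ : V = \bigcup_(k : {n & I n}) (if `[< [set z | 0 < u _ (tagged k) (@level_proj R G (tag k) i z)] `<=` V >]
       then [set z | 0 < u _ (tagged k) (@level_proj R G (tag k) i z)] else set0)).
      rewrite bigcup_unpickle; apply: sigma_algebra_bigcup => k.
      apply: sub_sigma_algebra; case: (unpickle k) => [[n l]|]; last first.
        by exists 0%N, set0; rewrite preimage_set0.
      case: ifP => _; last by exists 0%N, set0; rewrite preimage_set0.
      exists n, [set x | 0 < u n l x]; split => //; have [cu _ _ _] := ub n.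
      by apply: (@open_measurable_borel _ [set x | 0 < u n l x]); exact: (@open_cozero R _ (u n l) 0).
    apply/seteqP; split => [z Vz|z [k _]]; last by case: ifP => // /asboolP kV kz; exact: kV.
    have [k [kz kV]] := bV z V (open_nbhs_nbhs (conj oV Vz)).
    by exists k => //; rewrite asboolT.
  apply: smallest_sub; first exact: sigma_algebra_measurable.
  by move=> _ [n [A [mA ->]]]; exact: mlp.
- move=> _ _ [n [A [mA ->]]] [n' [A' [mA' ->]]].
  have [B [mB ->]] := lift n n' A mA; have [B' [mB' ->]] := lift n' n A' mA'.
  move: B' mB'; rewrite addnC => B' mB'.
  by exists (n' + n)%N, (B `&` B'); split => //; exact: measurableI.
- by move=> _; exists 0%N, setT; split => //; rewrite preimage_setT.
- by rewrite bigcup_const.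
- move=> _ [n [A [mA ->]]]; have e1 := margE (level_mfun G n i) mu mA.
  by rewrite munu margE// in e1.
- by move=> _; rewrite [X in (X < _)%E](probability_setT mu) ltry.
Qed.

Variable f : forall i, strat G i -> Delta R (strat G (opponent i)).
Hypothesis mf : forall i (B : set (borel (strat G (opponent i)))), measurable B ->
  measurable_fun setT (fun s : borel (strat G i) => prb (f s) B).

(* The hierarchy of beliefs of the type "s believes f s, and opponents of
   strategy y have the type of y", computed level by level. *)
Fixpoint belief_level n i : strat G (opponent i) -> level G n i :=
  match n return strat G (opponent i) -> level G n i with
  | 0 => fun y => y
  | k.+1 => fun y => (belief_level k y, law (@belief_level k (opponent i)) (f y))
  end.

Definition type_of i (s : strat G i) : hierarchy G i := fun n => law (@belief_level n i) (f s).

Definition typed i (y : strat G (opponent i)) : (strat G (opponent i) * hierarchy G (opponent i))%type :=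
  (y, type_of y).

Definition type_belief i (s : strat G i) := law (@typed i) (f s).

Lemma level_proj_typed n i (y : strat G (opponent i)) :
  @level_proj R G n i (typed y) = belief_level n y.
Proof. by elim: n => //= n ->. Qed.

Lemma measurable_law (T U : ptopologicalType) (h : T -> U) d (S : measurableType d) (F : S -> Delta R T) :
  has_cozero_base R U -> measurable_fun setT (h : borel T -> borel U) ->
  (forall B : set (borel T), measurable B -> measurable_fun setT (fun s => prb (F s) B)) ->
  measurable_fun setT ((fun s => law h (F s)) : S -> borel (Delta R U)).
Proof.
move=> [I [u ub]] mh mF; apply: (measurable_Delta ub) => B mB.
rewrite (_ : (fun s => _) = fun s => prb (F s) (h @^-1` B)).
  by apply: mF; rewrite -[X in measurable X]setTI; exact: mh.
by apply/funext => s; rewrite /prb lawE.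
Qed.

Lemma measurable_belief_level n i :
  measurable_fun setT (@belief_level n i : borel (strat G (opponent i)) -> borel (level G n i)).
Proof.
elim: n i => [|n IH] i; first exact: measurable_id.
apply: measurable_pair_borel => //; [exact: level_base|apply: has_cozero_base_Delta; exact: level_base|].
apply: measurable_law => //; first exact: level_base.
by move=> B mB; exact: mf.
Qed.

Lemma measurable_typed i : measurable_fun setT
  (@typed i : borel (strat G (opponent i)) -> borel (strat G (opponent i) * hierarchy G (opponent i))%type).
Proof.
have [I [u [ub base]]] := hierarchy_base i; apply: (cozero_base_measurable base) => -[n k] /=.
rewrite (_ : [set s | _] = @belief_level n i @^-1` [set x | 0 < u n k x]).
  rewrite -[X in measurable X]setTI; apply: measurable_belief_level => //.
  have [cu _ _ _] := ub n.
  by apply: (@open_measurable_borel _ [set x | 0 < u n k x]); exact: (@open_cozero R _ (u n k) 0).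
by apply/seteqP; split => s /=; rewrite level_proj_typed.
Qed.

Lemma type_beliefE i (s : strat G i) n : marg (level_mfun G n i) (type_belief s) = type_of s n.
Proof.
apply: Delta_eq => A mA.
have mlA : measurable (@level_proj R G n i @^-1` A :
    set (borel (strat G (opponent i) * hierarchy G (opponent i))%type)).
  by rewrite -[X in measurable X]setTI; exact: (continuous_borel (@level_proj_continuous R G n i)).
rewrite margE//; apply: (etrans (lawE (f s) (@measurable_typed i) mlA)).
apply: etrans (esym (lawE (f s) (@measurable_belief_level n i) mA)).
by congr (Delta_prob _ _); apply/seteqP; split => y /=; rewrite level_proj_typed.
Qed.

(** [type_belief s] is an explicit extension of the hierarchy; uniqueness identifies it with the one
    chosen by [belief]. *)
Lemma belief_type_of i (s : strat G i) : belief (type_of s) = type_belief s.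
Proof.
apply: hierarchy_unique => n; rewrite type_beliefE /belief.
have := @getPex _ [set nu : Delta R (strat G (opponent i) * hierarchy G (opponent i))%type |
  forall n : nat, marg (level_mfun G n i) nu = type_of s n].
by apply; exists (type_belief s) => k; exact: type_beliefE.
Qed.

Lemma type_of_coherent i (s : strat G i) : coherent (type_of s).
Proof.
move=> n; apply: Delta_eq => A mA.
have mfA : measurable (fst @^-1` A : set (borel (level G n.+1 i))).
  rewrite -[X in measurable X]setTI.
  exact: (continuous_borel (@continuous_fst (level G n i) (Delta R (level G n (opponent i))))).
rewrite margE//; apply: (etrans (lawE (f s) (@measurable_belief_level n.+1 i) mfA)).
exact: esym (lawE (f s) (@measurable_belief_level n i) mA).
Qed.

(** The image measure lives on the graph of [typed] over [D]. The graph is Borel since the cozero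
    base separates points, so it is the required Borel subset even when [S] is not Borel. *)
Lemma type_belief_one i (s : strat G i) (D : set (borel (strat G (opponent i))))
    (S : set (strat G (opponent i) * hierarchy G (opponent i))%type) :
  measurable D -> prb (f s) D = 1 -> (forall y, D y -> S (typed y)) -> has_measure_one (type_belief s) S.
Proof.
move=> mD D1 DS; apply/has_measure_oneP.
have [I [u [ub base]]] := hierarchy_base i.
have mfst : measurable_fun setT (fst : borel (strat G (opponent i) * hierarchy G (opponent i))%type ->
    borel (strat G (opponent i))) by exact: (continuous_borel (@continuous_fst _ _)).
pose Gr : set (borel (strat G (opponent i) * hierarchy G (opponent i))%type) :=
  [set z | z = typed z.1] `&` fst @^-1` D.
have mGr : measurable Gr.
  apply: measurableI; last by rewrite -[X in measurable X]setTI; exact: mfst.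
  apply: (@measurable_eq_borel R (strat G (opponent i) * hierarchy G (opponent i))%type _
    (borel (strat G (opponent i) * hierarchy G (opponent i))%type) id).
  - by eexists; eexists; exact: base.
  - exact: measurable_id.
  - exact: (measurableT_comp (@measurable_typed i) mfst).
exists Gr => //; split; first by move=> z [-> /=]; exact: DS.
rewrite /prb (lawE (f s) (@measurable_typed i) mGr).
rewrite -D1; congr (fine (Delta_prob _ _)); apply/seteqP; split => y /=; first by move=> [].
by move=> Dy; split.
Qed.

Lemma type_of_types i (s : strat G i) : types (type_of s).
Proof.
suff h k : forall i (s : strat G i), types_upto k.+1 (type_of s) by move=> [|k] //= _; exact: h.
elim: k => [|k IH] {}i {}s; first exact: type_of_coherent.
split; first exact: type_of_coherent.
rewrite belief_type_of; apply: (@type_belief_one _ _ setT) => //; first exact: prbT.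
by move=> y _; exact: IH.
Qed.

Lemma type_of_RCB (D : forall i, set (borel (strat G i))) :
  (forall i, measurable (D i)) ->
  (forall i s, D i s -> best_response (s, f s) /\ prb (f s) (D (opponent i)) = 1) ->
  forall i, D i `<=` RCBR G i.
Proof.
move=> mD DP i s Ds; exists (type_of s); first exact: type_of_types.
suff h n : forall i s, D i s -> RCB n (s, type_of s) by move=> n; exact: h.
elim: n => [|n IH] {Ds s}i s Ds.
  split => /=; first exact: type_of_types.
  rewrite belief_type_of (_ : marg _ _ = f s); first by have [] := DP i s Ds.
  apply: Delta_eq => A mA.
  have mfA : measurable (fst @^-1` A : set (borel (strat G (opponent i) * hierarchy G (opponent i))%type)).
    by rewrite -[X in measurable X]setTI; exact: (continuous_borel (@continuous_fst _ _)).
  by rewrite margE//; exact: (lawE (f s) (@measurable_typed i) mfA).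
split; first exact: IH.
rewrite /= belief_type_of; have [_ D1] := DP i s Ds.
by apply: type_belief_one D1 _ => // y; exact: IH.
Qed.

End type_structure.

(** * Borel selections of best responses *)

Section mixture.
Context d d' (S : measurableType d) (T : measurableType d') (R : realType).
Variables (mu : probability S R) (F : S -> probability T R).
Hypothesis mF : forall A, measurable A -> measurable_fun setT (fun s => prb (F s) A).

Definition mixture (A : set T) : \bar R := \int[mu]_s F s A.

Let mF' A : measurable A -> measurable_fun setT (fun s => F s A).
Proof.
move=> mA; rewrite (_ : (fun s => _) = EFin \o (fun s => prb (F s) A)).
  by apply/measurable_EFinP; exact: mF.
by apply/funext => s; rewrite /= -prbE.
Qed.

Let mixture0 : mixture set0 = 0%E.
Proof. by rewrite /mixture; under eq_integral do rewrite measure0; rewrite integral0. Qed.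

Let mixture_ge0 A : (0 <= mixture A)%E.
Proof. exact: integral_ge0. Qed.

Let mixture_sigma_additive : semi_sigma_additive mixture.
Proof.
move=> A mA tA mUA; rewrite /mixture (_ : (\int[mu]_s F s (\bigcup_n A n))%E =
    (\int[mu]_s (\sum_(n <oo) F s (A n)))%E); last first.
  by apply: eq_integral => s _; rewrite measure_bigcup//; apply: eq_eseriesl => n; rewrite in_setT.
rewrite integral_nneseries//; last by move=> n; exact: mF'.
by apply: is_cvg_nneseries => n _ _; exact: integral_ge0.
Qed.

HB.instance Definition _ := isMeasure.Build _ _ _ mixture mixture0 mixture_ge0 mixture_sigma_additive.

Let mixture_setT : mixture setT = 1%E.
Proof.
rewrite /mixture; under eq_integral do rewrite probability_setT.
by rewrite integral_cst// mul1e; exact: probability_setT.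
Qed.

HB.instance Definition _ := Measure_isProbability.Build _ _ _ mixture mixture_setT.

Definition mixture_prob : probability T R := mixture.

(** The mixture of the complement is the integral of a nonnegative function, which vanishes exactly
    when the function is almost everywhere zero. *)
Lemma mixture_one A : measurable A ->
  prb mixture_prob A = 1 <-> prb mu [set s | prb (F s) A = 1] = 1.
Proof.
move=> mA; have mCA : measurable (~` A) by exact: measurableC.
have mZ : measurable [set s | prb (F s) A = 1].
  by rewrite -[X in measurable X]setTI; exact: (mF mA measurableT (measurable_set1 1)).
have -> : prb mixture_prob A = 1 <-> (\int[mu]_s `|F s (~` A)| = 0)%E.
  rewrite (_ : (\int[mu]_s `|F s (~` A)|)%E = mixture_prob (~` A)); last first.
    by apply: eq_integral => s _; rewrite gee0_abs.
  rewrite prbE// prb_setC//; split=> [->|[]]; first by rewrite subrr.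
  by move=> /eqP; rewrite subr_eq0 => /eqP.
rewrite ae_eq_integral_abs//; last exact: mF'.
have pE s : F s (~` A) = 0%E <-> prb (F s) A = 1.
  rewrite prbE// prb_setC//; split=> [[]|->]; last by rewrite subrr.
  by move=> /eqP; rewrite subr_eq0 => /eqP.
split=> [[N [mN N0 ZN]]|Z1].
  have ZN' : ~` [set s | prb (F s) A = 1] `<=` N.
    by move=> s ns; apply: ZN => /= h; apply: ns; apply/pE; exact: h.
  have := prb_le mu (measurableC mZ) mN ZN'; rewrite prb_setC// [X in _ <= X]/prb N0/= => Z1.
  by apply/eqP; rewrite eq_le prb_le1//=; lra.
exists (~` [set s | prb (F s) A = 1]); split; first exact: measurableC.
  rewrite [LHS](@prbE _ _ _ mu _ (measurableC mZ)).
  by rewrite prb_setC// Z1 subrr.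
by move=> s /= h /pE s1; apply: h.
Qed.

End mixture.

Lemma prb_bigcap1 d (T : measurableType d) (R : realType) (P : probability T R) (A : nat -> set T) :
  (forall k, measurable (A k)) -> (forall k, prb P (A k) = 1) -> prb P (\bigcap_k A k) = 1.
Proof.
move=> mA A1; have mI : measurable (\bigcap_k A k) by exact: bigcapT_measurable.
rewrite -[\bigcap_k A k]setCK prb_setC; last exact: measurableC.
rewrite setC_bigcap; suff -> : prb P (\bigcup_k ~` A k) = 0 by rewrite subr0.
apply/eqP; rewrite eq_le prb_ge0 andbT; apply: prb_bigcup_le => // k; first exact: measurableC.
by rewrite prb_setC// A1 subrr mul0r.
Qed.

Lemma prb_dirac (R : realType) (T : ptopologicalType) (y : borel T) (A : set (borel T)) :
  measurable A -> prb (to_Delta (dirac y : probability (borel T) R)) A = (y \in A)%:R.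
Proof. by move=> mA; rewrite /prb to_DeltaE// [X in fine X]diracE. Qed.

(** * Iterated selections along countably many measures *)

Section selections.
Context (R : realType) (G : game R) (Y : forall i, set (strat G i)).
Arguments Y : clear implicits.

Let Selection i (mu : Delta R (strat G i)) (D : set (borel (strat G i)))
    (f : strat G i -> Delta R (strat G (opponent i))) :=
  [/\ measurable D, prb mu D = 1,
      forall s, D s -> best_response (s, f s) /\ has_measure_one (f s) (Y (opponent i)) &
      forall B : set (borel (strat G (opponent i))), measurable B ->
        measurable_fun setT (fun s : borel (strat G i) => prb (f s) B)].

Hypothesis sel : forall i (mu : Delta R (strat G i)), has_measure_one mu (Y i) ->
  exists D f, Selection mu D f.
Hypothesis sandY : forall i (P : probability (borel (strat G i)) R), sandwiched P (Y i).
Hypothesis Ybr : forall i s, Y i s -> exists mu : Delta R (strat G (opponent i)),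
  best_response (s, mu) /\ has_measure_one mu (Y (opponent i)).

Let M := {mu : forall i, Delta R (strat G i) | forall i, has_measure_one (mu i) (Y i)}.

Let D (x : M) i : set (borel (strat G i)) := projT1 (cid (sel (svalP x i))).
Let f (x : M) i : strat G i -> Delta R (strat G (opponent i)) :=
  projT1 (cid (projT2 (cid (sel (svalP x i))))).
Arguments D : clear implicits.
Arguments f : clear implicits.

Let DfP (x : M) i : Selection (sval x i) (D x i) (f x i).
Proof. exact: (projT2 (cid (projT2 (cid (sel (svalP x i)))))). Qed.

Let mf (x : M) i (B : set (borel (strat G (opponent i)))) : measurable B ->
  measurable_fun setT (fun s : borel (strat G i) => prb (f x i s) B).
Proof. by have [_ _ _] := DfP x i; exact. Qed.

Let measurable_one (x : M) i (A : set (borel (strat G (opponent i)))) : measurable A ->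
  measurable [set s : borel (strat G i) | prb (f x i s) A = 1].
Proof.
move=> mA; have := @mf x i A mA measurableT [set 1] (measurable_set1 1).
by rewrite setTI; exact.
Qed.

(** The average of the beliefs selected at the strategies of i; it becomes the next measure on the
    opponent's strategies, which is why [next_mix] crosses the players. *)
Let mix (x : M) i : Delta R (strat G (opponent i)) :=
  to_Delta (@mixture_prob _ _ (borel (strat G i)) (borel (strat G (opponent i))) R
    (sval x i) (fun s => Delta_prob (f x i s)) (@mf x i)).

Let mix_one (x : M) i (A : set (borel (strat G (opponent i)))) : measurable A ->
  prb (mix x i) A = 1 <-> prb (sval x i) [set s | prb (f x i s) A = 1] = 1.
Proof.
move=> mA; rewrite -(@mixture_one _ _ (borel (strat G i)) (borel (strat G (opponent i))) R
  (sval x i) (fun s => Delta_prob (f x i s)) (@mf x i) A mA).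
by rewrite {1}/prb to_DeltaE.
Qed.

(** Y is only sandwiched, so the argument runs through its Borel superset [C]: almost every selected
    belief gives [C] measure one, hence so does the average, and [B] has the same measure. *)
Let mix_Y (x : M) i : has_measure_one (mix x i) (Y (opponent i)).
Proof.
have [B [C [mB mC BY YC BC]]] := sandY (mix x i : probability (borel (strat G (opponent i))) R).
apply/has_measure_oneP; exists B => //; split => //.
rewrite BC; apply/mix_one => //; have [mD D1 DP _] := DfP x i.
have mZ := @measurable_one x i C mC.
apply/eqP; rewrite eq_le prb_le1//= -[X in X <= _]D1; apply: prb_le => // s Ds /=.
have [_ /has_measure_oneP[A mA [AY A1]]] := DP s Ds.
apply/eqP; rewrite eq_le prb_le1//= -[X in X <= _]A1; apply: prb_le => //; exact: subset_trans YC.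
Qed.

Let next_mix (x : M) i : Delta R (strat G i) :=
  match i return Delta R (strat G i) with One => mix x Two | Two => mix x One end.

Let next_Y (x : M) i : has_measure_one (next_mix x i) (Y i).
Proof. by case: i; [exact: (@mix_Y x Two)|exact: (@mix_Y x One)]. Qed.

Let next (x : M) : M := exist
  (fun mu : forall i, Delta R (strat G i) => forall i, has_measure_one (mu i) (Y i))
  (next_mix x) (@next_Y x).

Let nextE (x : M) i : sval (next x) (opponent i) = mix x i. Proof. by case: i. Qed.

(* What l rounds of trimming leave of the k-th selection: the strategies whose
   selected belief is concentrated on what l - 1 rounds leave of the next one. *)
Let E (x : M) := fix E l k i : set (borel (strat G i)) := match l with
  | 0 => D (iter k next x) i
  | l'.+1 => E l' k i `&` [set s | prb (f (iter k next x) i s) (E l' k.+1 (opponent i)) = 1]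
  end.
Arguments E : clear implicits.

Let measurable_E (x : M) l k i : measurable (E x l k i).
Proof.
elim: l k i => [|l IH] k i /=; first by have [] := DfP (iter k next x) i.
by apply: measurableI; [exact: IH|exact: (@measurable_one _ _ _ (IH k.+1 (opponent i)))].
Qed.

(** By induction the next trimmed set has full measure for the average of the selected beliefs, so
    almost every belief is concentrated on it and one more trimming removes a null set. *)
Let E_one (x : M) l k i : prb (sval (iter k next x) i) (E x l k i) = 1.
Proof.
elim: l k i => [|l IH] k i; first by have [] := DfP (iter k next x) i.
have mZ := @measurable_one (iter k next x) i _ (@measurable_E x l k.+1 (opponent i)).
have mm : prb (mix (iter k next x) i) (E x l k.+1 (opponent i)) = 1.
  by rewrite -nextE; exact: (IH k.+1 (opponent i)).
have Z1 := (@mix_one (iter k next x) i _ (@measurable_E x l k.+1 (opponent i))).1 mm.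
by rewrite -[RHS](IH k i); exact: (prb_setI1 (@measurable_E x l k i) mZ Z1).
Qed.

Let E' (x : M) k i : set (borel (strat G i)) := \bigcap_l E x l k i.
Arguments E' : clear implicits.

Let measurable_E' (x : M) k i : measurable (E' x k i).
Proof. by apply: bigcapT_measurable => l; exact: measurable_E. Qed.

Let E'_next (x : M) k i (s : strat G i) : E' x k i s -> prb (f (iter k next x) i s) (E' x k.+1 (opponent i)) = 1.
Proof. by by move=> Es; apply: prb_bigcap1 => // l; have [] := Es l.+1 I. Qed.

(** The 0-th measures are Dirac masses, and a set of full Dirac measure contains its point, so the
    given strategy survives all trimming. Beliefs on the k-th trimmed set live on the next, so the
    union over k is closed under them. *)
Lemma global_selection i0 (s0 : strat G i0) : Y i0 s0 ->
  exists (B : forall i, set (borel (strat G i))) (h : forall i, strat G i -> Delta R (strat G (opponent i))),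
  [/\ forall i, measurable (B i), B i0 s0,
      forall i (A : set (borel (strat G (opponent i)))), measurable A ->
        measurable_fun setT (fun s : borel (strat G i) => prb (h i s) A) &
      forall i s, B i s -> best_response (s, h i s) /\ prb (h i s) (B (opponent i)) = 1].
Proof.
move=> Ys0; have [y [Yy ys0]] : exists y : forall i, strat G i, (forall i, Y i (y i)) /\ y i0 = s0.
  have [mu [_ /has_measure_oneP[A mA [AY A1]]]] := Ybr Ys0.
  have [t At] : A !=set0.
    by apply/set0P/eqP => A0; move: A1; rewrite A0 /prb measure0 => /eqP; rewrite eq_sym oner_eq0.
  case: i0 s0 Ys0 mu A mA AY A1 t At => s0 Ys0 mu A mA AY A1 t At.
    exists (fun i => match i return strat G i with One => s0 | Two => t end); split => // -[] //; exact: AY.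
  exists (fun i => match i return strat G i with One => t | Two => s0 end); split => // -[] //; exact: AY.
pose m0 i : Delta R (strat G i) := to_Delta (dirac (y i : borel (strat G i))).
have d1 i : has_measure_one (m0 i) (Y i).
  have [B [C [mB mC BY YC BC]]] := sandY (Delta_prob (m0 i)).
  have C1 : prb (m0 i) C = 1 by rewrite (prb_dirac _ _ mC) mem_set//; exact: YC.
  by apply/has_measure_oneP; exists B => //; split => //; exact: (etrans BC C1).
pose x : M := exist (fun mu : forall i, Delta R (strat G i) => forall i, has_measure_one (mu i) (Y i)) _ d1.
(* The first index whose trimmed set contains s decides; off all of them the default 0 still leaves
   [h] measurable. *)
pose h i (s : strat G i) := f (iter (least [set k | E' x k i s]) next x) i s.
exists (fun i => \bigcup_k E' x k i), h; split.
- by move=> i; exact: bigcupT_measurable.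
- exists 0%N => //; have : prb (sval x i0) (E' x 0 i0) = 1.
    by apply: prb_bigcap1 => l; [exact: measurable_E|exact: (@E_one x l 0 i0)].
  rewrite /= (prb_dirac _ _ (@measurable_E' x 0 i0)) ys0.
  by case: (boolP (_ \in _)) => [/set_mem//|_ /eqP]; rewrite eq_sym oner_eq0.
- move=> i A mA; apply: measurable_fun_gt => q.
  rewrite (_ : [set s | _] = \bigcup_k ([set s | least [set k | E' x k i s] = k] `&`
      [set s | q < prb (f (iter k next x) i s) A])).
    apply: bigcupT_measurable => k; apply: measurableI.
      exact: (cmeas_least (S := fun k => E' x k i)).
    rewrite -[X in measurable X]setTI (_ : [set s | _] =
      (fun s => prb (f (iter k next x) i s) A) @^-1` `]q, +oo[%classic); last first.
      by apply/seteqP; split => s /=; rewrite in_itv/= andbT.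
    by apply: mf => //; exact: measurable_itv.
  apply/seteqP; split => s /=; last by move=> [k _ [<-]].
  by move=> qs; exists (least [set k | E' x k i s]).
- move=> i s [k _ Eks]; pose l := least [set k | E' x k i s].
  have [Es _] : E' x l i s /\ _ := leastP (ex_intro (fun k => E' x k i s) k Eks).
  have Es0 : D (iter l next x) i s by have := Es 0%N I.
  have h1 := E'_next Es.
  split; first by have [_ _ DP _] := DfP (iter l next x) i; have [] := DP s Es0.
  apply/eqP; rewrite eq_le prb_le1//=; last by apply: bigcupT_measurable => k'; exact: measurable_E'.
  rewrite -[X in X <= _]h1; apply: prb_le; first exact: measurable_E'.
    by apply: bigcupT_measurable => k'; exact: measurable_E'.
  by move=> t Et; exists l.+1.
Qed.

End selections.

(** * Rationalizability and common belief in rationality *)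

Section rationalizability.
Context (R : realType) (G : game R).

(** Every stage contains a Borel set of full measure, and the countable intersection of these
    projects into RCBR. As RCBR is a projection, this gives outer measure one only. *)
Lemma RCBR_weak_br i (s : strat G i) : RCBR G i s ->
  exists mu : Delta R (strat G (opponent i)),
    best_response (s, mu) /\ weak_support mu (@RCBR R G (opponent i)).
Proof.
move=> [t _ tR]; exists (marg fst_mfun (belief t)); split; first by have [] := tR 0%N.
move=> B mB RB; have mfB : measurable (fst @^-1` B :
    set (borel (strat G (opponent i) * hierarchy G (opponent i))%type)).
  by rewrite -[X in measurable X]setTI; exact: (continuous_borel (@continuous_fst _ _)).
rewrite prb_marg//.
have /choice[A AP] : forall n : nat, exists A : set (borel (strat G (opponent i) * hierarchy G (opponent i))%type),
    [/\ measurable A, A `<=` @RCB R G n (opponent i) & prb (belief t) A = 1].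
  by move=> n; have [_ /has_measure_oneP[A mA [AR A1]]] := tR n.+1; exists A.
have mA n : measurable (A n) by have [] := AP n.
have A1 : prb (belief t) (\bigcap_n A n) = 1 by apply: prb_bigcap1 => // n; have [] := AP n.
apply/eqP; rewrite eq_le prb_le1//= -[X in X <= _]A1; apply: prb_le => //.
  exact: bigcapT_measurable.
move=> [y t'] Ay; apply: RB; have RA n : @RCB R G n (opponent i) (y, t') by have [_ AR _] := AP n; exact: AR (Ay n I).
by exists t' => //; have [] := RA 0%N.
Qed.

Lemma RAT_eq_RCBR m j : Pi1_determinacy m.+1 -> (j.+1.*2 <= m)%N ->
  (forall (phi1 : baire -> space1 G) (phi2 : baire -> space2 G), continuous phi1 -> continuous phi2 ->
    forall i q, let A := [set w : NN | q < pay G i (phi1 (slice 0 w), phi2 (slice 1 w))] in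
    Sig j.+1.*2 A /\ Pi j.+1.*2 A) ->
  forall i, RAT G i = RCBR G i.
Proof.
move=> det jm payP.
pose c i := cid (polish_coding (@strat_polish R G i)).
pose phi i : baire -> strat G i := projT1 (c i).
pose g i : borel (strat G i) -> NN := projT1 (cid (projT2 (c i))).
have phigP i : [/\ continuous (phi i), measurable_fun setT (g i) & forall x, phi i (g i x) = x].
  exact: (projT2 (cid (projT2 (c i)))).
have cphi i : continuous (phi i) by have [] := phigP i.
have mg i : measurable_fun setT (g i) by have [] := phigP i.
have phig i x : phi i (g i x) = x by have [_ _] := phigP i; exact.
have mjoin i : measurable_fun setT (fun z : NN * NN =>
    (match i with One => join2 z.1 z.2 | Two => join2 z.2 z.1 end) : NN) by case: i; mtac.
have setE i q : [set z : NN * NN | q < payoff (i := i) (phi i z.1) (phi (opponent i) z.2)] =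
    (fun z : NN * NN => (match i with One => join2 z.1 z.2 | Two => join2 z.2 z.1 end) : NN) @^-1`
    [set w : NN | q < pay G i (phi One (slice 0 w), phi Two (slice 1 w))].
  by apply/seteqP; split => z; case: i => /=; rewrite !slice_join.
have pay_Sig i q : Sig j.*2.+2 [set z : NN * NN | q < payoff (i := i) (phi i z.1) (phi (opponent i) z.2)].
  by rewrite setE; apply: Sig_preimage => //; have [] := payP _ _ (cphi One) (cphi Two) i q.
have pay_Pi i q : Pi j.*2.+2 [set z : NN * NN | q < payoff (i := i) (phi i z.1) (phi (opponent i) z.2)].
  by rewrite setE; apply: Pi_preimage => //; have [] := payP _ _ (cphi One) (cphi Two) i q.
have [Y [SY Ybr Ymax]] := largest_br_family cphi mg phig det jm pay_Sig pay_Pi.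
have YRCBR i : Y i = RCBR G i.
  apply/seteqP; split => s; last by apply: (Ymax (fun i => RCBR G i)) => k t; exact: RCBR_weak_br.
  move=> Ys; have sandY k (P : probability (borel (strat G k)) R) : sandwiched P (Y k).
    have nm : (j.*2.+2 <= m.+1)%N by move: jm; rewrite doubleS; lia.
    exact: (@decoded_sandwiched R _ _ _ (mg k) (phig k) m det j.*2.+2 P (Y k) nm (SY k)).
  have sel := br_selection cphi mg phig det jm pay_Sig pay_Pi SY Ybr.
  have [B [h [mB Bs mh BP]]] := global_selection sel sandY Ybr Ys.
  exact: (type_of_RCB mh mB BP Bs).
move=> i; rewrite -YRCBR; apply: RAT_largest => //.
move=> Y' Y'br; apply: Ymax => k s /Y'br[mu [br m1]]; exists mu; split => //.
move=> B mB Y'B; have [A mA [AY A1]] := (has_measure_oneP _ _).1 m1.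
apply/eqP; rewrite eq_le prb_le1//= -[X in X <= _]A1; apply: prb_le => //.
exact: subset_trans Y'B.
Qed.

End rationalizability.

Lemma continuous_split2 (T U : topologicalType) (f : baire -> T) (g : baire -> U) :
  continuous f -> continuous g -> continuous (fun w : baire => (f (slice 0 w), g (slice 1 w))).
Proof.
move=> cf cg; apply: continuous_pair.
  exact: (continuous_compose (@continuous_sliceT 0) cf).
exact: (continuous_compose (@continuous_sliceT 1) cg).
Qed.

(** The sets whose preimage is both Sigma and Pi at level 2 form a sigma-algebra containing the
    analytic sets. *)
Lemma analytically_measurable_Sig (R : realType) (T : ptopologicalType) (f : T -> R) (psi : baire -> T) q :
  analytically_measurable f -> continuous psi ->
  Sig 2 [set w : NN | q < f (psi w)] /\ Pi 2 [set w : NN | q < f (psi w)].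
Proof.
move=> af cpsi; pose C := [set A : set T | Sig 2 (psi @^-1` A : set NN) /\ Pi 2 (psi @^-1` A : set NN)].
suff sub : <<s @analytic T >> `<=` C.
  apply: (sub [set x | q < f x]); apply: (af [set y | q < y]).
  by apply: sub_sigma_algebra; exact: open_gt.
apply: smallest_sub.
  split; first by split; rewrite preimage_set0; [exact: measurable_Sig|exact: measurable_Pi].
    move=> A [SA PA]; rewrite setTD; split; first exact: PA.
    by rewrite /Pi /= -preimage_setC setCK.
  move=> A AC; split; first by rewrite preimage_bigcup; apply: Sig_bigcup => k; have [] := AC k.
  by rewrite /Pi /= preimage_bigcup setC_bigcup; apply: Sig_bigcap => k; have [] := AC k.
move=> A aA; have S1 := Sigma1_Sig cpsi aA.
by split; [exact: Sig_subS|exact: Sig_sub_Pi].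
Qed.

Lemma polish_real (R : realType) : polish R R.
Proof.
split.
  exists (range (@ratr R)); first exact: (sub_countable (card_image_le _ _) (countableP _)).
  move=> U [x Ux] oU; have /(@nbhs_ballP _ R^o)[e /= e0 eU] : nbhs x U by apply: open_nbhs_nbhs.
  have /rat_in_itvoo[q] : x < x + e by lra.
  rewrite in_itv/= => /andP[q1 q2]; exists (ratr q); split; last by exists q.
  by apply: eU; rewrite /ball/= ltr_norml; apply/andP; split; lra.
exists (fun x y => `|x - y|); split.
- split => [x y|x y|x y|x y z].
  + exact: normr_ge0.
  + split=> [/eqP|->]; last by rewrite subrr normr0.
    by rewrite normr_eq0 subr_eq0 => /eqP.
  + exact: distrC.
  + exact: ler_distD.
- by move=> x U; rewrite -(@nbhs_ballE _ R^o); split => -[e /= e0 eU]; exists e.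
- move=> u uC; apply/cvg_ex; apply/(@cauchy_cvgP R^o)/cauchyP => e e0.
  by have [N NP] := uC e e0; exists (u N); exists N => // n /= Nn; exact: NP.
Qed.

(** The value of f is unique, so it can be quantified existentially both in a strict inequality and
    in its negation. *)
Lemma projective_fun_Sig (R : realType) (T : topologicalType) (f : T -> R) n :
  Sigma1 n.+1 [set p : (T * R)%type | p.2 = f p.1] ->
  forall (psi : baire -> T) q, continuous psi ->
  Sig n.+1 [set w : NN | q < f (psi w)] /\ Pi n.+1 [set w : NN | q < f (psi w)].
Proof.
move=> Sf psi q cpsi; have [chi [chi' [cchi _ chiK]]] := polish_coding (polish_real R).
have SC : Sig n.+1 [set z : NN * NN | chi z.2 = f (psi z.1)].
  have := Sigma1_Sig (continuous_split2 cpsi cchi) Sf.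
  have mj : measurable_fun setT (fun z : NN * NN => join2 z.1 z.2 : NN) by mtac.
  move=> /(Sig_preimage mj); congr (Sig _ _); apply/seteqP; split => z /=; by rewrite !slice_join.
have mchi : measurable_fun setT (chi : NN -> borel R) by exact: continuous_borel.
have mlt : measurable [set z : NN * NN | q < chi z.2].
  have mlt' : measurable [set w : NN | q < chi w].
    by apply: (@open_measurable_borel baire [set w | q < chi w]); exact: (open_preimage cchi (@open_gt R q)).
  by rewrite -[X in measurable X]setTI; exact: (@measurable_snd _ _ NN NN measurableT _ mlt').
split.
  rewrite (_ : [set w | _] = [set w | exists v, ([set z : NN * NN | chi z.2 = f (psi z.1)] `&`
      [set z : NN * NN | q < chi z.2]) (w, v)]).
    by apply: Sig_proj; apply: Sig_setI => //; exact: measurable_Sig.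
  apply/seteqP; split => w /=; last by move=> [v [<-]].
  by move=> qw; exists (chi' (f (psi w))); rewrite chiK.
rewrite /Pi /= (_ : ~` _ = [set w | exists v, ([set z : NN * NN | chi z.2 = f (psi z.1)] `&`
    ~` [set z : NN * NN | q < chi z.2]) (w, v)]).
  by apply: Sig_proj; apply: Sig_setI => //; apply: measurable_Sig; exact: measurableC.
apply/seteqP; split => w /=; last by move=> [v [<-]].
by move=> qw; exists (chi' (f (psi w))); rewrite chiK.
Qed.

Theorem theorem2 (R : realType) :
  (Pi1_determinacy 3 ->
     forall G : game R,
       (forall i : player, analytically_measurable (pay G i)) ->
       forall i : player, RAT G i = RCBR G i) /\
  (projective_determinacy ->
     forall G : game R,
       (forall i : player, projective_fun (pay G i)) ->
       forall i : player, RAT G i = RCBR G i).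
Proof.
split=> [det G aG|det G pG].
  (* With j = 0 the payoffs are at level 2, and m = 2 asks for determinacy at level m + 1 = 3. *)
  apply: (@RAT_eq_RCBR R G 2 0 det) => // phi1 phi2 c1 c2 i q.
  exact: analytically_measurable_Sig (aG i) (continuous_split2 c1 c2).
have [n nP] : exists n, forall i (psi : baire -> space1 G * space2 G) q, continuous psi ->
    Sig n [set w : NN | q < pay G i (psi w)] /\ Pi n [set w : NN | q < pay G i (psi w)].
  have [n1 P1] := pG One; have [n2 P2] := pG Two; exists (maxn n1 n2).+1 => -[] psi q cpsi.
    have [S P] := projective_fun_Sig P1 q cpsi.
    by split; [apply: Sig_le S|apply: Pi_le P]; rewrite ltnS leq_maxl.
  have [S P] := projective_fun_Sig P2 q cpsi.
  by split; [apply: Sig_le S|apply: Pi_le P]; rewrite ltnS leq_maxr.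
(* Raising the payoffs from level n to the even level 2(n + 1) meets the parity in [RAT_eq_RCBR];
   determinacy is taken one level above. *)
have det' : Pi1_determinacy n.+1.*2.+1.
  move=> A PA; apply: det; exists n.+1.*2.+1; exists (fst @^-1` A).
    exact: (Sigma1_preimage (@continuous_fst _ _) PA).
  by rewrite fst_image; apply/seteqP; split => [x Ax|x [y]//]; exists point.
apply: (RAT_eq_RCBR det' (leqnn _)) => phi1 phi2 c1 c2 i q.
have [S P] := nP i _ q (continuous_split2 c1 c2).
have le : (n <= n.+1.*2)%N by rewrite -addnn; lia.
by split; [exact: Sig_le S|exact: Pi_le P].
Qed.
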